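(* Assume that $\mathcal K$ satisfies (Dim) and that every definable subset of $K$ that is closed, bounded and discrete is finite. Let $X\subseteq K^m$ be a definable set and let $\tau$ be a non-zero element of $K$. (1) If $|\tau|\ne|1|$ then the set $\mathcal C_k(X,\tau^{\mathbb Z})$ is definable in $(\mathcal C(X),\mathcal B)$ for every integer $k\ge2$, hence so is $\mathcal C_{\ge2}(X,\tau^{\mathbb Z})$. If moreover $\mathcal K$ satisfies (Z), the same holds true for $k\ge1$ (that is, $\mathcal C_k(X,\tau^{\mathbb Z})$ is definable for every $k\ge1$, hence so is $\mathcal C_{\ge1}(X,\tau^{\mathbb Z})$). (2) If $K$ has a total order $\preccurlyeq$ compatible with $+$ and definable in $\mathcal L_{\rm ring}\cup\{\mathcal O\}$, then the set $\mathcal C_k(X,\tau\mathbb Z)$ is definable in $(\mathcal C(X),\mathcal B)$ for every integer $k\ge2$, hence so is $\mathcal C_{\ge2}(X,\tau\mathbb Z)$.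
   Context: Setting. $K$ is a field and $\mathcal O\subseteq K$ is either (ordered case) the unit interval $[-1,1]$ of a total order $\le$ making $K$ an ordered field, or (valued case) the valuation ring of a non-trivial valuation $v$ on $K$. $\mathcal K$ is an expansion of $(K,\mathcal O)$: a structure with universe $K$ in a language extending the ring language $\mathcal L_{\rm ring}=\{0,1,+,-,\times\}$ together with a unary predicate for $\mathcal O$. ''Definable'' means first-order definable with parameters (in $\mathcal K$ for subsets of $K^m$). $\mathcal O^\times$ is the set of non-zero $a\in\mathcal O$ with $a^{-1}\in\mathcal O$; $|x|$ is the class of $x\in K^\times$ in $K^\times/\mathcal O^\times$, $|0|=0$, and $|y|\le|x|$ iff $y\in x\mathcal O$. For $x\in K^m$, $\|x\|=\max_i|x_i|$; $K^m$ carries the topology given by the open balls for $\|\cdot\|$; ''bounded'' is with respect to $\|\cdot\|$. For definable $X\subseteq K^m$, $\mathcal C(X)$ is the ring (pointwise operations) of continuous definable functions $X\to K$; $\mathcal B=\{s\in\mathcal C(X): s(x)\in\mathcal O\ \forall x\in X\}$; $(\mathcal C(X),\mathcal B)$ is the ring expanded by a unary predicate for $\mathcal B$. Dimension. A coordinate projection $K^m\to K^r$ is a map $x\mapsto(x_i)_{i\in I}$ with $I\subseteq\{1,\dots,m\}$ of size $r\ge0$. The dimension $\dim X$ of a non-empty $X\subseteq K^m$ is the maximal $r\le m$ such that $\pi(X)$ has non-empty interior for some coordinate projection $\pi:K^m\to K^r$; $\dim\emptyset=-\infty$. The local dimension is $\dim(X,x)=\min\{\dim(B\cap X): B\text{ an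 open ball centered at }x\}$. $\Delta_d(X)=\{x\in X:\dim(X,x)=d\}$. $W_d(X)$ is the set of $x\in X$ for which there are an open ball $B$ centered at $x$ and a coordinate projection $\pi:K^m\to K^d$ restricting to a homeomorphism from $B\cap X$ onto an open subset of $K^d$. Write $\partial X=\overline X\setminus X$. $\mathcal K$ satisfies (Dim) if for every definable set $X\subseteq K^m$ and every definable map $f:X\to K^r$: (Dim1) $\dim f(X)\le\dim X$; (Dim2) $\dim X=\dim\overline X$, and if $X\ne\emptyset$ then $\dim\partial X<\dim X$; (Dim3) if $\dim X=d\ge0$ then $\dim(X\setminus W_d(X))<d$. $\mathcal K$ satisfies (Z) if (in the valued case) the value group $v(K^\times)$ is elementarily equivalent to $(\mathbb Z,+,\le)$ and for every definable set $X\subseteq K^\times$, $v(X)$ is definable in the ordered group $v(K^\times)$. For $k\ge0$ and $Y\subseteq K$, $\mathcal C_k(X,Y)$ (resp. $\mathcal C_{\ge k}(X,Y)$) is the set of $f\in\mathcal C(X)$ such that $f(x)\in Y$ for every $x\in\Delta_k(X)$ (resp. $x\in\bigcup_{l\ge k}\Delta_l(X)$) and $f(x)=0$ for all other $x\in X$. $\tau^{\mathbb Z}=\{\tau^k:k\in\mathbb Z\}$, $\tau\mathbb Z=\{k\tau:k\in\mathbb Z\}$. A total order $\preccurlyeq$ on $K$ is compatible with $+$ if $x\preccurlyeq y$ implies $x+z\preccurlyeq y+z$. *)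

(* Defs.v *)
From HB Require Import structures.
From mathcomp Require Import all_boot all_order all_algebra.
From mathcomp Require Import all_classical constructive_ereal topology ring.

Set Implicit Arguments.
Unset Strict Implicit.
Unset Printing Implicit Defensive.

Import Order.TTheory GRing.Theory Num.Theory.

Local Open Scope classical_set_scope.
Local Open Scope ring_scope.

Record language := Language {
  fsym : Type; farity : fsym -> nat;
  rsym : Type; rarity : rsym -> nat }.

(* The free variables of a term or formula are indexed by 'I_n. *)
Inductive term (L : language) (n : nat) :=
| TVar of 'I_n
| TApp (f : fsym L) of ('I_(farity f) -> term L n).

(* In [FEx phi], the bound variable of [phi] has index 0. *)
Inductive formula (L : language) : nat -> Type :=
| FEq n of term L n & term L n : formula L n
| FRel n (r : rsym L) of ('I_(rarity r) -> term L n) : formula L n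
| FNot n of formula L n : formula L n
| FAnd n of formula L n & formula L n : formula L n
| FEx n of formula L n.+1 : formula L n.

Record structure (L : language) (M : Type) := Structure {
  finterp : forall f : fsym L, 'rV[M]_(farity f) -> M;
  rinterp : forall r : rsym L, 'rV[M]_(rarity r) -> Prop }.

Fixpoint eval L M (S : structure L M) n (e : 'rV[M]_n) (t : term L n) : M :=
  match t with
  | TVar i => e 0 i
  | TApp f ts => finterp S (\row_i eval S e (ts i))
  end.

Fixpoint holds L M (S : structure L M) n (phi : formula L n) :
    'rV[M]_n -> Prop :=
  match phi in formula _ n return 'rV[M]_n -> Prop with
  | FEq _ t u => fun e => eval S e t = eval S e u
  | FRel _ r ts => fun e => rinterp S (\row_i eval S e (ts i))
  | FNot _ phi => fun e => ~ holds S phi e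
  | FAnd _ phi psi => fun e => holds S phi e /\ holds S psi e
  | FEx n phi => fun e =>
      exists a : M, holds S phi (row_mx (const_mx a : 'rV[M]_1) e)
  end.

(* The entries of [b] are the parameters. *)
Definition definable L M (S : structure L M) n (A : set 'rV[M]_n) : Prop :=
  exists p (phi : formula L (n + p)) (b : 'rV[M]_p),
    A = [set x | holds S phi (row_mx x b)].

Definition definable1 L M (S : structure L M) (A : set M) : Prop :=
  definable S [set x : 'rV[M]_1 | A (x 0 0)].

(* Sentences are formulas in 0 variables; 'rV_0 has exactly one element. *)
Definition elem_equiv L M N (S : structure L M) (T : structure L N) : Prop :=
  forall (phi : formula L 0) (d : 'rV[M]_0) (e : 'rV[N]_0),
    holds S phi d <-> holds T phi e.

Definition lang_sum (L L' : language) : language :=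
  Language (fun f : fsym L + fsym L' =>
              match f with inl f => farity f | inr f => farity f end)
           (fun r : rsym L + rsym L' =>
              match r with inl r => rarity r | inr r => rarity r end).

Definition struct_sum L L' M (S : structure L M) (S' : structure L' M) :
    structure (lang_sum L L') M :=
  @Structure (lang_sum L L') M
    (fun f => match f return 'rV[M]_(@farity (lang_sum L L') f) -> M with
              | inl f => finterp S (f := f) | inr f => finterp S' (f := f) end)
    (fun r => match r return 'rV[M]_(@rarity (lang_sum L L') r) -> Prop with
              | inl r => rinterp S (r := r) | inr r => rinterp S' (r := r) end).

Variant ring_fsym := RZero | ROne | RAdd | RSub | RMul.

Definition ring_farity (f : ring_fsym) : nat :=
  match f with RZero | ROne => 0 | _ => 2 end.

Definition Lringpred : language :=
  Language ring_farity (fun _ : unit => 1%N).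

Definition ringpred (R : pzRingType) (P : set R) : structure Lringpred R :=
  @Structure Lringpred R
    (fun f => match f return 'rV[R]_(ring_farity f) -> R with
              | RZero => fun=> 0
              | ROne => fun=> 1
              | RAdd => fun x => x 0 0 + x 0 1
              | RSub => fun x => x 0 0 - x 0 1
              | RMul => fun x => x 0 0 * x 0 1
              end)
    (fun _ x => P (x 0 0)).

(* The language {+, <=}. *)
Definition Logroup : language :=
  Language (fun _ : unit => 2%N) (fun _ : unit => 2%N).

Definition ogroup (G : porderZmodType) : structure Logroup G :=
  @Structure Logroup G (fun _ x => x 0 0 + x 0 1) (fun _ x => x 0 0 <= x 0 1).

(* [vval] is the valuation on non-zero elements; its value at 0 is irrelevant.
   By [vval_surj], [vgroup] is the value group. *)
Record valuation (K : fieldType) := Valuation {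
  vgroup : porderZmodType;
  vgroup_total : total (<=%O : rel vgroup);
  vgroup_leD : forall x y z : vgroup, x <= y -> x + z <= y + z;
  vval : K -> vgroup;
  vvalM : forall x y, x != 0 -> y != 0 -> vval (x * y) = vval x + vval y;
  vvalD : forall x y, x != 0 -> y != 0 -> x + y != 0 ->
    vval x <= vval y -> vval x <= vval (x + y);
  vval_surj : forall g, exists2 x, x != 0 & vval x = g;
  vval_nontriv : exists2 x, x != 0 & vval x != 0 }.

Inductive ovField :=
| OrderedField of realFieldType
| ValuedField (F : fieldType) of valuation F.

Definition ovfield (K : ovField) : fieldType :=
  match K with OrderedField F => F | ValuedField F _ => F end.

Definition ovsort (K : ovField) : Type := ovfield K.
Coercion ovsort : ovField >-> Sortclass.

HB.instance Definition _ (K : ovField) := GRing.Field.on (ovsort K).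

Definition OO (K : ovField) : set (ovsort K) :=
  match K return set (ovsort K) with
  | OrderedField F => [set x : F | -1 <= x <= 1]
  | ValuedField F v => [set x : F | x = 0 \/ 0 <= vval v x]
  end.
Arguments OO : clear implicits.

Definition OOunit (K : ovField) : set K :=
  [set a : K | [/\ a != 0, OO K a & OO K a^-1]].
Arguments OOunit : clear implicits.

Section Abs.
Variable K : ovField.
Implicit Types (x y : K) (m : nat).

(* [abseq], [absle] and [abslt] compare the classes |x| and |y|; they behave
   as expected when x or y is 0. *)
Definition abseq x y : Prop := exists2 u, OOunit K u & x = y * u.
Definition absle x y : Prop := exists2 a, OO K a & x = y * a.
Definition abslt x y : Prop := absle x y /\ ~ abseq x y.

(* The open ball of centre [a] and radius |r|, for r != 0. *)
Definition oball m (a : 'rV[K]_m) (r : K) : set 'rV[K]_m :=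
  [set x | forall i, abslt (x 0 i - a 0 i) r].

Definition ovbounded (A : set K) : Prop :=
  exists r, forall x, A x -> absle x r.

End Abs.

Section ValuationTheory.
Variables (F : fieldType) (v : valuation F).
Local Notation w := (vval v).
Local Notation G := (vgroup v).
Implicit Types (x y : F) (g h : G).

Let leD g h k : (g + k <= h + k) = (g <= h).
Proof.
apply/idP/idP => [|/vgroup_leD //].
by move=> /vgroup_leD-/(_ (- k)); rewrite !addrK.
Qed.

Lemma vval1 : w 1 = 0.
Proof.
have /eqP := vvalM v (oner_neq0 F) (oner_neq0 F).
by rewrite mulr1 -[X in X == _]addr0 => /eqP/addrI.
Qed.

Lemma vvalV x : x != 0 -> w x^-1 = - w x.
Proof.
move=> x0; apply: (addrI (w x)).
by rewrite -vvalM ?invr_eq0// mulfV// vval1 subrr.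
Qed.

Lemma vvalN x : w (- x) = w x.
Proof.
have [->|x0] := eqVneq x 0; first by rewrite oppr0.
have N1 : (-1 : F) != 0 by rewrite oppr_eq0 oner_eq0.
suff N10 : w (-1) = 0 by rewrite -mulN1r vvalM// N10 add0r.
have e : w (-1) + w (-1) = 0 by rewrite -vvalM// mulrNN mulr1 vval1.
have /orP[h|h] := vgroup_total (w (-1)) 0.
- by apply/le_anti; rewrite h -e -[X in _ <= X]add0r leD h.
- by apply/le_anti; rewrite h andbT -e -[X in X <= _]add0r leD h.
Qed.

Lemma vltNge g h : (g < h) = ~~ (h <= g).
Proof.
rewrite lt_neqAle; have /orP[gh|hg] := vgroup_total g h.
  by rewrite gh andbT eq_le gh.
by rewrite hg andbC eq_le hg andbT; case: (g <= h).
Qed.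

Lemma absle_valuedE (x y : ValuedField v) : y != 0 ->
  absle x y <-> (x = 0 \/ w y <= w x).
Proof.
move=> y0; split.
- move=> [a /= [->|a0] ->]; first by left; rewrite mulr0.
  have [->|an0] := eqVneq a 0; first by left; rewrite mulr0.
  by right; rewrite vvalM// -[X in X <= _]add0r [X in _ <= X]addrC leD.
- move=> [->|yx]; first by exists 0; [left|rewrite mulr0].
  have [->|x0] := eqVneq x 0; first by exists 0; [left|rewrite mulr0].
  exists (x / y); last by rewrite mulrC divfK.
  right; rewrite vvalM ?invr_eq0// vvalV//.
  by rewrite -(leD _ _ (w y)) add0r subrK.
Qed.

Lemma abslt_valuedE (x y : ValuedField v) : y != 0 ->
  abslt x y <-> (x = 0 \/ w y < w x).
Proof.
move=> y0; split.
- move=> [/absle_valuedE -/(_ y0)[->|yx] nxy]; first by left.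
  have [->|x0] := eqVneq x 0; first by left.
  right; rewrite vltNge; apply/negP => xy; apply: nxy; exists (x / y).
    split; rewrite ?mulf_neq0 ?invr_eq0//=; right.
      by rewrite vvalM ?invr_eq0// vvalV// -(leD _ _ (w y)) add0r subrK.
    by rewrite invf_div vvalM ?invr_eq0// vvalV// -(leD _ _ (w x)) add0r subrK.
  by rewrite mulrC divfK.
- move=> [->|yx].
    split; first by apply/absle_valuedE => //; left.
    by move=> [u [u0 _ _] /esym/eqP]; rewrite mulf_eq0 (negPf y0) (negPf u0).
  split; first by apply/absle_valuedE => //; right; apply: ltW.
  move=> [u [u0 _ [/eqP|]]]; first by rewrite invr_eq0 (negPf u0).
  rewrite vvalV// => u1 xyu; move: yx; rewrite xyu vvalM// vltNge => /negP; apply.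
  rewrite -(leD _ _ (w u)) in u1; rewrite add0r addNr in u1.
  by rewrite addrC -[X in _ <= X]add0r leD.
Qed.

End ValuationTheory.

Section OrderedTheory.
Variable F : realFieldType.
Implicit Types x y : OrderedField F.

Lemma absle_orderedE x y : absle x y <-> `|x : F| <= `|y : F|.
Proof.
split.
- move=> [a /= a1 ->]; rewrite normrM ler_piMr//.
  by rewrite ler_norml.
- have [->|y0] := eqVneq y 0.
    rewrite normr0 normr_le0 => /eqP ->; exists 0; last by rewrite mulr0.
    by rewrite /= lerN10 ler01.
  move=> xy; exists (x / y); last by rewrite mulrC divfK.
  rewrite /= -ler_norml (_ : `|_| = `|x : F| / `|y : F|); last exact: normf_div.
  by rewrite ler_pdivrMr ?normr_gt0// mul1r.
Qed.

Lemma abslt_orderedE x y : abslt x y <-> `|x : F| < `|y : F|.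
Proof.
split.
- move=> [/absle_orderedE]; rewrite le_eqVlt => /orP[/eqP xy []|//].
  have [y0|y0] := eqVneq y 0.
    move/eqP: xy; rewrite y0 normr0 normr_eq0 => /eqP ->; exists 1.
      by split; rewrite ?oner_neq0// ?invr1 /= -ler_norml normr1.
    by rewrite mul0r.
  have x0 : (x : F) != 0 by rewrite -normr_eq0 xy normr_eq0.
  exists (x / y); last by rewrite mulrC divfK.
  split; first by rewrite mulf_neq0 ?invr_eq0.
    rewrite /= -ler_norml (_ : `|_| = `|x : F| / `|y : F|); last exact: normf_div.
    by rewrite xy divff ?normr_eq0.
  rewrite /= -ler_norml invf_div.
  rewrite (_ : `|_| = `|y : F| / `|x : F|); last exact: normf_div.
  by rewrite xy divff ?normr_eq0.
- move=> xy; split; first by apply/absle_orderedE/ltW.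
  move=> [u [/= u0 u1 u2] xyu]; move: xy.
  suff -> : x = y * u :> F.
    rewrite normrM ltNge => /negP; apply; rewrite ler_peMr//.
    move: u2; rewrite -ler_norml normfV invf_le1// normr_gt0//.
  by [].
Qed.

End OrderedTheory.

Section AbsTheory.
Variable K : ovField.
Implicit Types x y r s : K.

Lemma abslt0 r : r != 0 -> abslt 0 r.
Proof.
case: K r => [F|F v] r r0; last by apply/abslt_valuedE => //; left.
by apply/abslt_orderedE; rewrite normr0 normr_gt0.
Qed.

Lemma absltN x r : r != 0 -> abslt x r -> abslt (- x) r.
Proof.
case: K x r => [F|F v] x r r0.
  by move=> /abslt_orderedE xr; apply/abslt_orderedE; rewrite normrN.
move=> /(abslt_valuedE _ r0) xr; apply/abslt_valuedE => //.
by case: xr => [->|xr]; [left; rewrite oppr0|right; rewrite vvalN].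
Qed.

Lemma abslt_min r s : r != 0 -> s != 0 -> exists2 t : K, t != 0 &
  forall x, abslt x t -> abslt x r /\ abslt x s.
Proof.
case: K r s => [F|F v] r s r0 s0.
  have [rs|sr] := leP `|r : F| `|s : F|.
  - exists r => // x /abslt_orderedE xt; split; apply/abslt_orderedE => //.
    exact: lt_le_trans rs.
  - exists s => // x /abslt_orderedE xt; split; apply/abslt_orderedE => //.
    exact: lt_trans sr.
have /orP[rs|sr] := vgroup_total (vval v r) (vval v s).
- exists s => // x /(abslt_valuedE _ s0) xt; split; apply/abslt_valuedE => //.
  by case: xt => xt; [left|right; exact: le_lt_trans xt].
- exists r => // x /(abslt_valuedE _ r0) xt; split; apply/abslt_valuedE => //.
  by case: xt => xt; [left|right; exact: le_lt_trans xt].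
Qed.

Lemma abslt_split r : r != 0 -> exists2 s : K, s != 0 &
  forall x y, abslt x s -> abslt y s -> abslt (x + y) r.
Proof.
case: K r => [F|F v] r r0.
  have r20 : (r : F) / 2 != 0 by rewrite mulf_neq0 ?invr_eq0 ?pnatr_eq0.
  exists ((r : F) / 2); first exact: r20.
  move=> x y /abslt_orderedE xs /abslt_orderedE ys; apply/abslt_orderedE.
  apply: (le_lt_trans (ler_normD (x : F) (y : F))); rewrite (splitr `|r : F|).
  have e : `|(r : F) / 2| = `|r : F| / 2 by rewrite normrM normfV [`|2%:R|]ger0_norm ?ler0n.
  by apply: ltrD; rewrite -e.
exists r => // x y /(abslt_valuedE _ r0) xs /(abslt_valuedE _ r0) ys.
apply/abslt_valuedE => //.
have [x0|x0] := eqVneq x 0; first by rewrite x0 add0r.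
have [y0|y0] := eqVneq y 0; first by rewrite y0 addr0.
have [xy0|xy0] := eqVneq (x + y) 0; [by left|right].
case: xs => [/eqP|xs]; first by rewrite (negPf x0).
case: ys => [/eqP|ys]; first by rewrite (negPf y0).
have /orP[xy|yx] := vgroup_total (vval v x) (vval v y).
  by apply: (lt_le_trans xs); exact: (@vvalD F v x y).
rewrite addrC in xy0 *.
by apply: (lt_le_trans ys); exact: (@vvalD F v y x).
Qed.

Lemma abslt_scale a x r : a != 0 -> abslt x r -> abslt (a * x) (a * r).
Proof.
move=> a0 [[o Oo ->] ne]; split; first by exists o; rewrite ?mulrA.
move=> [u Ou]; rewrite -[RHS]mulrA => /(mulfI a0) e.
by apply: ne; exists u.
Qed.

Lemma abslt_mulO x y r : r != 0 -> abslt x r -> OO K y -> abslt (x * y) r.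
Proof.
case: K x y r => [F|F v] x y r r0.
  move=> /abslt_orderedE xr /=; rewrite -ler_norml => y1.
  apply/abslt_orderedE; apply: le_lt_trans xr.
  by rewrite normrM ler_piMr.
move=> /(abslt_valuedE _ r0) xr yO; apply/abslt_valuedE => //.
have [->|x0] := eqVneq x 0; first by left; rewrite mul0r.
have [->|y0] := eqVneq y 0; first by left; rewrite mulr0.
case: xr => [/eqP|xr]; first by rewrite (negPf x0).
case: yO => [/eqP|yO]; first by rewrite (negPf y0).
right; apply: (lt_le_trans xr).
by rewrite vvalM// -[X in X <= _]add0r [X in _ <= X]addrC vgroup_leD.
Qed.

End AbsTheory.

Section Uniform.
Local Open Scope relation_scope.
Variable K : ovField.

Definition ov_ent : set_system (K * K) :=
  filter_from [set r : K | r != 0]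
    (fun r => [set xy : K * K | abslt (xy.2 - xy.1) r]).

Lemma ov_ent_filter : Filter ov_ent.
Proof.
apply: filter_from_filter => [|r s r0 s0]; first by exists 1; exact: oner_neq0.
have [t t0 tP] := abslt_min r0 s0.
by exists t => // -[x y] /= /tP.
Qed.

Lemma ov_ent_refl A : ov_ent A -> diagonal `<=` A.
Proof.
move=> [r /= r0 sA] [x y] /= /diagonalP xy; apply: sA => /=.
by rewrite xy subrr; exact: abslt0.
Qed.

Lemma ov_ent_inv A : ov_ent A -> ov_ent A^-1.
Proof.
move=> [r /= r0 sA]; exists r => // -[x y] /= xy; apply: sA => /=.
by rewrite -opprB; exact: absltN.
Qed.

Lemma ov_ent_split A : ov_ent A -> exists2 B, ov_ent B & B \; B `<=` A.
Proof.
move=> [r /= r0 sA]; have [s s0 sP] := abslt_split r0.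
exists [set xy : K * K | abslt (xy.2 - xy.1) s]; first by exists s.
move=> [x y] /= [z /= xz zy]; apply: sA => /=.
by rewrite -(subrK z y) -addrA; exact: sP.
Qed.

End Uniform.

HB.instance Definition _ (K : ovField) := isUniform.Build (ovsort K)
  (@ov_ent_filter K) (@ov_ent_refl K) (@ov_ent_inv K) (@ov_ent_split K).

Section Topology.
Variable K : ovField.

Lemma nbhs_ovE (x : K) (A : set K) :
  nbhs x A <-> exists2 r : K, r != 0 & [set y | abslt (y - x) r] `<=` A.
Proof.
rewrite -nbhs_entourageE; split.
  move=> [B [r r0 sB] BA]; exists r => // y yx; apply: BA.
  by apply/xsectionP/sB.
move=> [r r0 sA]; exists [set xy : K * K | abslt (xy.2 - xy.1) r].
  by exists r.
by move=> y /xsectionP /sA.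
Qed.

(* The library's topology on matrices is, for row vectors over [K], the one
   given by the open balls. *)
Lemma nbhs_oballE m (x : 'rV[K]_m) (A : set 'rV[K]_m) :
  nbhs x A <-> exists2 r : K, r != 0 & oball x r `<=` A.
Proof.
split.
- move=> [P nP sA].
  have rP i : {r : K | r != 0 & [set y | abslt (y - x 0 i) r] `<=` P 0 i}.
    by apply: cid2; apply/nbhs_ovE; exact: nP.
  have [r r0 rmin] : exists2 r : K, r != 0 &
      forall y i, i \in enum 'I_m -> abslt y r -> abslt y (s2val (rP i)).
    elim: (enum 'I_m) => [|j s [r r0 IH]]; first by exists 1; rewrite ?oner_neq0.
    have [t t0 tP] := abslt_min r0 (s2valP (rP j)).
    exists t => // y i; rewrite inE => /orP[/eqP -> /tP[]//|js /tP[yr _]].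
    exact: IH.
  exists r => // y xy; apply: sA => i j; rewrite ord1.
  by apply: (s2valP' (rP j)); apply: rmin; [exact: mem_enum|exact: xy].
- move=> [r r0 sA].
  exists (fun i j => [set y | abslt (y - x i j) r]).
    by move=> i j; apply/nbhs_ovE; exists r.
  by move=> y yP; apply: sA => i; exact: yP.
Qed.

Lemma ov_continuousB (T : topologicalType) (f g : T -> K) :
  continuous f -> continuous g -> continuous (f - g : T -> K).
Proof.
move=> cf cg t A /(nbhs_ovE (f t - g t))[r r0 sA]; have [s s0 sP] := abslt_split r0.
have nf : nbhs (f t) [set y | abslt (y - f t) s] by apply/nbhs_ovE; exists s.
have ng : nbhs (g t) [set y | abslt (y - g t) s] by apply/nbhs_ovE; exists s.
have {}nf : \forall z \near t, abslt (f z - f t) s by exact: (cf t _ nf).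
have {}ng : \forall z \near t, abslt (g z - g t) s by exact: (cg t _ ng).
change (\forall z \near t, A (f z - g z)).
near=> z; apply: sA => /=.
rewrite (_ : _ - _ = (f z - f t) + - (g z - g t)); last by rewrite /=; ring.
apply: sP; first by near: z.
by apply: absltN => //; near: z.
Unshelve. all: by end_near. Qed.

Lemma ov_continuousM (T : topologicalType) (f g : T -> K) :
  continuous f -> continuous g -> continuous (f * g : T -> K).
Proof.
move=> cf cg t A /(nbhs_ovE (f t * g t))[r r0 sA]; have [s s0 sP] := abslt_split r0.
have [s' s'0 s'P] := abslt_split s0.
have nr (h : T -> K) (ch : continuous h) (u : K) : u != 0 ->
    \forall z \near t, abslt (h z - h t) u.
  move=> u0; have nu : nbhs (h t) [set y | abslt (y - h t) u].
    by apply/nbhs_ovE; exists u.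
  exact: (ch t _ nu).
have scale (h : T -> K) (ch : continuous h) (a : K) (u : K) : u != 0 ->
    \forall z \near t, abslt (a * (h z - h t)) u.
  move=> u0; have [->|a0] := eqVneq a 0.
    by apply: nearW => z; rewrite mul0r; exact: abslt0.
  have ua0 : a^-1 * u != 0 by rewrite mulf_neq0 ?invr_eq0.
  apply: filterS (nr h ch _ ua0) => z /(abslt_scale a0).
  by rewrite mulVKf.
change (\forall z \near t, A (f z * g z)).
near=> z; apply: sA => /=.
rewrite (_ : _ - _ = ((f z - f t) * (g z - g t) + f t * (g z - g t))
                     + g t * (f z - f t)).
  apply: sP; last by near: z; exact: scale.
  apply: s'P; last by near: z; exact: scale.
  apply: abslt_mulO => //; first by near: z; exact: nr.
  suff : abslt (g z - g t) 1 by move=> [[a Oa ->] _]; rewrite mul1r.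
  by near: z; apply: nr => //; exact: oner_neq0.
by rewrite /=; ring.
Unshelve. all: by end_near. Qed.

End Topology.

Section Renaming.
Variable L : language.

Definition lift_ren n k (s : 'I_n -> 'I_k) (i : 'I_n.+1) : 'I_k.+1 :=
  if unlift ord0 i is Some j then lift ord0 (s j) else ord0.

Fixpoint rename_term n k (s : 'I_n -> 'I_k) (t : term L n) : term L k :=
  match t with
  | TVar i => TVar L (s i)
  | TApp f ts => TApp (fun i => rename_term s (ts i))
  end.

Fixpoint rename n (phi : formula L n) : forall k, ('I_n -> 'I_k) -> formula L k :=
  match phi in formula _ n return forall k, ('I_n -> 'I_k) -> formula L k with
  | FEq _ t u => fun _ s => FEq (rename_term s t) (rename_term s u)
  | FRel _ r ts => fun _ s => FRel (fun i => rename_term s (ts i))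
  | FNot _ phi => fun _ s => FNot (rename phi s)
  | FAnd _ phi psi => fun _ s => FAnd (rename phi s) (rename psi s)
  | FEx _ phi => fun _ s => FEx (rename phi (lift_ren s))
  end.

Variables (M : Type) (S : structure L M).

Lemma eval_rename n k (s : 'I_n -> 'I_k) (t : term L n) (e : 'rV[M]_k) :
  eval S e (rename_term s t) = eval S (\row_i e 0 (s i)) t.
Proof.
elim: t => [i|f ts IH] /=; first by rewrite mxE.
by congr finterp; apply/rowP => i; rewrite !mxE.
Qed.

Lemma holds_rename n (phi : formula L n) k (s : 'I_n -> 'I_k) (e : 'rV[M]_k) :
  holds S (rename phi s) e <-> holds S phi (\row_i e 0 (s i)).
Proof.
elim: phi k s e => {n} [n t u|n r ts|n phi IH|n phi IHphi psi IHpsi|n phi IH]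
  k s e /=.
- by rewrite !eval_rename.
- suff -> : \row_i eval S e (rename_term s (ts i)) =
            \row_i eval S (\row_i e 0 (s i)) (ts i) by [].
  by apply/rowP => i; rewrite !mxE eval_rename.
- by rewrite IH.
- by rewrite IHphi IHpsi.
- suff E a : \row_i (row_mx (const_mx a : 'rV_1) e) 0 (lift_ren s i) =
             row_mx (const_mx a : 'rV_1) (\row_i e 0 (s i)).
    by split=> -[a H]; exists a; [move/IH: H; rewrite E|apply/IH; rewrite E].
  apply/rowP => i; rewrite !mxE /lift_ren.
  case: unliftP => [j|] ->.
    have -> : lift ord0 j = rshift 1 j :> 'I_(1 + n) by apply: val_inj.
    have -> : lift ord0 (s j) = rshift 1 (s j) :> 'I_(1 + k) by apply: val_inj.
    by rewrite !(unsplitK (inr _)) !mxE.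
  have -> : ord0 = lshift n 0 :> 'I_(1 + n) by apply: val_inj.
  have -> : ord0 = lshift k 0 :> 'I_(1 + k) by apply: val_inj.
  by rewrite !(unsplitK (inl _)) !mxE.
Qed.

End Renaming.

Section Definable.
Variables (L : language) (M : Type) (S : structure L M).

Lemma definable_formula n (phi : formula L n) :
  definable S [set x | holds S phi x].
Proof.
exists 0%N, (rename phi (lshift 0)), 
  (\row_(i < 0) False_rect M (notF (ltn_ord i))).
apply/seteqP; split=> x /=; rewrite holds_rename;
  congr holds; apply/rowP => i; rewrite !mxE (unsplitK (inl _)) //.
Qed.

Lemma definableI n (A B : set 'rV[M]_n) :
  definable S A -> definable S B -> definable S (A `&` B).
Proof.
move=> [p [phi [b ->]]] [q [psi [c ->]]].
pose s (i : 'I_(n + p)) : 'I_(n + (p + q)) :=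
  match fintype.split i with inl j => lshift _ j | inr j => rshift n (lshift q j) end.
pose t (i : 'I_(n + q)) : 'I_(n + (p + q)) :=
  match fintype.split i with inl j => lshift _ j | inr j => rshift n (rshift p j) end.
exists (p + q)%N, (FAnd (rename phi s) (rename psi t)), (row_mx b c).
have es x : \row_i row_mx x (row_mx b c) 0 (s i) = row_mx x b.
  apply/rowP => i; rewrite !mxE /s; case: (fintype.split i) => j.
    by rewrite (unsplitK (inl _)).
  by rewrite (unsplitK (inr _)) mxE (unsplitK (inl _)).
have et x : \row_i row_mx x (row_mx b c) 0 (t i) = row_mx x c.
  apply/rowP => i; rewrite !mxE /t; case: (fintype.split i) => j.
    by rewrite (unsplitK (inl _)).
  by rewrite (unsplitK (inr _)) mxE (unsplitK (inr _)).
by apply/seteqP; split=> x /=; rewrite !holds_rename es et.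
Qed.

Lemma definable_preim n k (s : 'I_n -> 'I_k) (A : set 'rV[M]_n) :
  definable S A -> definable S [set x : 'rV[M]_k | A (\row_i x 0 (s i))].
Proof.
move=> [p [phi [b ->]]].
pose t (i : 'I_(n + p)) : 'I_(k + p) :=
  match fintype.split i with inl j => lshift _ (s j) | inr j => rshift k j end.
exists p, (rename phi t), b.
have et x : \row_i row_mx x b 0 (t i) = row_mx (\row_i x 0 (s i)) b.
  apply/rowP => i; rewrite !mxE /t; case: (fintype.split i) => j.
    by rewrite (unsplitK (inl _)) mxE.
  by rewrite (unsplitK (inr _)).
by apply/seteqP; split=> x /=; rewrite holds_rename et.
Qed.

Lemma definable_ex n (A : set 'rV[M]_(1 + n)) : definable S A ->
  definable S [set x : 'rV[M]_n | exists a, A (row_mx (const_mx a) x)].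
Proof.
move=> [p [phi [b ->]]]; exists p, (FEx (phi : formula L (n + p).+1)), b.
suff E x a : row_mx (row_mx (const_mx a : 'rV_1) x) b =
    row_mx (const_mx a : 'rV_1) (row_mx x b) :> 'rV[M]_(1 + (n + p)).
  by apply/seteqP; split=> x [a /= H]; exists a; rewrite -?E// E.
apply/rowP => i; case: (@fintype.splitP 1 (n + p) i) => j ij; last case: (fintype.splitP j) => k jk.
- rewrite (_ : i = lshift (n + p) j); last exact: val_inj.
  rewrite [RHS]row_mxEl; set i' := lshift _ _.
  have -> : i' = lshift p (lshift n j) :> 'I_(1 + n + p) by exact: val_inj.
  exact: etrans (row_mxEl (row_mx _ x) b 0 _) (row_mxEl _ _ _ _).
- rewrite (_ : i = rshift 1 (lshift p k)); last by apply: val_inj; rewrite /= ij jk.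
  rewrite [RHS]row_mxEr row_mxEl; set i' := rshift _ _.
  have -> : i' = lshift p (rshift 1 k) :> 'I_(1 + n + p) by exact: val_inj.
  exact: etrans (row_mxEl (row_mx _ x) b 0 _) (row_mxEr _ _ _ _).
- rewrite (_ : i = rshift 1 (rshift n k)); last by apply: val_inj; rewrite /= ij jk.
  rewrite [RHS]row_mxEr row_mxEr; set i' := rshift _ _.
  have -> : i' = rshift (1 + n) k :> 'I_(1 + n + p) by exact: val_inj.
  exact: row_mxEr (row_mx _ x) b 0 _.
Qed.

End Definable.

(* Every language extending {0, 1, +, -, *, O} is, up to renaming of symbols,
   of the form [lang_sum Lringpred L]. *)
Definition expansion (K : ovField) (L : language) (S : structure L K) :
    structure (lang_sum Lringpred L) K :=
  struct_sum (ringpred (OO K)) S.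

Definition definable_map (K : ovField) (L : language) (S : structure L K) m r
    (X : set 'rV[K]_m) (f : X -> 'rV[K]_r) : Prop :=
  definable S [set row_mx (val x) (f x) | x in [set: X]].

Definition definable_fun (K : ovField) (L : language) (S : structure L K) m
    (X : set 'rV[K]_m) (f : X -> K) : Prop :=
  definable_map S (fun x => const_mx (f x) : 'rV[K]_1).

Section DefinableFun.
Variables (K : ovField) (L : language) (S : structure L K) (m : nat).
Variable X : set 'rV[K]_m.
Local Notation KK := (expansion S).

Let G (f : X -> K) : set 'rV[K]_(m + 1) :=
  [set row_mx (val x) (const_mx (f x) : 'rV[K]_1) | x in [set: X]].

Let GP (f : X -> K) (z : 'rV[K]_(m + 1)) (x : X) :
  lsubmx z = val x -> (G f z <-> z 0 (rshift m 0) = f x).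
Proof.
move=> zx; split.
  move=> [y _ yz]; rewrite -yz row_mxEr mxE.
  suff -> : x = y by [].
  by apply: val_inj; rewrite -zx -yz row_mxKl.
move=> zf; exists x => //; rewrite -[RHS]hsubmxK zx; congr row_mx.
by apply/rowP => i; rewrite !mxE ord1 zf.
Qed.

Let Gdom (f : X -> K) z : G f z -> exists x : X, lsubmx z = val x.
Proof. by move=> [x _ <-]; exists x; rewrite row_mxKl. Qed.

Lemma definable_fun_op (op : K -> K -> K) (g h : X -> K) :
    (forall n (t u : term (lang_sum Lringpred L) n), exists w, forall e,
       eval KK e w = op (eval KK e t) (eval KK e u)) ->
  definable_fun KK g -> definable_fun KK h ->
  definable_fun KK (fun x => op (g x) (h x)).
Proof.
move=> opP dg dh.
have dG (k : X -> K) : definable_fun KK k = definable KK (G k) by [].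
rewrite dG; pose n := (1 + (1 + (m + 1)))%N.
pose s0 : 'I_n := ord0.
pose s1 : 'I_n := rshift 1 (lshift (m + 1) 0).
pose s2 (i : 'I_(m + 1)) : 'I_n := rshift 1 (rshift 1 i).
pose sel (c : 'I_n) (i : 'I_(m + 1)) : 'I_n :=
  match fintype.split i with inl j => s2 (lshift 1 j) | inr _ => c end.
pose E (a b : K) (z : 'rV[K]_(m + 1)) : 'rV[K]_n :=
  row_mx (const_mx a : 'rV_1) (row_mx (const_mx b : 'rV_1) z).
have E0 a b z : E a b z 0 s0 = a.
  have -> : s0 = lshift (1 + (m + 1)) 0 by exact: val_inj.
  by rewrite row_mxEl mxE.
have E1 a b z : E a b z 0 s1 = b by rewrite row_mxEr row_mxEl mxE.
have E2 a b z i : E a b z 0 (s2 i) = z 0 i by rewrite !row_mxEr.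
have Esel a b z c :
    \row_i E a b z 0 (sel c i) = row_mx (lsubmx z) (const_mx (E a b z 0 c) : 'rV_1).
  apply/rowP => i; rewrite [LHS]mxE [RHS]mxE /sel.
  case: (fintype.split i) => j; first by rewrite E2 [RHS]mxE.
  by rewrite [RHS]mxE.
have [w wP] := opP _ (TVar (lang_sum Lringpred L) s0) (TVar _ s1).
have dA : definable KK ([set e : 'rV[K]_n | G g (\row_i e 0 (sel s0 i))] `&`
    ([set e : 'rV[K]_n | G h (\row_i e 0 (sel s1 i))] `&`
     [set e | holds KK (FEq (TVar _ (s2 (rshift m 0))) w) e])).
  apply: definableI; first exact: definable_preim.
  apply: definableI; first exact: definable_preim.
  exact: definable_formula.
have := definable_ex (definable_ex dA).
congr definable; apply/seteqP; split => [z [b [a [Ga [Hb zw]]]]|z Gz].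
- have {}Ga : G g (\row_i E a b z 0 (sel s0 i)) := Ga.
  have {}Hb : G h (\row_i E a b z 0 (sel s1 i)) := Hb.
  have {zw} : E a b z 0 (s2 (rshift m 0)) = eval KK (E a b z) w := zw.
  rewrite wP E2 [eval _ _ _]E0 [eval _ _ _]E1 => zw.
  have [x] := Gdom Ga; rewrite Esel row_mxKl => zx.
  apply/(GP _ zx); rewrite zw.
  have lx c : lsubmx (row_mx (lsubmx z) (const_mx c : 'rV[K]_1)) = val x.
    by rewrite row_mxKl.
  move: Ga Hb; rewrite !Esel E0 E1 => /(GP _ (lx a)) <- /(GP _ (lx b)) <-.
  by rewrite !row_mxEr !mxE.
- have [x zx] := Gdom Gz; move/(GP _ zx): Gz => zx'.
  have lx c : lsubmx (row_mx (lsubmx z) (const_mx c : 'rV[K]_1)) = val x.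
    by rewrite row_mxKl.
  exists (h x), (g x).
  suff : (G g (\row_i E (g x) (h x) z 0 (sel s0 i)) /\
    (G h (\row_i E (g x) (h x) z 0 (sel s1 i)) /\
     E (g x) (h x) z 0 (s2 (rshift m 0)) = eval KK (E (g x) (h x) z) w)) by [].
  rewrite !Esel E0 E1; split; last split.
  + by apply/(GP _ (lx _)); rewrite row_mxEr mxE.
  + by apply/(GP _ (lx _)); rewrite row_mxEr mxE.
  + by rewrite wP E2 [eval _ _ (TVar _ s0)]E0 [eval _ _ (TVar _ s1)]E1.
Qed.

Lemma definable_fun1 : definable KK X -> definable_fun KK (1 : X -> K).
Proof.
move=> dX.
have dA : definable KK ([set z : 'rV[K]_(m + 1) | X (\row_i z 0 (lshift 1 i))] `&`
    [set z | holds KK (FEq (TVar _ (rshift m 0))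
       (TApp (f := inl ROne : fsym (lang_sum Lringpred L))
          (fun i : 'I_0 => False_rect _ (notF (ltn_ord i))))) z]).
  by apply: definableI; [exact: definable_preim|exact: definable_formula].
have := dA; congr definable; apply/seteqP; split => z.
- have e : \row_i z 0 (lshift 1 i) = lsubmx z by apply/rowP => i; rewrite !mxE.
  move=> [/=]; rewrite e => Xz z1.
  by apply/(@GP 1 z (SigSub (mem_set Xz))).
- move=> Gz; have [x zx] := Gdom Gz; move/(GP _ zx): Gz => z1; split => //=.
  rewrite (_ : \row_i _ = val x); first exact: set_valP.
  by rewrite -zx; apply/rowP => i; rewrite !mxE.
Qed.

End DefinableFun.

Record defset (K : ovField) (L : language) (S : structure L K) (m : nat) :=
  DefSet { dset :> set 'rV[K]_m; dsetP : definable S dset }.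

Section CDFun.
Variables (K : ovField) (L : language) (S : structure L K) (m : nat).
Variable X : defset (expansion S) m.

Definition cdfun_pred : {pred (dset X -> K)} :=
  [pred f : dset X -> K |
    `[< continuous f /\ definable_fun (expansion S) f >]].

Lemma cdfun_subring_closed : subring_closed cdfun_pred.
Proof.
split.
- apply/asboolP; split; first exact: (@cst_continuous _ _ (1 : K)).
  by apply: definable_fun1; exact: dsetP.
- move=> f g /asboolP[cf df] /asboolP[cg dg]; apply/asboolP; split.
    exact: ov_continuousB.
  apply: (definable_fun_op (op := fun x y => x - y)) df dg => n t u.
  exists (TApp (f := inl RSub : fsym (lang_sum Lringpred L))
            (fun i : 'I_2 => if i == 0 then t else u)) => e.
  by rewrite /= !mxE.
- move=> f g /asboolP[cf df] /asboolP[cg dg]; apply/asboolP; split.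
    exact: ov_continuousM.
  apply: (definable_fun_op (op := fun x y => x * y)) df dg => n t u.
  exists (TApp (f := inl RMul : fsym (lang_sum Lringpred L))
            (fun i : 'I_2 => if i == 0 then t else u)) => e.
  by rewrite /= !mxE.
Qed.

(* C(X), with the pointwise ring structure inherited from [dset X -> K]. *)
Record cdfun := CDFun { cdval :> dset X -> K; _ : cdval \in cdfun_pred }.

HB.instance Definition _ := [isSub for cdval].
HB.instance Definition _ := [Choice of cdfun by <:].
HB.instance Definition _ := GRing.SubChoice_isSubComPzRing.Build
  (dset X -> K) cdfun_pred cdfun cdfun_subring_closed.

Definition cdbounded : set cdfun := [set s | forall x, OO K (s x)].

Definition cdring : structure Lringpred cdfun := ringpred cdbounded.

End CDFun.

Section Dimension.
Variable K : ovField.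
Implicit Types m d : nat.

Definition coord_proj m (I : {set 'I_m}) (x : 'rV[K]_m) : 'rV[K]_#|I| :=
  \row_j x 0 (enum_val j).

Definition natdim d : \bar int := (d%:Z)%:E.

Definition tdim m (X : set 'rV[K]_m) : \bar int :=
  if X == set0 then -oo%E
  else natdim (\max_(I : {set 'I_m} |
                      `[< (coord_proj I @` X)° !=set0 >]) #|I|).

(* The default value [-oo] is never used: the minimum exists. *)
Definition tldim m (X : set 'rV[K]_m) (x : 'rV[K]_m) : \bar int :=
  let D := [set tdim (oball x r `&` X) | r in [set r : K | r != 0]] in
  xget -oo%E (D `&` lbound D).

Definition Delta d m (X : set 'rV[K]_m) : set 'rV[K]_m :=
  [set x | X x /\ tldim X x = natdim d].

Definition homeo_on (T U : topologicalType) (A : set T) (B : set U)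
    (f : T -> U) : Prop :=
  exists g : U -> T,
    [/\ f @` A = B, {in A, cancel f g},
        {within A, continuous f} & {within B, continuous g}].

Definition Wset d m (X : set 'rV[K]_m) : set 'rV[K]_m :=
  [set x | X x /\ exists (r : K) (I : {set 'I_m}) (U : set 'rV[K]_#|I|),
    [/\ r != 0, #|I| = d, open U & homeo_on (oball x r `&` X) U (coord_proj I)]].

Definition frontier m (X : set 'rV[K]_m) : set 'rV[K]_m := closure X `\` X.

Variables (L : language) (S : structure L K).

Definition condDim : Prop :=
  forall m (X : set 'rV[K]_m), definable S X ->
  [/\ forall r (f : X -> 'rV[K]_r), definable_map S f ->
        (tdim (range f) <= tdim X)%E,
      tdim X = tdim (closure X) /\
        (X !=set0 -> (tdim (frontier X) < tdim X)%E)
    & forall d, tdim X = natdim d -> (tdim (X `\` Wset d X) < natdim d)%E].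

End Dimension.

(* (Z) is a condition on valued fields; an ordered field does not satisfy it. *)
Definition condZ (K : ovField) (L : language) : structure L K -> Prop :=
  match K return structure L K -> Prop with
  | OrderedField F => fun _ => False
  | ValuedField F v => fun S =>
      elem_equiv (ogroup (vgroup v)) (ogroup int) /\
      forall X : set F, X `<=` [set x | x != 0] -> definable1 S X ->
        definable1 (ogroup (vgroup v)) (vval v @` X)
  end.

Section Cvalued.
Variables (K : ovField) (L : language) (S : structure L K) (m : nat).
Variable X : defset (expansion S) m.

Definition Cvalued (D : set 'rV[K]_m) (Y : set K) : set (cdfun X) :=
  [set f | forall x : dset X,
     (D (val x) -> Y (f x)) /\ (~ D (val x) -> f x = 0)].

Definition Ceq (k : nat) (Y : set K) : set (cdfun X) := Cvalued (Delta k X) Y.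
Definition Cge (k : nat) (Y : set K) : set (cdfun X) :=
  Cvalued (\bigcup_(l in [set l | (k <= l)%N]) Delta l X) Y.

End Cvalued.
Arguments Ceq {K L S m} X k Y.
Arguments Cge {K L S m} X k Y.

Definition intpowers (K : ovField) (t : K) : set K := [set t ^ k | k in [set: int]].
Definition intmultiples (K : ovField) (t : K) : set K := [set t *~ k | k in [set: int]].

Definition additive_order (K : ovField) (le : rel K) : Prop :=
  [/\ reflexive le, antisymmetric le, transitive le & total le] /\
  forall x y z, le x y -> le (x + z) (y + z).

(* Main.v *)
Require Import Defs.
From mathcomp Require Import all_boot all_order all_algebra.
From mathcomp Require Import all_classical constructive_ereal topology lra.

Set Implicit Arguments.
Unset Strict Implicit.
Unset Printing Implicit Defensive.

Import Order.TTheory GRing.Theory Num.Theory.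
Local Open Scope classical_set_scope.
Local Open Scope ring_scope.

(* Points of X are coded in C(X) by functions p with Z(p) = {x}, and Z(f), Z(g) are
   disjoint iff f and g generate the unit ideal.  This makes quantification over the
   points of X and comparison of |f(x)| with |g(x)| definable in (C(X), B), with
   {y : |p(y)| < |e(y)|}, where p(x) = 0 and e(x) <> 0, as basic neighbourhoods of x.

   By (Dim2) and (Dim3) the local dimension at x is at least j iff every
   neighbourhood of x contains a neighbourhood with a chain of j + 1 non-empty zero
   sets, each nowhere dense in the previous one; hence Delta_k(X) is definable.

   That f(x) lies in the orbit of b under an affine map T is expressed through the
   set V of cluster values at x of a quotient g/t along a zero set h = 0: one asks
   for g, h, t such that V is bounded and discrete, contains b and f(x), and is
   stable under T except at f(x).  V is closed and definable in K, so it is finite,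
   and following the orbit of b one must meet f(x).  Conversely, at a point with two
   free coordinates u, v, the functions g = v, t = u, h = prod_i (v - b_i u) realize
   any finite set {b_i} as V.  Under (Z), one free coordinate u suffices: take
   g = b_i u where |u| is a 2^i-th power but not a 2^(i+1)-th power.

   It remains that tau^Z is closed in K^* and tau Z in K.  For the latter, (Dim2)
   gives an interior point of the positive cone, so that the multiples n tau cannot
   be arbitrarily small. *)

(** * Definability with numbered variables *)

Section EnvDefinable.
Variables (L : language) (M : Type) (S : structure L M).
Implicit Types (P Q : (nat -> M) -> Prop) (T U : (nat -> M) -> M).

Definition atenv (e : nat -> M) (u : nat + M) : M :=
  match u with inl k => e k | inr a => a end.

(* Variables are numbered by [nat], and a formula is instantiated by mapping each
   of its free variables to a variable or to a parameter. *)
Definition envdef P : Prop := exists n (phi : formula L n) (s : 'I_n -> nat + M),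
  forall e, P e <-> holds S phi (\row_i atenv e (s i)).

Lemma envdef_iff P Q : (forall e, P e <-> Q e) -> envdef P -> envdef Q.
Proof.
by move=> PQ [n [phi [s H]]]; exists n, phi, s => e; rewrite -PQ.
Qed.

Lemma envdef_not P : envdef P -> envdef (fun e => ~ P e).
Proof.
by move=> [n [phi [s H]]]; exists n, (FNot phi), s => e; rewrite /= H.
Qed.

Lemma envdef_and P Q : envdef P -> envdef Q -> envdef (fun e => P e /\ Q e).
Proof.
move=> [n [phi [s H]]] [n' [psi [t H']]].
exists (n + n')%N, (FAnd (rename phi (lshift n')) (rename psi (@rshift n n'))).
exists (fun i => match fintype.split i with inl j => s j | inr j => t j end) => e.
rewrite /= !holds_rename H H'.
rewrite (_ : \row_i _ = \row_i atenv e (s i)); last first.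
  by apply/rowP => i; rewrite !mxE (unsplitK (inl _)).
rewrite (_ : \row_i _ = \row_i atenv e (t i)) //.
by apply/rowP => i; rewrite !mxE (unsplitK (inr _)).
Qed.

(** Variable 0 is the quantified one. Several variables of [phi] may be instantiated by it, so [t]
    sends all of these to the bound index of [FEx] and lifts the others; the predecessor taken at 0
    is a junk value that is never read. *)
Lemma envdef_ex (Q : M -> (nat -> M) -> Prop) :
  envdef (fun e => Q (e 0%N) (fun k => e k.+1)) ->
  envdef (fun e => exists a, Q a e).
Proof.
move=> [n [phi [s H]]].
pose t (i : 'I_n) : 'I_n.+1 :=
  if s i is inl 0 then ord0 else lift ord0 i.
exists n, (FEx (rename phi t)).
exists (fun i => match s i with inl k => inl k.-1 | inr a => inr a end) => e /=.
suff E a : Q a e <-> holds S (rename phi t) (row_mx (const_mx a : 'rV[M]_1)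
    (\row_i atenv e match s i with inl k => inl k.-1 | inr a => inr a end)).
  by split=> -[a /E Ha]; exists a.
rewrite holds_rename; apply: (iff_trans (H (fun k => if k is k'.+1 then e k' else a))).
suff -> : \row_i atenv (fun k => if k is k'.+1 then e k' else a) (s i) =
  \row_i (row_mx (const_mx a : 'rV[M]_1)
    (\row_i atenv e match s i with inl k => inl k.-1 | inr a => inr a end)) 0 (t i) by [].
apply/rowP => i; rewrite [LHS]mxE [RHS]mxE /t; case E : (s i) => [[|k]|b] /=.
- have -> : ord0 = lshift n 0 :> 'I_(1 + n) by apply: val_inj.
  by rewrite [RHS]row_mxEl mxE.
- have -> : lift ord0 i = rshift 1 i :> 'I_(1 + n) by apply: val_inj.
  by rewrite [RHS]row_mxEr mxE E.
- have -> : lift ord0 i = rshift 1 i :> 'I_(1 + n) by apply: val_inj.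
  by rewrite [RHS]row_mxEr mxE E.
Qed.

Lemma envdef_or P Q : envdef P -> envdef Q -> envdef (fun e => P e \/ Q e).
Proof.
move=> dP dQ.
apply: (@envdef_iff (fun e => ~ (~ P e /\ ~ Q e))) => [e|].
  split=> [H|[H|H] []//]; have [|nP] := pselect (P e); first by left.
  by right; apply: contrapT => nQ; apply: H.
by apply/envdef_not/envdef_and; apply: envdef_not.
Qed.

Lemma envdef_imp P Q : envdef P -> envdef Q -> envdef (fun e => P e -> Q e).
Proof.
move=> dP dQ; apply: (@envdef_iff (fun e => ~ P e \/ Q e)) => [e|].
  split=> [[]//|H]; have [|nP] := pselect (P e); last by left.
  by move=> /H; right.
by apply: envdef_or => //; exact: envdef_not.
Qed.

Lemma envdef_all (Q : M -> (nat -> M) -> Prop) :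
  envdef (fun e => Q (e 0%N) (fun k => e k.+1)) ->
  envdef (fun e => forall a, Q a e).
Proof.
move=> dQ; apply: (@envdef_iff (fun e => ~ exists a, ~ Q a e)) => [e|].
  by split=> [H a|H [a]]; [apply: contrapT => nQ; apply: H; exists a|apply].
apply: envdef_not; apply: (envdef_ex (Q := fun a e => ~ Q a e)).
exact: envdef_not.
Qed.

(** Covers subformulas that mention no variable, such as [Y 0] further on: classically each is true
    or false, and both truth values are expressed by an equation of a variable with itself. *)
Lemma envdef_prop (p : Prop) : envdef (fun=> p).
Proof.
have H : envdef (fun e => e 0%N = e 0%N).
  exists 1%N, (FEq (TVar L 0) (TVar L 0)), (fun=> inl 0%N) => e.
  by split.
have [Hp|Hp] := pselect p; first exact: envdef_iff H.
by apply: envdef_iff (envdef_not H) => e; split.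
Qed.

Lemma envdef_subst (s : nat -> nat + M) P :
  envdef P -> envdef (fun e => P (fun k => atenv e (s k))).
Proof.
move=> [n [phi [t H]]]; exists n, phi.
exists (fun i => match t i with inl k => s k | inr a => inr a end) => e.
rewrite H; suff -> : \row_i atenv (fun k => atenv e (s k)) (t i) =
   \row_i atenv e match t i with inl k => s k | inr a => inr a end by [].
by apply/rowP => i; rewrite !mxE; case: (t i).
Qed.

Lemma envdef_shift P : envdef P -> envdef (fun e => P (fun k => e k.+1)).
Proof. exact: (envdef_subst (fun k => inl k.+1)). Qed.

Lemma envdef_allfin n (P : 'I_n -> (nat -> M) -> Prop) :
  (forall i, envdef (P i)) -> envdef (fun e => forall i, P i e).
Proof.
move=> dP.
apply: (@envdef_iff (fun e => forall i, i \in enum 'I_n -> P i e)) => [e|].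
  by split=> H i; [exact/H/mem_enum|].
elim: (enum 'I_n) => [|j s IH].
  by apply: envdef_iff (envdef_prop True) => e; split.
apply: envdef_iff (envdef_and (dP j) IH) => e; split=> [[Pj H] i|H].
  by rewrite inE => /orP[/eqP ->|/H].
by split=> [|i si]; apply: H; rewrite inE ?eqxx// si orbT.
Qed.

(** Definability of the graph: variable 0 carries the value and the arguments are shifted by one.
    Functions given by no term of the language can then be composed. *)
Definition envfun T : Prop := envdef (fun e => T (fun k => e k.+1) = e 0%N).

Lemma envfun_var k : envfun (fun e => e k).
Proof.
exists 2%N, (FEq (TVar L 0) (TVar L 1)).
exists (fun i => if i == 0 then inl k.+1 else inl 0%N) => e.
by rewrite /= !mxE.
Qed.

Lemma envfun_row n (T : 'I_n -> (nat -> M) -> M) i :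
  envfun (T i) -> envfun (fun e => (\row_j T j e) 0 i).
Proof. by move=> dT; apply: envdef_iff dT => e; rewrite mxE. Qed.

Lemma envfun_cst a : envfun (fun=> a).
Proof.
exists 2%N, (FEq (TVar L 0) (TVar L 1)).
exists (fun i => if i == 0 then inr a else inl 0%N) => e.
by rewrite /= !mxE.
Qed.

Lemma envdef_comp (Q : M -> (nat -> M) -> Prop) T : envfun T ->
  envdef (fun e => Q (e 0%N) (fun k => e k.+1)) ->
  envdef (fun e => Q (T e) e).
Proof.
move=> dT dQ; apply: (@envdef_iff (fun e => exists a, T e = a /\ Q a e)) => [e|].
  by split=> [[a [->]]|] //; exists (T e).
apply: (envdef_ex (Q := fun a e => T e = a /\ Q a e)).
by apply: envdef_and.
Qed.

Lemma envfun_shift T : envfun T -> envfun (fun e => T (fun k => e k.+1)).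
Proof.
exact: (envdef_subst (fun k => inl (if k is k'.+1 then k'.+2 else 0%N))).
Qed.

Lemma envdef_eq T U : envfun T -> envfun U -> envdef (fun e => T e = U e).
Proof.
move=> dT dU; apply: (envdef_comp (Q := fun a e => T e = a) dU).
exact: dT.
Qed.

(** Induction on the list [l] of positions still filled by a function: each is replaced by a
    quantified variable through [envdef_comp], until every position holds a variable or a
    parameter. *)
Lemma envdef_rel n (R : set 'rV[M]_n) (T : 'I_n -> (nat -> M) -> M) :
  definable S R -> (forall i, envfun (T i)) -> envdef (fun e => R (\row_i T i e)).
Proof.
move=> dR dT.
suff H (l : seq 'I_n) : forall U : 'I_n -> (nat -> M) -> M,
    (forall i, i \in l -> envfun (U i)) ->
    (forall i, i \notin l -> exists v, forall e, U i e = atenv e v) ->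
    envdef (fun e => R (\row_i U i e)).
  by apply: (H (enum 'I_n)) => // i; rewrite mem_enum.
elim: l => [|j l IH] U dU vU.
  have [v Hv] := choice (fun i => vU i (isT : i \notin [::])).
  case: dR => p [phi [b Rb]]; exists (n + p)%N, phi.
  exists (fun i => match fintype.split i with inl j => v j | inr j => inr (b 0 j) end).
  move=> e; rewrite Rb /=; suff -> : row_mx (\row_i U i e) b = \row_i atenv e
    match fintype.split i with inl j => v j | inr j => inr (b 0 j) end by [].
  by apply/rowP => i; rewrite !mxE; case: (fintype.split i) => k //; rewrite mxE Hv.
pose Q a e := R (\row_i if i == j then a else U i e).
have -> : (fun e => R (\row_i U i e)) = (fun e => Q (U j e) e).
  apply/funext => e; congr R; apply/rowP => i; rewrite !mxE.
  by case: eqP => // ->.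
apply: (envdef_comp (dU _ (mem_head _ _))).
apply: (IH (fun i e => if i == j then e 0%N else U i (fun k => e k.+1))) => i il.
  have [ij|nij] := eqVneq i j; first exact: envfun_var.
  by apply/envfun_shift/dU; rewrite inE il orbT.
have [ij|nij] := eqVneq i j; first by exists (inl 0%N).
have [|v Hv] := vU i; first by rewrite inE negb_or nij.
by exists (match v with inl k => inl k.+1 | inr a => inr a end) => e; rewrite Hv; case: (v).
Qed.

Lemma envdef_definable n (A : set 'rV[M]_n) (d : M) :
  envdef (fun e => A (\row_(i < n) e i)) -> definable S A.
Proof.
move=> [N [phi [s H]]].
pose t (i : 'I_N) : 'I_(n + N) :=
  match s i with
  | inl k => if insub k is Some j then lshift N (j : 'I_n) else rshift n i
  | inr _ => rshift n i
  end.
exists N, (rename phi t), (\row_i match s i with inl _ => d | inr a => a end).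
apply/funext => x; apply/propext.
(* Variables numbered [n] or more may take any value, since [H] holds for all [e]; they receive
   [d]. *)
pose e k := if insub k is Some j then x 0 (j : 'I_n) else d.
have xe : x = \row_(i < n) e i.
  apply/rowP => i; rewrite mxE /e insubT //= => ?.
  by congr (x 0 _); apply: val_inj.
rewrite /= holds_rename {1}xe; apply: (iff_trans (H e)).
suff -> : \row_i atenv e (s i) = \row_i row_mx x
  (\row_i match s i with inl _ => d | inr a => a end) 0 (t i) by [].
apply/rowP => i; rewrite [LHS]mxE [RHS]mxE /t.
case E : (s i) => [k|a] /=; last by rewrite row_mxEr mxE E.
by rewrite /e; case: insubP => [j _ _|_]; rewrite ?row_mxEl // row_mxEr mxE E.
Qed.

Lemma definable_envdef n (A : set 'rV[M]_n) :
  definable S A -> envdef (fun e => A (\row_(i < n) e i)).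
Proof. by move=> dA; apply: envdef_rel => // i; exact: envfun_var. Qed.

Lemma envdef_definable1 (A : set M) (d : M) :
  envdef (fun e => A (e 0%N)) -> definable1 S A.
Proof.
move=> dA; apply: (envdef_definable d).
by apply: envdef_iff dA => e /=; rewrite mxE.
Qed.

(** The row is replaced by a sequence of which only the first [n] terms matter, and these are
    quantified one at a time. *)
Lemma envdef_exrow n (Q : 'rV[M]_n -> (nat -> M) -> Prop) :
  envdef (fun e => Q (\row_(i < n) e i) (fun k => e (n + k)%N)) ->
  envdef (fun e => exists y, Q y e).
Proof.
suff H (P : (nat -> M) -> Prop) : envdef P -> envdef (fun e =>
    exists y : nat -> M, P (fun k => if (k < n)%N then y k else e (k - n)%N)).
  move=> /H; apply: envdef_iff => e.
  have E y : (fun k => if ((n + k) < n)%N then y (n + k)%N else e (n + k - n)%N) = e.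
    by apply/funext => k; rewrite ltnNge leq_addr /= addKn.
  split=> [[y]|[y Qy]]; first by rewrite E => Qy; eexists; exact: Qy.
  pose y' k : M := if insub k is Some j then y 0 (j : 'I_n) else e 0%N.
  exists y'; rewrite E; suff -> : \row_(i < n) (if (i < n)%N then y' i else e (i - n)%N) = y by [].
  apply/rowP => i; rewrite mxE ltn_ord /y' insubT //= => ?.
  by congr (y 0 _); apply: val_inj.
elim: n P {Q} => [|k IH] P dP.
  apply: envdef_iff dP => e.
  have E : (fun k => e (k - 0)%N) = e by apply/funext => k; rewrite subn0.
  by split=> [Pe|[y]]; [exists (fun=> e 0%N)|]; rewrite /= E.
have {}IH := IH (fun e => exists a, P (fun k => if k is k'.+1 then e k' else a)).
apply: (envdef_iff _ (IH _)); last first.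
  apply: (envdef_ex (Q := fun a e => P (fun k => if k is k'.+1 then e k' else a))).
  apply: envdef_iff dP => e; suff -> : e = (fun k => if k is k'.+1 then e k'.+1 else e 0%N) by [].
  by apply/funext => -[].
move=> e; split.
  move=> [y [a H]]; exists (fun k => if k is k'.+1 then y k' else a).
  by congr P: H; apply/funext => -[|j] //=; rewrite ltnS subSS.
move=> [y H]; exists (fun k => y k.+1), (y 0%N).
by congr P: H; apply/funext => -[|j] //=; rewrite ltnS subSS.
Qed.

End EnvDefinable.

(** * Comparison of absolute values, in the ordered and the valued case *)

Lemma absle0r (K : ovField) (x : K) : absle 0 x.
Proof.
exists 0; last by rewrite mulr0.
by case: K {x} => [F|F v] /=; [rewrite lerN10 ler01|left].
Qed.

Lemma absler0 (K : ovField) (x : K) : absle x 0 -> x = 0.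
Proof. by move=> [a _ ->]; rewrite mul0r. Qed.

Section AbsArith.
Variable K : ovField.
Implicit Types (a b c d r s x y : K).

(** Totality of the comparison of classes, taken from the order of [F] or of the value group. Most
    later inequalities follow from it and from the multiplicativity of [OO], without returning to
    the two cases. *)
Lemma absltNge x y : abslt x y <-> ~ absle y x.
Proof.
have [->|y0] := eqVneq y 0.
  split=> [[H []]|/(_ (absle0r x))//]; exists 1; last by rewrite mul0r (absler0 H).
  by split; rewrite ?invr1 ?oner_eq0//; case: K => [F|F v] /=;
    [rewrite lexx andbT; lra | right; rewrite vval1 .. | lra | right; rewrite vval1].
case: K x y y0 => [F|F v] x y y0.
  by rewrite abslt_orderedE absle_orderedE ltNge; split=> /negP.
rewrite abslt_valuedE//; have [->|x0] := eqVneq x 0.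
  split=> [_ H|_]; last by left.
  by have /eqP := @absler0 (ValuedField v) y H; rewrite (negPf y0).
rewrite absle_valuedE//; split.
  by move=> [/eqP|]; rewrite ?(negPf x0)// vltNge => /negP H [/eqP|//]; rewrite (negPf y0).
move=> H; right; rewrite vltNge; apply/negP => H'.
by apply: H; right.
Qed.

Lemma absleNgt x y : absle x y <-> ~ abslt y x.
Proof.
split=> [xy /absltNge //|H]; apply: contrapT => /absltNge; exact: H.
Qed.

Lemma abslt_absle x y : abslt x y -> absle x y. Proof. by case. Qed.

Lemma absle_total x y : absle x y \/ absle y x.
Proof.
have [|H] := pselect (absle x y); first by left.
by right; apply/abslt_absle/absltNge.
Qed.

Lemma OOM a b : OO K a -> OO K b -> OO K (a * b).
Proof.
case: K a b => [F|F v] a b /=.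
  by rewrite -!ler_norml => a1 b1; rewrite normrM mulr_ile1.
move=> aO bO; have [->|a0] := eqVneq a 0; first by left; rewrite mul0r.
have [->|b0] := eqVneq b 0; first by left; rewrite mulr0.
case: aO => [/eqP|aO]; first by rewrite (negPf a0).
case: bO => [/eqP|bO]; first by rewrite (negPf b0).
right; rewrite (@vvalM F v)//; apply: le_trans aO _.
by rewrite -[X in X <= _]add0r [X in _ <= X]addrC; exact: vgroup_leD.
Qed.

Lemma OO1 : OO K 1.
Proof. by case: K => [F|F v] /=; [lra|right; rewrite vval1]. Qed.

Lemma absle_refl x : absle x x.
Proof. by exists 1; [exact: OO1|rewrite mulr1]. Qed.

Lemma absle_trans y x z : absle x y -> absle y z -> absle x z.
Proof.
by move=> [a aO ->] [b bO ->]; exists (b * a); [exact: OOM|rewrite mulrA].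
Qed.

Lemma abslt_le_trans y x z : abslt x y -> absle y z -> abslt x z.
Proof.
move=> /absltNge xy yz; apply/absltNge => zx; apply: xy.
exact: absle_trans zx.
Qed.

Lemma absle_lt_trans y x z : absle x y -> abslt y z -> abslt x z.
Proof.
move=> xy /absltNge yz; apply/absltNge => zx; apply: yz.
exact: absle_trans xy.
Qed.

Lemma abslt_trans y x z : abslt x y -> abslt y z -> abslt x z.
Proof. by move=> /abslt_absle; exact: absle_lt_trans. Qed.

Lemma abslt_neq0 x y : abslt x y -> y != 0.
Proof. by move=> /absltNge H; apply/eqP => y0; apply: H; rewrite y0; exact: absle0r. Qed.

Lemma absle_neq0 x y : absle x y -> x != 0 -> y != 0.
Proof. by move=> H; apply: contraNneq => y0; rewrite y0 in H; rewrite (absler0 H). Qed.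

Lemma absleM a b c d : absle a b -> absle c d -> absle (a * c) (b * d).
Proof.
by move=> [x xO ->] [y yO ->]; exists (x * y); [exact: OOM|rewrite mulrACA].
Qed.

Lemma absle_mul2r c a b : c != 0 -> absle (a * c) (b * c) <-> absle a b.
Proof.
move=> c0; split=> [[x xO E]|H]; last by apply: absleM H (absle_refl c).
by exists x => //; apply: (mulIf c0); rewrite E mulrAC.
Qed.

Lemma abslt_mul2r c a b : c != 0 -> abslt (a * c) (b * c) <-> abslt a b.
Proof. by move=> c0; rewrite !absltNge absle_mul2r. Qed.

Lemma absltM a b c d : abslt a b -> absle c d -> d != 0 -> abslt (a * c) (b * d).
Proof.
move=> ab cd d0; have [->|c0] := eqVneq c 0.
  by rewrite mulr0; apply: abslt0; rewrite mulf_neq0// (abslt_neq0 ab).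
by apply: abslt_le_trans (absleM (absle_refl b) cd); apply/abslt_mul2r.
Qed.

Lemma abslt_distC x y r : abslt (x - y) r -> abslt (y - x) r.
Proof. by move=> H; rewrite -opprB; apply: absltN => //; exact: abslt_neq0 H. Qed.

Lemma ex_abslt r : r != 0 -> exists2 s, s != 0 & abslt s r.
Proof.
case: K r => [F|F v] r r0.
  exists ((r : F) / 2); first by rewrite mulf_neq0 ?invr_eq0 ?pnatr_eq0.
  apply/abslt_orderedE; rewrite normrM normfV [`|2%:R|]ger0_norm ?ler0n//.
  have : 0 < `|r : F| by rewrite normr_gt0.
  by move=> ?; lra.
have [x x0 vx] := vval_nontriv v.
have [y y0 vy] : exists2 y, y != 0 & 0 < vval v y.
  have [vx0|vx0] := boolP (0 <= vval v x).
    by exists x => //; rewrite lt_neqAle eq_sym vx.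
  exists x^-1; rewrite ?invr_eq0// vvalV//.
  rewrite vltNge; apply: (contra _ vx0) => H.
  by have := vgroup_leD (vval v x) H; rewrite addNr add0r.
exists ((r : F) * y); first by rewrite mulf_neq0.
apply/(@abslt_valuedE F v) => //; right; rewrite vvalM// vltNge; apply/negP => H.
move: vy; rewrite vltNge => /negP; apply.
by have := vgroup_leD (- vval v r) H; rewrite subrr addrC addKr.
Qed.

End AbsArith.

(** In the ordered case |r| - |a| serves as [s], in the valued case [r] itself, by the ultrametric
    inequality. That one [s] works for all [c] with |c| <= |a| is used later for the powers of an
    element. *)
Lemma abslt_open_unif (K : ovField) (a r : K) : abslt a r ->
  exists2 s, s != 0 & forall c b, absle c a -> abslt b s -> abslt (c + b) r.
Proof.
case: K a r => [F|F v] a r.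
  move=> /abslt_orderedE ar; pose s : F := `|r : F| - `|a : F|.
  exists s; first by rewrite gt_eqF// subr_gt0.
  move=> c b /absle_orderedE ca /abslt_orderedE.
  rewrite (ger0_norm (_ : 0 <= s)) ?subr_ge0 1?ltW// /s => bs.
  apply/abslt_orderedE; apply: le_lt_trans (ler_normD (c : F) (b : F)) _.
  by lra.
move=> ar; have r0 := abslt_neq0 ar; exists r => // c b ca br.
have cr := absle_lt_trans ca ar.
move: cr br => /(abslt_valuedE _ r0) cr /(abslt_valuedE _ r0) br; apply/(abslt_valuedE _ r0).
have [c0|c0] := eqVneq c 0; first by rewrite c0 add0r.
have [b0|b0] := eqVneq b 0; first by rewrite b0 addr0.
case: cr => [/eqP|cr]; first by rewrite (negPf c0).
case: br => [/eqP|br]; first by rewrite (negPf b0).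
have [cb0|cb0] := eqVneq (c + b) 0; [by left|right].
have /orP[cb|bc] := vgroup_total (vval v c) (vval v b).
  by apply: lt_le_trans cr _; exact: (@vvalD F v).
rewrite addrC in cb0 *.
by apply: lt_le_trans br _; exact: (@vvalD F v).
Qed.

Lemma abslt_open (K : ovField) (a r : K) : abslt a r ->
  exists2 s, s != 0 & forall b, abslt b s -> abslt (a + b) r.
Proof.
by move=> /abslt_open_unif[s s0 sP]; exists s => // b; apply: sP; exact: absle_refl.
Qed.

Section AbsNear.
Variable K : ovField.
Implicit Types (a b r s t x : K).

(** If [b] and a - b were both small, their sum [a] would be smaller than itself in absolute
    value. *)
Lemma absle_near a : a != 0 ->
  exists2 r, r != 0 & forall b, abslt (b - a) r -> absle r b.
Proof.
move=> a0; have [r r0 rP] := abslt_split a0; exists r => // b br.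
have [//|/absltNge br'] := pselect (absle r b).
have := rP _ _ (abslt_distC br) br'; rewrite subrK.
by move=> /absltNge /(_ (absle_refl a)).
Qed.

Lemma abslt_allfin n (P : 'I_n -> K -> Prop) :
  (forall i, exists2 s, s != 0 & forall b, abslt b s -> P i b) ->
  exists2 s, s != 0 & forall i b, abslt b s -> P i b.
Proof.
move=> H; suff [s s0 sP] : exists2 s, s != 0 &
    forall i, i \in enum 'I_n -> forall b, abslt b s -> P i b.
  by exists s => // i b; apply: sP; exact: mem_enum.
elim: (enum 'I_n) => [|j l [s s0 IH]]; first by exists 1; rewrite ?oner_neq0.
have [t t0 tP] := H j; have [u u0 uP] := abslt_min s0 t0.
exists u => // i; rewrite inE => /orP[/eqP -> b /uP[_ /tP]//|il b /uP[+ _]].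
exact: IH.
Qed.

Lemma abslt_min3 r s t : r != 0 -> s != 0 -> t != 0 -> exists2 u, u != 0 &
  forall x, abslt x u -> [/\ abslt x r, abslt x s & abslt x t].
Proof.
move=> r0 s0 t0; have [u u0 uP] := abslt_min r0 s0.
have [w w0 wP] := abslt_min u0 t0.
by exists w => // x /wP[/uP[]].
Qed.

End AbsNear.

(** * Balls and continuity *)

Section OvTopology.
Variable K : ovField.

Lemma oball_center m (x : 'rV[K]_m) r : r != 0 -> oball x r x.
Proof. by move=> r0 i; rewrite subrr; exact: abslt0. Qed.

Lemma oball_min m r s : r != 0 -> s != 0 -> exists2 t : K, t != 0 &
  forall x : 'rV[K]_m, oball x t `<=` oball x r `&` oball x s.
Proof.
move=> r0 s0; have [t t0 tP] := abslt_min r0 s0.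
by exists t => // x y xy; split=> i; have [] := tP _ (xy i).
Qed.

Lemma oball_open m (x y : 'rV[K]_m) r : r != 0 -> oball x r y ->
  exists2 s, s != 0 & oball y s `<=` oball x r.
Proof.
move=> r0 xy.
have [s s0 sP] := abslt_allfin (fun i => abslt_open (xy i)).
exists s => // z yz i.
by rewrite -(subrKA (y 0 i)) addrC; apply: sP; exact: yz.
Qed.

Lemma nbhs_setE m (X : set 'rV[K]_m) (x : X) (A : set X) :
  nbhs x A <-> exists2 r : K, r != 0 & forall y : X, oball (val x) r (val y) -> A y.
Proof.
split.
  move=> [_ /= [] [B oB <-] /= Bx sBA].
  have [r r0 rB] : exists2 r : K, r != 0 & oball (val x) r `<=` B.
    by apply/nbhs_oballE; exact: open_nbhs_nbhs.
  by exists r => // y /rB; exact: sBA.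
move=> [r r0 sA].
have : nbhs x (val @^-1` (oball (val x) r : set 'rV[K]_m)).
  by apply: (@initial_continuous X 'rV[K]_m set_val); apply/nbhs_oballE; exists r.
exact: filterS.
Qed.

Lemma ov_continuousP m (X : set 'rV[K]_m) (f : X -> K) :
  continuous f <-> forall x (r : K), r != 0 ->
    exists2 s : K, s != 0 & forall y, oball (val x) s (val y) -> abslt (f y - f x) r.
Proof.
split=> [cf x r r0|H x A /nbhs_ovE[r r0 sA]].
  have nr : nbhs (f x) [set z | abslt (z - f x) r] by apply/nbhs_ovE; exists r.
  exact/nbhs_setE/(cf x _ nr).
by apply/nbhs_setE; have [s s0 sP] := H x r r0; exists s => // y /sP /sA.
Qed.

End OvTopology.

(** * Definability in rings with a predicate and in expansions of K *)

Section EnvDefinableRel.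
Variables (L : language) (M : Type) (S : structure L M).
Implicit Types (T U V : (nat -> M) -> M).

Lemma envdef_rel1 (R : M -> Prop) T : envdef S (fun e => R (e 0%N)) ->
  envfun S T -> envdef S (fun e => R (T e)).
Proof. by move=> dR dT; apply: (envdef_comp (Q := fun a e => R a) dT). Qed.

Lemma envdef_rel2 (R : M -> M -> Prop) T U :
  envdef S (fun e => R (e 0%N) (e 1%N)) ->
  envfun S T -> envfun S U -> envdef S (fun e => R (T e) (U e)).
Proof.
move=> dR dT dU; apply: (envdef_comp (Q := fun a e => R a (U e)) dT).
apply: (envdef_comp (Q := fun a e => R (e 0%N) a) (envfun_shift dU)).
exact: (envdef_subst (fun k => inl (if k is 0 then 1%N else 0%N)) dR).
Qed.

Lemma envdef_rel3 (R : M -> M -> M -> Prop) T U V :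
  envdef S (fun e => R (e 0%N) (e 1%N) (e 2%N)) ->
  envfun S T -> envfun S U -> envfun S V ->
  envdef S (fun e => R (T e) (U e) (V e)).
Proof.
move=> dR dT dU dV; apply: (envdef_comp (Q := fun a e => R a (U e) (V e)) dT).
apply: (envdef_comp (Q := fun a e => R (e 0%N) a (V (fun k => e k.+1)))
  (envfun_shift dU)).
apply: (envdef_comp (Q := fun a e => R (e 1%N) (e 0%N) a)
  (envfun_shift (envfun_shift dV))).
exact: (envdef_subst 
  (fun k => inl (if k is k'.+1 then if k' is 0 then 1%N else 0%N else 2%N)) dR).
Qed.

Lemma envfun_op2 (op : M -> M -> M) T U :
  envdef S (fun e => op (e 0%N) (e 1%N) = e 2%N) ->
  envfun S T -> envfun S U -> envfun S (fun e => op (T e) (U e)).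
Proof.
move=> dop dT dU; apply: (envdef_rel3 (R := fun a b c => op a b = c) dop).
- exact: envfun_shift.
- exact: envfun_shift.
- exact: envfun_var.
Qed.

End EnvDefinableRel.

Section RingAtoms.
Variables (R : pzRingType) (P : set R).

Section Plain.
Let S := ringpred P.

Lemma ringpred_atom2 (f : ring_fsym) (op : R -> R -> R) (H : ring_farity f = 2%N) :
  (forall x : 'rV[R]_(ring_farity f), finterp S (f := f) x =
     op (x 0 (cast_ord (esym H) 0)) (x 0 (cast_ord (esym H) 1))) ->
  envdef S (fun e => op (e 0%N) (e 1%N) = e 2%N).
Proof.
move=> E; pose ts (i : 'I_(ring_farity f)) : term Lringpred 3 :=
  TVar _ (if i == 0 :> nat then 0 else 1).
exists 3%N, (FEq (TApp (f := f : Defs.fsym Lringpred) ts) (TVar Lringpred (2 : 'I_3))).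
exists (fun i => inl (i : nat)) => e; set x := \row_i _.
suff <- : finterp S (f := f) (\row_i Defs.eval S x (ts i)) = op (e 0%N) (e 1%N).
  by rewrite [e 2%N](_ : _ = x 0 2)// mxE.
by rewrite E !mxE /= /x !mxE.
Qed.

Lemma ringpred_addP : envdef S (fun e => e 0%N + e 1%N = e 2%N).
Proof.
by apply: (@ringpred_atom2 RAdd _ erefl) => x /=; congr (x _ _ + x _ _); apply: val_inj.
Qed.

Lemma ringpred_subP : envdef S (fun e => e 0%N - e 1%N = e 2%N).
Proof.
apply: (@ringpred_atom2 RSub (fun x y => x - y) erefl) => x /=.
by congr (x _ _ - x _ _); apply: val_inj.
Qed.

Lemma ringpred_mulP : envdef S (fun e => e 0%N * e 1%N = e 2%N).
Proof.
by apply: (@ringpred_atom2 RMul _ erefl) => x /=; congr (x _ _ * x _ _); apply: val_inj.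
Qed.

Lemma ringpred_predP : envdef S (fun e => P (e 0%N)).
Proof.
exists 1%N, (FRel (r := tt : Defs.rsym Lringpred)
  (fun=> TVar Lringpred (0 : 'I_1))), (fun=> inl 0%N) => e.
by rewrite /= !mxE.
Qed.

End Plain.

Section Sum.
Variables (L : language) (S : structure L R).

Fixpoint inl_term n (t : term Lringpred n) : term (lang_sum Lringpred L) n :=
  match t with
  | TVar i => TVar _ i
  | TApp f ts => TApp (f := inl f : Defs.fsym (lang_sum Lringpred L)) (fun i => inl_term (ts i))
  end.

Fixpoint inl_formula n (phi : formula Lringpred n) : formula (lang_sum Lringpred L) n :=
  match phi with
  | FEq _ t u => FEq (inl_term t) (inl_term u)
  | FRel _ r ts => FRel (r := inl r : Defs.rsym (lang_sum Lringpred L)) (fun i => inl_term (ts i))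
  | FNot _ phi => FNot (inl_formula phi)
  | FAnd _ phi psi => FAnd (inl_formula phi) (inl_formula psi)
  | FEx _ phi => FEx (inl_formula phi)
  end.

Lemma eval_inl n (t : term Lringpred n) e :
  Defs.eval (struct_sum (ringpred P) S) e (inl_term t) = Defs.eval (ringpred P) e t.
Proof.
elim: t => [i|f ts IH] //.
rewrite [LHS]/= [RHS]/=; congr (match f with RZero => _ | _ => _ end _).
by apply/rowP => i; rewrite [LHS]mxE [RHS]mxE IH.
Qed.

Lemma holds_inl n (phi : formula Lringpred n) e :
  holds (struct_sum (ringpred P) S) (inl_formula phi) e <-> holds (ringpred P) phi e.
Proof.
elim: phi e => {n} [n t u|n r ts|n phi IH|n phi IHp psi IHq|n phi IH] e /=.
- by rewrite !eval_inl.
- suff -> : \row_i Defs.eval (struct_sum (ringpred P) S) e (inl_term (ts i)) =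
    \row_i Defs.eval (ringpred P) e (ts i) by [].
  by apply/rowP => i; rewrite [LHS]mxE [RHS]mxE eval_inl.
- by rewrite IH.
- by rewrite IHp IHq.
- by split=> -[a /IH]; exists a.
Qed.

Lemma envdef_inl Q : envdef (ringpred P) Q -> envdef (struct_sum (ringpred P) S) Q.
Proof.
move=> [n [phi [s H]]]; exists n, (inl_formula phi), s => e.
by rewrite holds_inl.
Qed.

End Sum.
End RingAtoms.

Section ExpansionDefinable.
Variables (K : ovField) (L : language) (S : structure L K).
Local Notation KK := (expansion S).
Implicit Types (T U V : (nat -> K) -> K).

Lemma kfun_add T U : envfun KK T -> envfun KK U -> envfun KK (fun e => T e + U e).
Proof. exact/envfun_op2/envdef_inl/ringpred_addP. Qed.

Lemma kfun_sub T U : envfun KK T -> envfun KK U -> envfun KK (fun e => T e - U e).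
Proof. exact/(envfun_op2 (op := fun x y => x - y))/envdef_inl/ringpred_subP. Qed.

Lemma kfun_mul T U : envfun KK T -> envfun KK U -> envfun KK (fun e => T e * U e).
Proof. exact/envfun_op2/envdef_inl/ringpred_mulP. Qed.

Lemma kdef_OO T : envfun KK T -> envdef KK (fun e => OO K (T e)).
Proof. exact/envdef_rel1/envdef_inl/ringpred_predP. Qed.

Lemma kdef_neq0 T : envfun KK T -> envdef KK (fun e => is_true (T e != 0)).
Proof.
move=> dT; apply: (envdef_iff _ (envdef_not (envdef_eq dT (envfun_cst KK 0)))) => e.
by split=> /eqP.
Qed.

Lemma kdef_absle T U : envfun KK T -> envfun KK U ->
  envdef KK (fun e => absle (T e) (U e)).
Proof.
move=> dT dU.
apply: (envdef_iff (P := fun e => exists a, OO K a /\ T e = U e * a)) => [e|].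
  by split=> [[a []]|[a]]; exists a.
apply: (envdef_ex (Q := fun a e => OO K a /\ T e = U e * a)).
apply: envdef_and; first exact/kdef_OO/envfun_var.
apply: envdef_eq; first exact: envfun_shift.
by apply: kfun_mul; [exact: envfun_shift|exact: envfun_var].
Qed.

Lemma kdef_abslt T U : envfun KK T -> envfun KK U ->
  envdef KK (fun e => abslt (T e) (U e)).
Proof.
move=> dT dU; apply: envdef_iff (envdef_not (kdef_absle dU dT)) => e.
exact: iff_sym (absltNge _ _).
Qed.

Lemma kdef_oball m (c : (nat -> K) -> 'rV[K]_m) (y : (nat -> K) -> 'rV[K]_m) T :
  (forall i, envfun KK (fun e => c e 0 i)) ->
  (forall i, envfun KK (fun e => y e 0 i)) -> envfun KK T ->
  envdef KK (fun e => oball (c e) (T e) (y e)).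
Proof.
move=> dc dy dT; apply: (envdef_allfin (P := fun i e => abslt (y e 0 i - c e 0 i) (T e))).
by move=> i; apply: kdef_abslt => //; exact: kfun_sub.
Qed.

Variables (m : nat) (X : defset KK m) (x0 : dset X).
Implicit Types (p : (nat -> K) -> dset X).

(** Points of X form a subtype, while variables range over K: a row is read as a point of X, with
    junk value [x0] outside X. Quantifiers over X thus become quantifiers over rows. *)
Definition totpt (y : 'rV[K]_m) : dset X := insubd x0 y.

Lemma totptK (x : dset X) : totpt (val x) = x.
Proof. exact: valKd. Qed.

Lemma totpt_in y : dset X y -> val (totpt y) = y.
Proof. by move=> Xy; rewrite /totpt insubdK//; exact/mem_set. Qed.

Lemma totpt_out y : ~ dset X y -> totpt y = x0.
Proof. by move=> Xy; rewrite /totpt /insubd insubN//; apply/negP => /set_mem. Qed.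

Definition envpt p : Prop := exists T : 'I_m -> (nat -> K) -> K,
  (forall i, envfun KK (T i)) /\ p = (fun e => totpt (\row_i T i e)).

Lemma envpt_var (s : 'I_m -> nat) :
  envpt (fun e => totpt (\row_(i < m) e (s i))).
Proof. by exists (fun i e => e (s i)); split=> // i; exact: envfun_var. Qed.

Lemma envpt_cst x : envpt (fun=> x).
Proof.
exists (fun i _ => val x 0 i); split=> [i|]; first exact: envfun_cst.
apply/funext => e; rewrite (_ : \row_i _ = val x) ?totptK//.
by apply/rowP => i; rewrite mxE.
Qed.

Lemma envpt_shift p : envpt p -> envpt (fun e => p (fun k => e k.+1)).
Proof.
move=> [T [dT ->]]; exists (fun i e => T i (fun k => e k.+1)); split=> // i.
exact: envfun_shift.
Qed.

Lemma kdef_ex (Q : dset X -> (nat -> K) -> Prop) :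
  envdef KK (fun e => Q (totpt (\row_(i < m) e i)) (fun k => e (m + k)%N)) ->
  envdef KK (fun e => exists x, Q x e).
Proof.
move=> dQ; apply: (envdef_iff (P := fun e => exists y, Q (totpt y) e)) => [e|].
  by split=> [[y Qy]|[x Qx]]; [exists (totpt y)|exists (val x); rewrite totptK].
exact: (envdef_exrow (Q := fun y e => Q (totpt y) e)).
Qed.

Lemma kdef_all (Q : dset X -> (nat -> K) -> Prop) :
  envdef KK (fun e => Q (totpt (\row_(i < m) e i)) (fun k => e (m + k)%N)) ->
  envdef KK (fun e => forall x, Q x e).
Proof.
move=> dQ; apply: (envdef_iff (P := fun e => ~ exists x, ~ Q x e)) => [e|].
  by split=> [H x|H [x]]; [apply: contrapT => nQ; apply: H; exists x|apply].
apply: envdef_not; apply: (kdef_ex (Q := fun x e => ~ Q x e)).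
exact: envdef_not.
Qed.

Lemma kdef_dset (T : 'I_m -> (nat -> K) -> K) : (forall i, envfun KK (T i)) ->
  envdef KK (fun e => dset X (\row_i T i e)).
Proof. exact/envdef_rel/dsetP. Qed.

Lemma kfun_coord i p : envpt p -> envfun KK (fun e => val (p e) 0 i).
Proof.
move=> [T [dT ->]].
apply: (envdef_iff (P := fun e =>
  (dset X (\row_i T i (fun k => e k.+1)) /\ T i (fun k => e k.+1) = e 0%N) \/
  (~ dset X (\row_i T i (fun k => e k.+1)) /\ val x0 0 i = e 0%N))) => [e|].
  have [Xy|Xy] := pselect (dset X (\row_i T i (fun k => e k.+1))).
    rewrite totpt_in// mxE; split=> [[[]|[]]|] //; first by left.
  by rewrite totpt_out//; split=> [[[]|[]]|] //; right.
have dX : envdef KK (fun e => dset X (\row_i T i (fun k => e k.+1))).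
  by apply: kdef_dset => j; exact: envfun_shift.
apply: envdef_or; apply: envdef_and => //.
- exact: dT.
- exact: envdef_not.
- by apply: envdef_eq; [exact: envfun_cst|exact: envfun_var].
Qed.

Lemma kfun_app (f : dset X -> K) p : definable_fun KK f -> envpt p ->
  envfun KK (fun e => f (p e)).
Proof.
move=> df dp.
pose T (i : 'I_(m + 1)) (e : nat -> K) :=
  match fintype.split i with
  | inl j => val (p (fun k => e k.+1)) 0 j
  | inr _ => e 0%N
  end.
apply: (envdef_iff _ (envdef_rel (T := T) df _)) => [e|i]; last first.
  rewrite /T; case: (fintype.split i) => j; last exact: envfun_var.
  exact/kfun_coord/envpt_shift.
have TE : \row_i T i e = row_mx (val (p (fun k => e k.+1))) (const_mx (e 0%N)).
  by apply/rowP => i; rewrite [LHS]mxE [RHS]mxE /T; case: (fintype.split i) => j //; rewrite mxE.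
rewrite TE; split=> [[x _ /eq_row_mx[/val_inj <-]]|<-].
  by move=> /rowP/(_ 0); rewrite !mxE.
by exists (p (fun k => e k.+1)).
Qed.

Lemma kfun_definable (f : dset X -> K) :
  envfun KK (fun e => f (totpt (\row_(i < m) e i))) -> definable_fun KK f.
Proof.
move=> df; apply: (envdef_definable 0).
pose s k := if k is k'.+1 then inl k' : nat + K else inl m.
apply: (envdef_iff _ (envdef_and (definable_envdef (@dsetP _ _ _ _ X)) (envdef_subst s df))) => e.
rewrite /=; split=> [[Xe fe]|].
  exists (totpt (\row_(i < m) e i)) => //; rewrite totpt_in//.
  apply/rowP => i; rewrite [LHS]mxE [RHS]mxE; case: (splitP i) => j ij.
    by rewrite mxE ij.
  by rewrite mxE fe ij ord1 addn0.
move=> [x _ /rowP xe].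
have -> : \row_(i < m) e i = val x.
  apply/rowP => i; have := xe (lshift 1 i); rewrite row_mxEl => ->.
  by rewrite !mxE.
split; first exact: set_valP.
by have := xe (rshift m 0); rewrite row_mxEr !mxE/= totptK addn0.
Qed.

Lemma kfun_cd (f : cdfun X) p : envpt p -> envfun KK (fun e => f (p e)).
Proof. by case: f => f /= /asboolP[_ df]; exact: kfun_app. Qed.

Lemma cd_continuous (f : cdfun X) : continuous f.
Proof. by case: f => f /= /asboolP[]. Qed.

Lemma ex_cdfun (f : dset X -> K) : continuous f ->
  envfun KK (fun e => f (totpt (\row_(i < m) e i))) ->
  exists g : cdfun X, forall x, g x = f x.
Proof.
move=> cf /kfun_definable df.
have cd : f \in @cdfun_pred K L S m X by apply/asboolP.
by exists (CDFun cd).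
Qed.

End ExpansionDefinable.

(** Recursion on the shape of the statement. Only binary conjunctions are recognized, hence the
    nested ones in the sets to which it is applied. *)
Ltac kdef := cbv beta; lazymatch goal with
| |- envdef _ (fun e => @?P e /\ @?Q e) => apply: envdef_and; kdef
| |- envdef _ (fun e => ~ @?P e) => apply: envdef_not; kdef
| |- envdef _ (fun e => @?P e -> @?Q e) => apply: envdef_imp; kdef
| |- envdef _ (fun e => is_true (@?T e != 0)) => apply: kdef_neq0; kdef
| |- envdef _ (fun e => @?T e = @?U e) => apply: envdef_eq; kdef
| |- envdef _ (fun e => absle (@?T e) (@?U e)) => apply: kdef_absle; kdef
| |- envdef _ (fun e => abslt (@?T e) (@?U e)) => apply: kdef_abslt; kdef
| |- envdef _ (fun e => forall i : 'I__, @?P e i) => apply: envdef_allfin => ?; kdef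
| |- envdef _ (fun e => exists x : ovsort _, @?P e x) => apply: envdef_ex; kdef
| |- envdef _ (fun e => forall x : ovsort _, @?P e x) => apply: envdef_all; kdef
| x0 : set_type _ |- envdef _ (fun e => exists x : set_type _, @?P e x) =>
    apply: (kdef_ex (x0 := x0)); kdef
| x0 : set_type _ |- envdef _ (fun e => forall x : set_type _, @?P e x) =>
    apply: (kdef_all (x0 := x0)); kdef
| |- envfun _ (fun e => @?T e - @?U e) => apply: kfun_sub; kdef
| |- envfun _ (fun e => @?T e + @?U e) => apply: kfun_add; kdef
| |- envfun _ (fun e => @?T e * @?U e) => apply: kfun_mul; kdef
| |- envfun _ (fun e => e _) => exact: envfun_var
| |- envfun _ (fun=> ?c) => exact: envfun_cst
| |- envfun _ (fun e => cdval _ _) => apply: kfun_cd; kdef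
| |- envfun _ (fun e => fun_of_matrix (@?A e) _ _) =>
    first [apply: kfun_coord | apply: envfun_row]; kdef
| |- envpt _ (fun=> ?c) => exact: envpt_cst
| |- envpt _ _ => exact: envpt_var
| |- _ => idtac
end.

(** * The formally real and the ultrametric case *)

Lemma abslt_irr (K : ovField) (x : K) : ~ abslt x x.
Proof. by move=> /absltNge /(_ (absle_refl x)). Qed.

(** Write b = a + (b - a) and a = b + (a - b): a strict inequality between |a| and |b|, either way,
    would contradict the ultrametric inequality. *)
Lemma valued_ultrametric (F : fieldType) (v : valuation F) (a b : ValuedField v) :
  abslt (b - a) a -> absle a b /\ absle b a.
Proof.
move=> ba; have a0 := abslt_neq0 ba.
have ba' : absle b a.
  apply/absleNgt => ab.
  have b0 := abslt_neq0 ab.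
  move: ab ba => /(@abslt_valuedE F v _ _ b0) ab /(@abslt_valuedE F v _ _ a0) ba.
  case: ab => [/eqP|ab]; first by rewrite (negPf a0).
  have bav : b - a != 0.
    by apply/eqP => /subr0_eq E; move: ab; rewrite E ltxx.
  case: ba => [/eqP|ba]; first by rewrite (negPf bav).
  have := @vvalD F v a (b - a) a0 bav; rewrite subrKC => /(_ b0 (ltW ba)) H.
  by move: ab; rewrite vltNge H.
split=> //; apply/absleNgt => ab.
have [b0|b0] := eqVneq b 0.
  by move: ba; rewrite b0 sub0r => /absltN -/(_ a0); rewrite opprK => /abslt_irr.
move: ab ba => /(@abslt_valuedE F v _ _ a0) ab /(@abslt_valuedE F v _ _ a0) ba.
case: ab => [/eqP|ab]; first by rewrite (negPf b0).
have bav : a - b != 0.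
  by apply/eqP => /subr0_eq E; move: ab; rewrite E ltxx.
have {}ba : vval v a < vval v (a - b).
  rewrite -opprB vvalN; case: ba => // /eqP; rewrite subr_eq0 eq_sym -subr_eq0.
  by rewrite (negPf bav).
have /orP[H|H] := vgroup_total (vval v b) (vval v (a - b)).
  have := @vvalD F v b (a - b) b0 bav; rewrite subrKC => /(_ a0 H) H'.
  by move: ab; rewrite vltNge H'.
have := @vvalD F v (a - b) b bav b0; rewrite subrK => /(_ a0 H) H'.
by move: ba; rewrite vltNge H'.
Qed.

(* [K] is either formally real, and then sums of two squares control both terms,
   or ultrametric, and then the absolute value is locally constant away from 0. *)
Lemma ov_dichotomy (K : ovField) :
  (forall r : K, r != 0 -> exists2 s, s != 0 &
     forall a b, abslt (a * a + b * b) s -> abslt a r /\ abslt b r) \/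
  (forall a b : K, abslt (b - a) a -> absle a b /\ absle b a).
Proof.
case: K => [F|F v]; [left=> r r0|right; exact: valued_ultrametric].
exists (r * r); first by rewrite mulf_neq0.
suff H (a b : OrderedField F) : abslt (a * a + b * b) (r * r) -> abslt a r.
  by move=> a b ab; split; [exact: H ab|rewrite addrC in ab; exact: H ab].
move=> /abslt_orderedE ab; apply/abslt_orderedE; move: ab.
rewrite ger0_norm; last by apply: addr_ge0; rewrite -expr2 sqr_ge0.
rewrite normrM -expr2 => ab.
rewrite -(@ltr_pXn2r _ 2)// ?nnegrE//; apply: le_lt_trans ab.
by rewrite real_normK ?num_real// expr2 lerDl -expr2 sqr_ge0.
Qed.

(** * Zero sets and codes of points in C(X) *)

Section ContinuousDefinable.
Variables (K : ovField) (L : language) (S : structure L K) (m : nat).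
Variables (X : defset (expansion S) m) (x0 : dset X).
Local Notation KK := (expansion S).
Local Notation R := (cdfun X).
Implicit Types (f g h p w : R) (x y z : dset X) (r s : K).

Lemma cdfun_ext f g : f =1 g -> f = g.
Proof. by move=> fg; apply: val_inj; apply/funext. Qed.

Lemma cdBE f g x : (f - g) x = f x - g x. Proof. by []. Qed.
Lemma cdDE f g x : (f + g) x = f x + g x. Proof. by []. Qed.
Lemma cdME f g x : (f * g) x = f x * g x. Proof. by []. Qed.
Lemma cd1E x : (1 : R) x = 1. Proof. by []. Qed.
Lemma cd_near f x r : r != 0 -> exists2 s, s != 0 &
  forall y, oball (val x) s (val y) -> abslt (f y - f x) r.
Proof. by move=> r0; have /ov_continuousP/(_ x r r0) := cd_continuous (f := f). Qed.

Lemma cd_cst (a : K) : exists f, forall x, f x = a.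
Proof.
apply: (ex_cdfun (x0 := x0) (f := fun=> a)); first exact: cst_continuous.
exact: envfun_cst.
Qed.

Lemma cd_coord i : exists f, forall x, f x = val x 0 i.
Proof.
apply: (ex_cdfun (x0 := x0) (f := fun x => val x 0 i)).
  by apply/ov_continuousP => x r r0; exists r => // y; exact.
exact/kfun_coord/envpt_var.
Qed.

(** The inverse is continuous because 1/f(y) - 1/f(x) = (f(x) - f(y)) / (f(y) f(x)), where |f(y)| is
    bounded below near x. *)
Lemma cd_inv f : (forall x, f x != 0) -> exists g, f * g = 1.
Proof.
move=> f0; have [||g gE] := ex_cdfun (X := X) (x0 := x0) (f := fun x => (f x)^-1).
- apply/ov_continuousP => x r r0.
  have [a a0 aP] := absle_near (f0 x).
  have [s s0 sP] := @cd_near f x a a0.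
  have [t t0 tP] := @cd_near f x (r * (a * f x))
    (mulf_neq0 r0 (mulf_neq0 a0 (f0 x))).
  have [u u0 uP] := oball_min m s0 t0.
  exists u => // y /uP[/sP/aP fa /tP ft].
  have -> : (f y)^-1 - (f x)^-1 = (f x - f y) * (f y * f x)^-1.
    by rewrite invfM mulrBl mulrCA mulfV// mulr1 mulVKf.
  apply/(abslt_mul2r _ _ (mulf_neq0 (f0 y) (f0 x))); rewrite mulfVK ?mulf_neq0//.
  apply: abslt_le_trans (abslt_distC ft) _.
  by apply: absleM (absle_refl _) _; apply: absleM fa (absle_refl _).
- apply: (envdef_iff (P := fun e => f (totpt x0 (\row_(i < m) e i.+1)) * e 0%N = 1)) => [e|].
    split=> [fe|<-]; last by rewrite mulfV.
    by apply: (mulfI (f0 (totpt x0 (\row_(i < m) e i.+1)))); rewrite mulfV.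
  apply: envdef_eq; last exact: envfun_cst.
  by apply: kfun_mul; [exact/kfun_cd/envpt_var|exact: envfun_var].
- by exists g; apply: cdfun_ext => x; rewrite cdME gE mulfV.
Qed.

(** Gluing is continuous at points where the two functions agree and at points near which the
    condition is constant. *)
Lemma cd_if (P : dset X -> Prop) f g :
  envdef KK (fun e => P (totpt x0 (\row_(i < m) e i))) ->
  (forall x, f x = g x \/ exists2 r, r != 0 &
     forall y, oball (val x) r (val y) -> (P y <-> P x)) ->
  exists h, forall x, (P x -> h x = f x) /\ (~ P x -> h x = g x).
Proof.
move=> dP Pfg.
have [||h hE] := ex_cdfun (X := X) (x0 := x0) (f := fun x => if `[< P x >] then f x else g x).
- apply/ov_continuousP => x r r0.
  have [a a0 aP] := @cd_near f x r r0.
  have [b b0 bP] := @cd_near g x r r0.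
  have [c c0 cP] := oball_min m a0 b0.
  case: (Pfg x) => [fg|[d d0 dP']].
    by exists c => // y /cP[/aP fy /bP gy]; move: fy gy;
      case: asboolP => _; case: asboolP => _; rewrite fg.
  have [e e0 eP] := oball_min m c0 d0.
  exists e => // y /eP[/cP[/aP fy /bP gy] /dP' Pyx].
  by case: asboolP => Px; case: asboolP => Py //; exfalso; tauto.
- pose p (e : nat -> K) := totpt x0 (\row_(i < m) e i.+1).
  apply: (envdef_iff (P := fun e => (P (p e) /\ f (p e) = e 0%N) \/
      (~ P (p e) /\ g (p e) = e 0%N))) => [e|].
    by rewrite /p; case: asboolP => Pe; split=> [[[]|[]]|]//; [left|right].
  have dPp : envdef KK (fun e => P (p e)) := envdef_shift dP.
  have dp : envpt x0 p by exact: envpt_var.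
  apply: envdef_or; apply: envdef_and; rewrite //; try exact: envdef_not.
  + by apply: envdef_eq; [exact: (kfun_cd _ dp)|exact: envfun_var].
  + by apply: envdef_eq; [exact: (kfun_cd _ dp)|exact: envfun_var].
- by exists h => x; rewrite hE; case: asboolP.
Qed.

(** Near x, a function that is non-zero at x keeps its absolute value; if only one of the two
    vanishes at x, it stays smaller than the other. *)
Lemma ultrametric_locally_constant f g x :
  (forall a b : K, abslt (b - a) a -> absle a b /\ absle b a) ->
  f x != 0 \/ g x != 0 -> exists2 r, r != 0 & forall y,
    oball (val x) r (val y) -> (absle (g y) (f y) <-> absle (g x) (f x)).
Proof.
move=> um fg0.
have nz (u : R) : u x != 0 -> exists2 r, r != 0 & forall y,
    oball (val x) r (val y) -> absle (u x) (u y) /\ absle (u y) (u x).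
  move=> u0; have [r r0 rP] := @cd_near u x _ u0.
  by exists r => // y /rP; exact: um.
have zz (u w : R) : u x = 0 -> w x != 0 -> exists2 r, r != 0 & forall y,
    oball (val x) r (val y) -> abslt (u y) (w y).
  move=> u0 w0; have [r r0 rP] := nz w w0.
  have [s s0 sP] := @cd_near u x _ w0.
  have [t t0 tP] := oball_min m r0 s0.
  exists t => // y /tP[/rP[wy _] /sP]; rewrite u0 subr0 => uy.
  exact: abslt_le_trans wy.
have [fx|fx] := eqVneq (f x) 0.
  case: fg0 => [|g0]; first by rewrite fx eqxx.
  have [r r0 rP] := zz f g fx g0; exists r => // y /rP fgy.
  split; first by move/absltNge: fgy.
  by rewrite fx => /absler0 E; rewrite E eqxx in g0.
have [gx|gx] := eqVneq (g x) 0.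
  have [r r0 rP] := zz g f gx fx; exists r => // y /rP fgy.
  by split=> _; [rewrite gx; exact: absle0r|exact: abslt_absle].
have [r r0 rP] := nz f fx; have [s s0 sP] := nz g gx.
have [t t0 tP] := oball_min m r0 s0.
exists t => // y /tP[/rP[f1 f2] /sP[g1 g2]]; split=> H.
  exact: absle_trans g1 (absle_trans H f2).
exact: absle_trans g2 (absle_trans H f1).
Qed.

Lemma kdef_absle_cd f g :
  envdef KK (fun e => absle (f (totpt x0 (\row_(i < m) e i)))
                            (g (totpt x0 (\row_(i < m) e i)))).
Proof. by apply: kdef_absle; exact/kfun_cd/envpt_var. Qed.

(** [h] stands in for max(|f|, |g|): it is f^2 + g^2 in the formally real case, and the larger of
    [f] and [g] in the ultrametric case, where the two pieces agree at common zeros. *)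
Lemma cd_norm2 f g : exists h, (forall x, f x = 0 -> g x = 0 -> h x = 0) /\
  (forall r, r != 0 -> exists2 s, s != 0 &
     forall y, abslt (h y) s -> abslt (f y) r /\ abslt (g y) r).
Proof.
have [sq|um] := ov_dichotomy K.
  exists (f * f + g * g); split=> [x fx gx|r /sq[s s0 sP]].
    by rewrite cdDE !cdME fx gx mulr0 addr0.
  by exists s => // y; exact: sP.
have [x|h hE] := cd_if (P := fun x => absle (g x) (f x)) (f := f) (g := g) (kdef_absle_cd g f).
  have [fx|fx] := eqVneq (f x) 0; last first.
    by right; apply: ultrametric_locally_constant um _; left.
  have [gx|gx] := eqVneq (g x) 0; first by left; rewrite fx.
  by right; apply: ultrametric_locally_constant um _; right.
exists h; split=> [x fx gx|r r0].
  by have [h1 h2] := hE x; have [/h1|/h2] := pselect (absle (g x) (f x)) => ->.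
exists r => // y; have [h1 h2] := hE y.
have [gf|gf] := pselect (absle (g y) (f y)).
  by rewrite h1// => fr; split=> //; exact: absle_lt_trans fr.
rewrite h2// => gr; split=> //; apply: abslt_trans gr; exact/absltNge.
Qed.

Lemma cd_norm2_eq0 h f g :
  (forall r, r != 0 -> exists2 s, s != 0 &
     forall y, abslt (h y) s -> abslt (f y) r /\ abslt (g y) r) ->
  forall y, h y = 0 -> f y = 0 /\ g y = 0.
Proof.
move=> H y hy; split; apply: contrapT => /eqP u0; have [s s0 sP] := H _ u0.
  by have := sP y; rewrite hy => /(_ (abslt0 s0))[/abslt_irr].
by have := sP y; rewrite hy => /(_ (abslt0 s0))[_ /abslt_irr].
Qed.

Definition disj f g : Prop := exists a b, a * f + b * g = 1.

Lemma disjP f g : disj f g <-> forall x, ~ (f x = 0 /\ g x = 0).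
Proof.
split=> [[a [b E]] x [fx gx]|H].
  have /eqP := cd1E x; rewrite -E cdDE !cdME fx gx !mulr0 addr0 eq_sym.
  by rewrite oner_eq0.
suff [a [b u0]] : exists a b, forall x, (a * f + b * g) x != 0.
  have [w wE] := cd_inv u0; exists (w * a), (w * b).
  by rewrite -!mulrA -mulrDr mulrC.
have [sq|um] := ov_dichotomy K.
  exists f, g => x; apply/eqP => u0; apply: (H x).
  apply: (@cd_norm2_eq0 (f * f + g * g)) => // r /sq[s s0 sP].
  by exists s => // y; exact: sP.
(* In the ultrametric case [a] is the indicator function of |g| <= |f|, continuous as there is no
   common zero; a f + (1 - a) g is at each point the larger of the two values, hence never 0. *)
have [o oE] := cd_cst 1; have [z zE] := cd_cst 0.
have [x|a aE] := cd_if (P := fun x => absle (g x) (f x)) (f := o) (g := z) (kdef_absle_cd g f).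
  right; apply: ultrametric_locally_constant um _.
  have [fx|] := eqVneq (f x) 0; last by left.
  by have [gx|] := eqVneq (g x) 0; [case: (H x)|right].
exists a, (1 - a) => x; rewrite cdDE !cdME cdBE cd1E; have [a1 a2] := aE x.
have [gf|gf] := pselect (absle (g x) (f x)).
  rewrite a1// oE subrr mul0r addr0 mul1r; apply/eqP => fx; apply: (H x).
  by split=> //; rewrite fx in gf; exact: absler0.
rewrite a2// zE mul0r add0r subr0 mul1r.
by apply: (@abslt_neq0 _ (f x)); exact/absltNge.
Qed.

(** [cd_norm2] is iterated over the functions y_i - x_i, so that a small value of [p] forces all
    coordinates of y close to those of x. *)
Lemma cd_code x : exists p, p x = 0 /\ (forall r, r != 0 -> exists2 s, s != 0 &
  forall y, abslt (p y) s -> oball (val x) r (val y)).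
Proof.
suff [p [px pP]] : exists p, p x = 0 /\ (forall r, r != 0 -> exists2 s, s != 0 &
    forall y, abslt (p y) s -> forall i, i \in enum 'I_m -> abslt (val y 0 i - val x 0 i) r).
  exists p; split=> // r /pP[s s0 sP]; exists s => // y /sP H i.
  by apply: H; exact: mem_enum.
elim: (enum 'I_m) => [|j l [p [px pP]]].
  by exists 0; split=> // r r0; exists r.
have [u uE] := cd_coord j; have [c cE] := cd_cst (val x 0 j).
have [h [h0 hP]] := cd_norm2 p (u - c).
exists h; split; first by apply: h0; rewrite // cdBE uE cE subrr.
move=> r r0; have [s s0 sP] := pP r r0.
have [t t0 tP] := abslt_min r0 s0; have [w w0 wP] := hP t t0.
exists w => // y /wP[/tP[_ /sP py] /tP[+ _]]; rewrite cdBE uE cE => jr i.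
by rewrite inE => /orP[/eqP -> //|]; exact: py.
Qed.

Lemma cd_code_eq0 p x : (forall r, r != 0 -> exists2 s, s != 0 &
    forall y, abslt (p y) s -> oball (val x) r (val y)) ->
  forall y, p y = 0 -> y = x.
Proof.
move=> pP y py; apply: val_inj; apply/rowP => i.
apply/eqP; rewrite -subr_eq0; apply: contrapT => /negP yx.
have [s s0 /(_ y)] := pP _ yx; rewrite py => /(_ (abslt0 s0))/(_ i).
exact: abslt_irr.
Qed.

Definition iscode p x : Prop := forall y, p y = 0 <-> y = x.

Lemma ex_iscode x : exists p, iscode p x.
Proof.
have [p [px pP]] := cd_code x; exists p => y.
by split=> [|->] //; exact: cd_code_eq0.
Qed.

(** Inclusion of the zero set of [p] in that of [f], expressed without points. *)
Definition zsub p f : Prop := forall g, disj g f -> disj g p.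

(** If [f] were non-zero at a zero x of [p], a function vanishing only at x would be disjoint from
    [f] but not from [p]. *)
Lemma zsubP p f : zsub p f <-> forall x, p x = 0 -> f x = 0.
Proof.
split=> [pf x px|pf g /disjP gf].
  have [g gx] := ex_iscode x; apply: contrapT => fx.
  have /disjP/(_ x) : disj g p.
    by apply: pf; apply/disjP => y [/gx ->].
  by apply; split=> //; exact/gx.
by apply/disjP => x [gx px]; apply: (gf x); split=> //; exact: pf.
Qed.

(** The zero set of [p] is minimal among the non-empty ones, that is, a singleton. *)
Definition ispt p : Prop :=
  ~ disj p p /\ forall g, zsub g p -> ~ disj g g -> zsub p g.

Lemma isptP p : ispt p <-> exists x, iscode p x.
Proof.
have ndisj f : ~ disj f f <-> exists x, f x = 0.
  split=> [H|[x fx] /disjP/(_ x)]; last by apply.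
  apply: contrapT => nx; apply: H; apply/disjP => x [fx _].
  by apply: nx; exists x.
split.
  move=> [/ndisj[x px] H]; exists x => y; split=> [py|->//].
  have [g gx] := ex_iscode x.
  have /zsubP pg : zsub p g.
    by apply: H; [apply/zsubP => z /gx ->|apply/ndisj; exists x; exact/gx].
  exact/gx/pg.
move=> [x px]; split; first by apply/ndisj; exists x; exact/px.
move=> g /zsubP gp /ndisj[y gy]; apply/zsubP => z /px ->.
by have /px <- := gp _ gy.
Qed.

End ContinuousDefinable.

(** * Dimension and local dimension *)

Section DimensionTheory.
Variable K : ovField.
Implicit Types m d j : nat.

Lemma natdim_le j d : (natdim j <= natdim d)%E = (j <= d)%N.
Proof. by rewrite /natdim lee_fin lez_nat. Qed.

Lemma natdim_lt j d : (natdim j < natdim d)%E = (j < d)%N.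
Proof. by rewrite /natdim lte_fin ltz_nat. Qed.

Lemma tdim_set0 m : tdim (set0 : set 'rV[K]_m) = -oo%E.
Proof. by rewrite /tdim eqxx. Qed.

Lemma tdim_nat m (A : set 'rV[K]_m) : A !=set0 -> exists d, tdim A = natdim d.
Proof. by move=> /set0P A0; rewrite /tdim (negPf A0); eexists. Qed.

Lemma tdim_sub m (A B : set 'rV[K]_m) : A `<=` B -> (tdim A <= tdim B)%E.
Proof.
move=> AB; have [->|/set0P[x Ax]] := eqVneq A set0; first by rewrite tdim_set0 leNye.
rewrite /tdim; case: ifPn => [_|A0]; first exact: leNye.
case: ifPn => [/eqP B0|_]; first by have := AB x Ax; rewrite B0.
rewrite natdim_le; apply/bigmax_leqP => I /asboolP[y Iy].
apply: leq_bigmax_cond; apply/asboolP; exists y.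
by apply: interiorS Iy; exact: image_subset.
Qed.

Lemma natdim_le_tdim m (A : set 'rV[K]_m) j : (natdim j <= tdim A)%E -> A !=set0.
Proof. by move=> H; apply/set0P/eqP => A0; move: H; rewrite A0 tdim_set0. Qed.

End DimensionTheory.

Section LocalDimension.
Variables (K : ovField) (m : nat) (X : set 'rV[K]_m).

Definition locdim_ge j (x : 'rV[K]_m) : Prop :=
  forall r, r != 0 -> (natdim j <= tdim (oball x r `&` X))%E.

(** Balls centred at a point of X meet X, so the dimensions involved are natural numbers and have a
    minimum [k]. *)
Lemma tldimP x d : X x -> tldim X x = natdim d <->
  locdim_ge d x /\ exists2 r, r != 0 & tdim (oball x r `&` X) = natdim d.
Proof.
move=> Xx; pose D := [set tdim (oball x r `&` X) | r in [set r : K | r != 0]].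
have Dd r : r != 0 -> exists d, tdim (oball x r `&` X) = natdim d.
  by move=> r0; apply: tdim_nat; exists x; split=> //; exact: oball_center.
pose P k := `[< D (natdim k) >].
have exP : exists k, P k.
  have [k Hk] := Dd 1 (oner_neq0 _); exists k; apply/asboolP.
  by exists 1 => //; exact: oner_neq0.
have [k /asboolP Dk kmin] := ex_minnP exP.
have lbk : (D `&` lbound D) (natdim k).
  split=> // _ [r r0 <-]; have [l rl] := Dd r r0; rewrite rl natdim_le.
  by apply: kmin; apply/asboolP; exists r.
have -> : tldim X x = natdim k.
  rewrite /tldim; case: xgetP => [y _ [Dy /(_ _ Dk) yk]|/(_ (natdim k))//].
  by apply/le_anti; rewrite yk lbk.2.
split=> [/eqP|[ge [r r0 rd]]].
  rewrite eq_le !natdim_le -eqn_leq => /eqP <-; split.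
    by move=> r r0; apply: lbk.2; exists r.
  by have [r r0 rk] := Dk; exists r.
apply/le_anti; rewrite -{1}rd lbk.2/=; last by exists r.
by have [s s0 <-] := Dk; exact: ge.
Qed.

Lemma locdim_geP x j : X x ->
  locdim_ge j x <-> exists2 d, (j <= d)%N & tldim X x = natdim d.
Proof.
move=> Xx; split=> [ge|[d jd /tldimP-/(_ Xx)[ge _] r r0]]; last first.
  by apply: le_trans (ge r r0); rewrite natdim_le.
have [d Hd] : exists d, tldim X x = natdim d.
  have Dd r : r != 0 -> exists d, tdim (oball x r `&` X) = natdim d.
    by move=> r0; apply: tdim_nat; exists x; split=> //; exact: oball_center.
  pose P k := `[< exists2 r, r != 0 & tdim (oball x r `&` X) = natdim k >].
  have exP : exists k, P k.
    have [k Hk] := Dd 1 (oner_neq0 _); exists k; apply/asboolP.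
    by exists 1 => //; exact: oner_neq0.
  have [k /asboolP Dk kmin] := ex_minnP exP; exists k.
  apply/tldimP => //; split=> // r r0; have [l rl] := Dd r r0.
  by rewrite rl natdim_le; apply: kmin; apply/asboolP; exists r.
exists d => //; have /tldimP-/(_ Xx)[_ [r r0 rd]] := Hd.
by rewrite -natdim_le -rd; exact: ge.
Qed.

Lemma DeltaP k x : X x -> Delta k X x <-> locdim_ge k x /\ ~ locdim_ge k.+1 x.
Proof.
move=> Xx; rewrite !locdim_geP//; split.
  move=> [_ xk]; split; first by exists k.
  move=> [d kd]; rewrite xk => /eqP; rewrite eq_le !natdim_le.
  by rewrite [(d <= k)%N]leqNgt kd andbF.
move=> [[d kd xd] H]; split=> //; rewrite xd; congr natdim; apply/eqP.
rewrite eqn_leq kd andbT leqNgt; apply/negP => dk; apply: H.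
by exists d.
Qed.

Lemma bigcup_DeltaP k x : X x ->
  (\bigcup_(l in [set l | (k <= l)%N]) Delta l X) x <-> locdim_ge k x.
Proof.
move=> Xx; rewrite locdim_geP//; split=> [[l /= kl [_ xl]]|[l kl xl]].
  by exists l.
by exists l.
Qed.

End LocalDimension.

(** * Boxes: points with freely moving coordinates *)

Section Boxes.
Variables (K : ovField) (L : language) (S : structure L K) (m : nat).
Variables (X : defset (expansion S) m) (x0 : dset X).
Local Notation KK := (expansion S).
Local Notation R := (cdfun X).
Implicit Types (f g h p w : R) (x y z : dset X) (r s : K).

(* On the ball, the coordinates in [I] can be perturbed freely, and continuously
   at each point: this is all that is used of the charts given by [Wset]. *)
Definition box z r (I : {set 'I_m}) : Prop := r != 0 /\
  forall y, oball (val z) r (val y) -> forall s, s != 0 -> exists2 t, t != 0 &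
    forall v : 'I_m -> K, (forall i, abslt (v i) t) -> exists y',
      [/\ oball (val z) r (val y'), oball (val y) s (val y') &
          forall i, i \in I -> val y' 0 i = val y 0 i + v i].

Lemma definable_oball (c : 'rV[K]_m) r : definable KK (oball c r `&` dset X).
Proof.
apply: definableI; last exact: dsetP.
apply: (envdef_definable 0); apply: kdef_oball => [i|i|]; try exact: envfun_cst.
apply: (envdef_iff (P := fun e => e i.+1 = e 0%N)) => [e|]; first by rewrite mxE.
by apply: envdef_eq; exact: envfun_var.
Qed.

(** By (Dim3) some point of the trace [A] has a chart, with |I| = dim A. There the coordinates in
    [I] move freely inside the open set [U], and the inverse chart [g] carries the motion back
    continuously. *)
Lemma ex_box x r j : condDim KK -> r != 0 ->
  (natdim j <= tdim (oball (val x) r `&` dset X))%E ->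
  exists z s I, [/\ oball (val x) r (val z), box z s I, (j <= #|I|)%N &
    forall y, oball (val z) s (val y) -> oball (val x) r (val y)].
Proof.
move=> cD r0 jA; set A := oball (val x) r `&` dset X in jA.
have [d Ad] := tdim_nat (natdim_le_tdim jA).
have [_ _ /(_ d Ad) Wd] := cD m A (definable_oball _ _).
have [z [Az [r' [I [U [r'0 Id oU [g [fU fK _ gc]]]]]]]] : Wset d A !=set0.
  apply/set0P/eqP => W0; move: Wd.
  by rewrite W0 setD0 Ad ltxx.
have [Bz Xz] := Az; have [t t0 tP] := oball_open r0 Bz.
have [s s0 sP] := oball_min m t0 r'0.
exists (totpt x0 z), s, I; split.
- by rewrite totpt_in.
- split=> // y; rewrite totpt_in// => zy u u0.
  have [zty zr'y] := sP _ _ zy; have Ay : A (val y).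
    by split; [exact: tP|exact: set_valP].
  pose u' := coord_proj I (val y).
  have Uu : U u' by rewrite -fU; exists (val y).
  have gu : g u' = val y by apply: fK; apply/mem_set.
  have [a a0 aP] := oball_open s0 zy.
  have [b b0 bP] := oball_min m a0 u0.
  have nU : nbhs u' U by exact: open_nbhs_nbhs.
  have ng : nbhs u' [set w | U w -> oball (val y) b (g w)].
    have nb : nbhs (g u') (oball (val y) b) by rewrite gu; apply/nbhs_oballE; exists b.
    by move/subspace_continuousP: gc => /(_ u' Uu _ nb).
  have /nbhs_oballE[c c0 cP] : nbhs u' (U `&` [set w | U w -> oball (val y) b (g w)]).
    exact: filterI.
  exists c => // v vc.
  pose w : 'rV[K]_#|I| := \row_k (u' 0 k + v (enum_val k)).
  have [Uw /(_ Uw) gw] : (U `&` [set w | U w -> oball (val y) b (g w)]) w.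
    by apply: cP => k; rewrite mxE addrAC subrr add0r.
  have [w' Aw' fw'] : (coord_proj I @` (oball z r' `&` A)) w by rewrite fU.
  have [_ [_ Xw']] := Aw'.
  have gw' : g w = w' by rewrite -fw' fK//; apply/mem_set.
  rewrite gw' in gw; have [/aP zw'' yw'] := bP _ _ gw.
  exists (totpt x0 w'); rewrite totpt_in//; split=> // i iI.
  have := congr1 (fun M : 'rV[K]_#|I| => M 0 (enum_rank_in iI i)) fw'.
  by rewrite /w !mxE enum_rankK_in.
- by rewrite Id -natdim_le -Ad.
- by move=> y; rewrite totpt_in// => /sP[/tP].
Qed.

End Boxes.

(** * Chains of zero sets and local dimension *)

Section Chains.
Variables (K : ovField) (L : language) (S : structure L K) (m : nat).
Variables (X : defset (expansion S) m) (x0 : dset X).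
Local Notation KK := (expansion S).
Local Notation R := (cdfun X).
Implicit Types (f g h p w e : R) (x y z : dset X) (r s : K).

Definition nbd p e : set (dset X) := [set y | abslt (p y) (e y)].

Lemma nbd_center p e x : p x = 0 -> e x != 0 ->
  exists2 r, r != 0 & forall y, oball (val x) r (val y) -> nbd p e y.
Proof.
move=> px ex; have [a a0 aP] := absle_near ex.
have [r r0 rP] := @cd_near _ _ _ _ _ p x a a0.
have [s s0 sP] := @cd_near _ _ _ _ _ e x a a0.
have [t t0 tP] := oball_min m r0 s0; exists t => // y /tP[/rP + /sP/aP].
by rewrite px subr0 => py ey; exact: abslt_le_trans ey.
Qed.

Lemma ex_nbd x r : r != 0 -> exists p e,
  [/\ p x = 0, forall y, e y = e x, e x != 0 &
      forall y, nbd p e y -> oball (val x) r (val y)].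
Proof.
move=> r0; have [p [px pP]] := cd_code x0 x; have [s s0 sP] := pP r r0.
have [e eE] := cd_cst x0 s; exists p, e; split=> //.
- by move=> y; rewrite !eE.
- by rewrite eE.
- by move=> y; rewrite /nbd /= eE; exact: sP.
Qed.

Lemma nbd_open p e : (forall y z, e y = e z) -> forall y, nbd p e y ->
  exists2 r, r != 0 & forall z, oball (val y) r (val z) -> nbd p e z.
Proof.
move=> ec y py; have [a a0 aP] := abslt_open py.
have [r r0 rP] := @cd_near _ _ _ _ _ p y a a0; exists r => // z /rP /aP.
by rewrite /nbd /= (ec z y) subrKC.
Qed.

(** Zero sets are taken inside [nbd p e]. The second clause makes each zero of [h'] a limit of zeros
    of [h] that are not zeros of [h']. The index counts inclusions, so there are j + 1 sets. *)
Fixpoint chain j h p e : Prop :=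
  if j is j'.+1 then exists h',
    [/\ forall y, nbd p e y -> h' y = 0 -> h y = 0,
        forall y, nbd p e y -> h' y = 0 -> forall p' e', p' y = 0 -> e' y != 0 ->
          exists z, [/\ nbd p e z, nbd p' e' z, h z = 0 & h' z != 0] &
        chain j' h' p e]
  else exists y, h y = 0 /\ nbd p e y.

(** Let [B] be the set of zeros of [h] that are not zeros of [h']. The zero set of [h'] lies in the
    frontier of [B], which has smaller dimension than [B] by (Dim2), so each inclusion raises the
    dimension by at least one. *)
Lemma chain_dim j h p e : condDim KK -> chain j h p e ->
  (natdim j <= tdim [set val y | y in [set y | nbd p e y /\ h y = 0%R]])%E.
Proof.
move=> cD; elim: j h => [|j IH] h.
  move=> [y [hy py]]; set A := [set _ | _ in _].
  have [|d ->] := @tdim_nat _ _ A; first by exists (val y), y.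
  by rewrite natdim_le.
move=> [h' [h'h nd /IH]]; set A' := [set _ | _ in _]; set A := [set _ | _ in _] => jA'.
pose B : set 'rV[K]_m := [set v | exists y, (forall i, val y 0 i = v 0 i) /\
  (abslt (p y) (e y) /\ (h y = 0 /\ h' y != 0))].
have dB : definable KK B.
  by apply: (envdef_definable 0); rewrite /B/=; kdef.
have BA : B `<=` A.
  move=> v [y [yv [py [hy _]]]]; exists y => //.
  by apply/rowP => i; rewrite yv.
have A'B : A' `<=` frontier B.
  move=> _ [y [py hy] <-]; split; last first.
    move=> [z [zy [_ [_ h'z]]]]; have E : z = y by apply/val_inj/rowP => i; rewrite zy.
    by rewrite E hy eqxx in h'z.
  move=> C /nbhs_oballE[r r0 rC]; have [p' [e' [p'y _ e'y pe']]] := ex_nbd y r0.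
  have [z [pz pz' hz h'z]] := nd y py hy p' e' p'y e'y.
  exists (val z); split; last exact/rC/pe'.
  by exists z.
have [v A'v] := natdim_le_tdim jA'.
have B0 : B !=set0.
  have [+ _] := A'B v A'v; move=> /(_ setT) [|w [Bw _]]; last by exists w.
  exact: filterT.
have [_ [_ /(_ B0) lt] _] := cD m B dB.
have [d Bd] := tdim_nat B0.
apply: le_trans (tdim_sub BA); rewrite Bd natdim_le -natdim_lt -Bd.
exact: le_lt_trans (le_trans jA' (tdim_sub A'B)) lt.
Qed.

(** The free coordinates are fixed one after the other to their values at [z]. The list [t] holds
    those still free: membership in the zero set of [h] depends only on the coordinates in [I]
    outside [t]. *)
Lemma box_chain z r I p e : box z r I -> (forall y y', e y = e y') ->
  nbd p e z -> (forall y, nbd p e y -> oball (val z) r (val y)) ->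
  forall (t : seq 'I_m) h, uniq t -> {subset t <= I} ->
  (forall y y', nbd p e y -> nbd p e y' ->
     (forall i, i \in I -> i \notin t -> val y' 0 i = val y 0 i) ->
     h y = 0 -> h y' = 0) ->
  h z = 0 -> chain (size t) h p e.
Proof.
move=> [r0 bx] ec pz pr; elim=> [|i t IH] h /=; first by move=> _ _ _ hz; exists z.
move=> /andP[it ut] tI hI hz.
have [u uE] := cd_coord x0 i; have [c cE] := cd_cst x0 (val z 0 i).
have [h' [h'0 /cd_norm2_eq0 h'E]] := cd_norm2 x0 h (u - c).
have uzE y : h' y = 0 -> h y = 0 /\ val y 0 i = val z 0 i.
  by move=> /h'E[hy /eqP]; rewrite cdBE uE cE subr_eq0 => /eqP.
have h'zE y : h y = 0 -> val y 0 i = val z 0 i -> h' y = 0.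
  by move=> hy yi; apply: h'0; rewrite // cdBE uE cE yi subrr.
exists h'; split.
- by move=> y _ /h'E[].
- move=> y py /uzE[hy yi] p' e' p'y e'y.
  have [a a0 aP] := nbd_open ec py; have [b b0 bP] := nbd_center p'y e'y.
  have [s s0 sP] := oball_min m a0 b0.
  have [d d0 dP] := bx y (pr _ py) s s0; have [q q0 qd] := ex_abslt d0.
  (* Moving only coordinate [i], among those in [I], by a non-zero [q] stays in the zero set of [h]
     and leaves that of [h']. *)
  have [|y' [_ yy' y'E]] := dP (fun k => if k == i then q else 0).
    by move=> k; case: eqP => _ //; exact: abslt0.
  have [/aP py' /bP py''] := sP _ _ yy'.
  exists y'; split=> //.
    apply: (hI y) => // k kI; rewrite inE negb_or => /andP[/negPf ki _].
    by rewrite y'E// ki addr0.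
  apply/eqP => /uzE[_]; rewrite y'E ?tI ?mem_head// eqxx yi => /eqP.
  by rewrite -subr_eq0 addrAC subrr add0r (negPf q0).
- apply: IH => //; first by move=> k kt; apply: tI; rewrite inE kt orbT.
  + move=> y y' py py' E /uzE[hy yi]; apply: h'zE.
      apply: (hI y) => // k kI; rewrite inE negb_or => /andP[_ kt].
      exact: E.
    by rewrite E// tI// mem_head.
  + exact: h'zE.
Qed.

Lemma box_nbd_chain z r I j : box z r I -> (j <= #|I|)%N -> exists p e,
  (forall y, nbd p e y -> oball (val z) r (val y)) /\ chain j 0 p e.
Proof.
move=> bx jI; have [p [e [pz ec ez pe]]] := ex_nbd z bx.1.
exists p, e; split=> //.
have -> : j = size (take j (enum I)) by rewrite size_take -cardE; case: ltngtP jI.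
apply: (box_chain bx) => //.
- by move=> y y'; rewrite ec [RHS]ec.
- by rewrite /nbd /= pz; exact: abslt0.
- by rewrite take_uniq// enum_uniq.
- by move=> i /mem_take; rewrite mem_enum.
Qed.

Lemma box_sub z r s I : box z r I -> s != 0 -> exists t, box z t I /\
  forall y, oball (val z) t (val y) -> oball (val z) s (val y).
Proof.
move=> [r0 bx] s0; have [t t0 tP] := oball_min m r0 s0.
exists t; split=> [|y /tP[]//]; split=> // y zy q q0.
have [a a0 aP] := oball_open t0 zy; have [b b0 bP] := oball_min m a0 q0.
have [d d0 dP] := bx y (tP _ _ zy).1 b b0; exists d => // v vd.
have [y' [_ yy' y'E]] := dP v vd; exists y'.
by have [/aP ? ?] := bP _ _ yy'.
Qed.

Definition locdim_formula j x : Prop :=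
  forall p e, p x = 0 -> e x != 0 -> exists p' e',
    (forall y, nbd p' e' y -> nbd p e y) /\ chain j 0 p' e'.

Lemma locdim_formula_sound j x : condDim KK ->
  locdim_formula j x -> locdim_ge (dset X) j (val x).
Proof.
move=> cD H r r0; have [p [e [px _ ex pe]]] := ex_nbd x r0.
have [p' [e' [p'p /chain_dim-/(_ cD) jd]]] := H p e px ex.
apply: le_trans jd _; apply: tdim_sub => _ [y [/p'p/pe xy _] <-].
by split=> //; exact: set_valP.
Qed.

Lemma locdim_formulaP j x : condDim KK ->
  locdim_formula j x <-> locdim_ge (dset X) j (val x).
Proof.
move=> cD; split=> [|H p e px ex]; first exact: locdim_formula_sound.
have [r r0 rP] := nbd_center px ex.
have [z [s [I [xz bx jI sr]]]] := ex_box x0 cD r0 (H r r0).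
have [p' [e' [p'P ch]]] := box_nbd_chain bx jI.
by exists p', e'; split=> // y /p'P/sr/rP.
Qed.

(** The box can be shrunk around [z], and each smaller box carries a chain of index [j]. *)
Lemma box_locdim_ge z r I j : condDim KK -> box z r I -> (j <= #|I|)%N ->
  locdim_ge (dset X) j (val z).
Proof.
move=> cD bx jI; apply: locdim_formula_sound => // p e pz ez.
have [s s0 sP] := nbd_center pz ez; have [t [bt ts]] := box_sub bx s0.
have [p' [e' [p'P ch]]] := box_nbd_chain bt jI.
by exists p', e'; split=> // y /p'P/ts/sP.
Qed.

End Chains.

(** * Cluster sets and orbits of affine maps *)

Lemma finite_gap (K : ovField) (s : seq K) (a : K) :
  exists2 r, r != 0 & forall b, b \in s -> abslt (b - a) r -> b = a.
Proof.
elim: s => [|c s [r r0 IH]]; first by exists 1; rewrite ?oner_neq0.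
have [ca|ca] := eqVneq c a.
  by exists r => // b; rewrite inE => /orP[/eqP -> _|/IH].
have ca0 : c - a != 0 by rewrite subr_eq0.
have [t t0 tP] := abslt_min r0 ca0.
exists t => // b; rewrite inE => /orP[/eqP -> /tP[_ /abslt_irr]//|bs /tP[+ _]].
exact: IH.
Qed.

Lemma finite_bound (K : ovField) (s : seq K) :
  exists w, forall b, b \in s -> absle b w.
Proof.
elim: s => [|c s [w wP]]; first by exists 0.
have [cw|wc] := absle_total c w.
  by exists w => b; rewrite inE => /orP[/eqP -> //|/wP].
exists c => b; rewrite inE => /orP[/eqP ->|/wP bw]; first exact: absle_refl.
exact: absle_trans wc.
Qed.

Section Clusters.
Variables (K : ovField) (L : language) (S : structure L K) (m : nat).
Variables (X : defset (expansion S) m) (x0 : dset X).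
Local Notation KK := (expansion S).
Local Notation R := (cdfun X).
Implicit Types (c f g h p t w e : R) (x y z : dset X) (a b r s : K).

(** c(x) is a cluster value of g/t at [x] along h = 0. The inequality is multiplied by [t] to stay
    in the ring, and [e] bounds both the distance to [x], through [p], and the distance to the
    cluster value. *)
Definition cluster_value x g h t c : Prop := forall p e, p x = 0 -> e x != 0 ->
  exists y, abslt (p y) (e y) /\ (h y = 0 /\ (t y != 0 /\
    abslt ((g - c * t) y) ((e * t) y))).

(** The same notion inside K, where the finiteness hypothesis applies. *)
Definition cluster_set x g h t : set K := [set a | forall r, r != 0 ->
  exists y, (forall i, abslt (val y 0 i - val x 0 i) r) /\ (h y = 0 /\ (t y != 0 /\
    abslt (g y - a * t y) (r * t y)))].

Lemma abslt_quotient (a b r v : K) : v != 0 ->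
  abslt (a - b * v) (r * v) <-> abslt (a / v - b) r.
Proof.
move=> v0; rewrite -(abslt_mul2r (a / v - b) r v0) mulrBl divfK//.
Qed.

(** Near [x] the functions [c] and [e] vary little: [abslt_split] absorbs the variation of [c], and
    [absle_near] bounds [e] from below. *)
Lemma clusterP x g h t c : cluster_value x g h t c <-> cluster_set x g h t (c x).
Proof.
split=> [H r r0|H p e px ex].
  have [s s0 sP] := abslt_split r0.
  have [u u0 uP] := @cd_near _ _ _ _ _ c x s s0.
  have [v v0 vP] := oball_min m u0 r0.
  have [p [px pP]] := cd_code x0 x; have [w w0 wP] := pP v v0.
  have [q q0 qP] := abslt_min w0 s0.
  have [e eE] := cd_cst x0 q.
  have [|y [py [hy [ty gy]]]] := H p e px; first by rewrite eE.
  rewrite eE in py; have [/wP/vP[/uP cy xy] _] := qP _ py.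
  exists y; split=> //; split=> //; split=> //.
  move: gy; rewrite cdBE !cdME eE => /(abslt_quotient _ _ _ ty)/qP[_ gy].
  apply/(abslt_quotient _ _ _ ty).
  by rewrite -(subrKA (c y)); exact: sP.
have [r1 r10 r1P] := nbd_center px ex.
have [d d0 dP] := absle_near ex.
have [r2 r20 r2P] := @cd_near _ _ _ _ _ e x d d0.
have [s s0 sP] := abslt_split d0.
have [r3 r30 r3P] := @cd_near _ _ _ _ _ c x s s0.
have [r4 r40 r4P] := abslt_min3 r10 r20 r30.
have [r r0 rP] := abslt_min r40 s0.
have [y [xy [hy [ty gy]]]] := H r r0; exists y.
have xy4 i := (rP _ (xy i)).1.
split; first by apply: r1P => i; case: (r4P _ (xy4 i)).
split=> //; split=> //; rewrite cdBE !cdME; apply/(abslt_quotient _ _ _ ty).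
move/(abslt_quotient _ _ _ ty)/rP: gy => [_ gy].
have ey : absle d (e y) by apply/dP/r2P => i; case: (r4P _ (xy4 i)).
apply: abslt_le_trans ey; rewrite -(subrKA (c x)); apply: sP => //.
by apply/abslt_distC/r3P => i; case: (r4P _ (xy4 i)).
Qed.

Lemma definable_cluster_set x g h t : definable1 KK (cluster_set x g h t).
Proof. by apply: (envdef_definable1 0); rewrite /cluster_set/=; kdef. Qed.

Lemma closed_cluster_set x g h t : closed (cluster_set x g h t).
Proof.
move=> a cl r r0; have [s s0 sP] := abslt_split r0.
have [u u0 uP] := abslt_min r0 s0.
have [b [Vb ba]] : (cluster_set x g h t `&` [set b | abslt (b - a) s]) !=set0.
  by apply: cl; apply/nbhs_ovE; exists s.
have [y [xy [hy [ty gy]]]] := Vb u u0; exists y; split.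
  by move=> i; have [] := uP _ (xy i).
split=> //; split=> //; apply/(abslt_quotient _ _ _ ty).
move/(abslt_quotient _ _ _ ty)/uP: gy => [_ gy].
by rewrite -(subrKA b); exact: sP.
Qed.

(* [al], [be] and [b] stand for constants: the clauses say that the cluster set of
   [g / t] at [x] along [h = 0] is bounded and discrete, hence finite, contains [b],
   and that the affine map [a |-> al * a + be] does not leave it, except at [f x]. *)
Definition orbit_formula (al be b : R) x f : Prop := exists g h t,
  (exists w, forall c, cluster_value x g h t c -> absle (c x) (w x)) /\
  ((forall c, cluster_value x g h t c -> exists e, e x != 0 /\
     forall c', cluster_value x g h t c' -> abslt ((c' - c) x) (e x) -> c' x = c x) /\
  (cluster_value x g h t b /\ (cluster_value x g h t f /\
  (forall c, cluster_value x g h t c -> c x <> f x -> cluster_value x g h t (al * c + be))))).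

Lemma orbit_formula_sound (al be b : R) x f :
  (forall A : set K, definable1 KK A -> closed A -> ovbounded A ->
     A `<=` isolated A -> finite_set A) ->
  let T a := al x * a + be x in injective (fun n => iter n T (b x)) ->
  orbit_formula al be b x f -> exists n, f x = iter n T (b x).
Proof.
move=> fin T Tinj [g [h [t [[w wb] [dis [bV [fV stepV]]]]]]].
set V := cluster_set x g h t.
have lift a : V a -> exists2 c : R, c x = a & cluster_value x g h t c.
  by have [c cE] := cd_cst x0 a; exists c => //; apply/clusterP; rewrite cE.
have finV : finite_set V.
  apply: fin; [exact: definable_cluster_set|exact: closed_cluster_set| |].
    by exists (w x) => a /lift[c <-]; exact: wb.
  move=> a Va; split; first exact/mem_set.
  have [c ca Vc] := lift a Va; have [e [e0 eP]] := dis c Vc.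
  exists [set b | abslt (b - a) (e x)]; first by apply/nbhs_ovE; exists (e x).
  apply/seteqP; split=> [a' [/= a'a /lift[c' c'a Vc']]|_ ->].
    by rewrite /= -c'a -ca; apply: eP Vc' _; rewrite cdBE ca c'a.
  by split=> //=; rewrite subrr; exact: abslt0.
apply: contrapT => nf.
(* Stability can fail only at [f x], which the orbit is assumed to miss, so the whole orbit stays in
   [V]; being infinite by injectivity, it contradicts [finV]. *)
have VT n : V (iter n T (b x)).
  elim: n => [|n IH]; first exact/clusterP.
  have [c cE Vc] := lift _ IH; rewrite iterS -cE.
  have : cluster_value x g h t (al * c + be).
    by apply: stepV => // cf; apply: nf; exists n; rewrite -cf cE.
  by move/clusterP.
apply: infinite_nat.
rewrite (_ : setT = (fun n => iter n T (b x)) @^-1` V).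
  by apply: finite_preimage finV => i j _ _; exact: Tinj.
by apply/seteqP; split=> // n _; exact: VT.
Qed.

(** Every non-empty finite subset of K is a cluster set at [x]. Emptiness is excluded because, in
    the construction with a single free coordinate, g/t takes a value of [s] wherever [t] is
    non-zero. *)
Definition has_cluster_sets x : Prop := forall s : seq K, s != [::] ->
  exists g h t, forall a, cluster_set x g h t a <-> a \in s.

(** The cluster set is chosen to be b, T b, ..., T^n b. Its last element is [f x], the only one
    whose image may fall outside. *)
Lemma orbit_formula_complete (al be b : R) x f n : has_cluster_sets x ->
  let T a := al x * a + be x in f x = iter n T (b x) ->
  orbit_formula al be b x f.
Proof.
move=> hx T fxE; have [//|g [h [t V]]] := hx (traject T (b x) n.+1).
have VP c : cluster_value x g h t c <-> c x \in traject T (b x) n.+1.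
  exact: iff_trans (clusterP _ _ _ _ _) (V _).
exists g, h, t; split.
  have [w wP] := finite_bound (traject T (b x) n.+1); have [u uE] := cd_cst x0 w.
  by exists u => c /VP; rewrite uE; exact: wP.
split.
  move=> c _; have [r r0 rP] := finite_gap (traject T (b x) n.+1) (c x).
  have [e eE] := cd_cst x0 r; exists e; rewrite eE; split=> // c' /VP.
  exact: rP.
split; first by apply/VP; rewrite mem_head.
split; first by apply/VP/trajectP; exists n.
move=> c /VP/trajectP[i]; rewrite ltnS leq_eqVlt => /orP[/eqP -> cE|lt cE _].
  by case; rewrite cE fxE.
by apply/VP/trajectP; exists i.+1 => //; rewrite iterS -cE.
Qed.

Lemma box_has_cluster_sets z r (I : {set 'I_m}) : box z r I -> (1 < #|I|)%N ->
  has_cluster_sets z.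
Proof.
move=> [r0 bx] /card_gt1P[i [j [iI jI ij]]] s _.
have [u uE] : exists u : R, forall y, u y = val y 0 i - val z 0 i.
  have [v vE] := cd_coord x0 i; have [c cE] := cd_cst x0 (val z 0 i).
  by exists (v - c) => y; rewrite cdBE vE cE.
have [v vE] : exists v : R, forall y, v y = val y 0 j - val z 0 j.
  have [v vE] := cd_coord x0 j; have [c cE] := cd_cst x0 (val z 0 j).
  by exists (v - c) => y; rewrite cdBE vE cE.
have [h hE] : exists h : R, forall y, h y = 0 <-> exists2 b, b \in s & v y = b * u y.
  elim: s => [|b s [h hE]].
    by exists 1 => y; rewrite cd1E; split=> [/eqP|[]//]; rewrite oner_eq0.
  have [c cE] := cd_cst x0 b; exists ((v - c * u) * h) => y.
  rewrite cdME cdBE cdME cE; split.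
    move=> /eqP; rewrite mulf_eq0 subr_eq0 => /orP[/eqP vb|/eqP/hE[d ds vd]].
      by exists b => //; exact: mem_head.
    by exists d => //; rewrite inE ds orbT.
  move=> [d]; rewrite inE => /orP[/eqP ->|ds] vd; first by rewrite vd subrr mul0r.
  by rewrite (_ : h y = 0) ?mulr0//; apply/hE; exists d.
exists v, h, u => a; split=> [Va|as_ q q0].
  have [q q0 qP] := finite_gap s a.
  have [y [_ [/hE[b bs vb] [uy]]]] := Va q q0.
  by move=> /(abslt_quotient _ _ _ uy); rewrite vb mulfK// => /(qP b bs) <-.
have [d d0 dP] := bx z (oball_center _ r0) q q0.
(* The value [a] is reached by the displacement (k, a k) of (u, v), so both k and a k have to be
   small. *)
have [d' d'0 d'P] : exists2 d', d' != 0 & forall b, abslt b d' -> abslt b d /\ abslt (a * b) d.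
  have [->|a0] := eqVneq a 0.
    by exists d => // b bd; rewrite mul0r; split=> //; exact: abslt0.
  have [d' d'0 d'P] := abslt_min d0 (mulf_neq0 (invr_neq0 a0) d0).
  exists d' => // b /d'P[bd /(abslt_scale a0)]; rewrite mulVKf//.
have [k k0 /d'P[kd akd]] := ex_abslt d'0.
have [l|y [_ zy yE]] := dP (fun l => if l == i then k else if l == j then a * k else 0).
  by case: eqP => // _; case: eqP => // _; exact: abslt0.
have uy : u y = k by rewrite uE yE// eqxx addrAC subrr add0r.
have vy : v y = a * k.
  by rewrite vE yE// eq_sym (negPf ij) eqxx addrAC subrr add0r.
exists y; split=> //; split; first by apply/hE; exists a; rewrite // vy uy.
rewrite vy uy subrr; split=> //; apply: abslt0; exact: mulf_neq0.
Qed.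

End Clusters.

(** * Power classes, and cluster sets from one free coordinate *)

Section PowerClasses.
Variable K : ovField.
Implicit Types a b q z : K.

Definition absim a b : Prop := absle a b /\ absle b a.

(* [power_class j a] says that a <> 0 and |a| is a 2^j-th power. *)
Fixpoint power_class j a : Prop :=
  if j is j'.+1 then exists z, power_class j' z /\ absim a (z * z) else a != 0.

Lemma absim_refl a : absim a a.
Proof. by split; exact: absle_refl. Qed.

Lemma absim_sym a b : absim a b -> absim b a.
Proof. by case. Qed.

Lemma absim_trans b a c : absim a b -> absim b c -> absim a c.
Proof. by move=> [ab ba] [bc cb]; split; [exact: absle_trans bc|exact: absle_trans ba]. Qed.

Lemma absim_sqr a b : absim (a * a) (b * b) -> absim a b.
Proof.
suff H (c d : K) : absle (c * c) (d * d) -> absle c d by move=> [/H ? /H ?].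
move=> cd; apply/absleNgt => dc; move/absleNgt: cd; apply.
exact: absltM dc (abslt_absle dc) (abslt_neq0 dc).
Qed.

Lemma power_class_neq0 j a : power_class j a -> a != 0.
Proof.
elim: j a => [//|j IH] a [z [/IH z0 [_ H]]].
by apply: absle_neq0 H _; rewrite mulf_neq0.
Qed.

Lemma power_class_sim j a b : absim a b -> power_class j a -> power_class j b.
Proof.
case: j => [[ab _] a0|j ab [z [zj az]]]; first exact: absle_neq0 a0.
by exists z; split=> //; exact: absim_trans (absim_sym ab) az.
Qed.

Lemma power_classS j a : power_class j.+1 a -> power_class j a.
Proof.
elim: j a => [|j IH] a; first exact: power_class_neq0.
by move=> [z [/IH zj az]]; exists z.
Qed.

(** For j = 0 take q = z^2 pi, which is not a square up to absolute value because [pi] is not;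
    squaring [q] passes from [j] to j + 1. Choosing [z], respectively [q], small keeps the result
    below |r|. *)
Lemma ex_power_class j r (pi : K) : pi != 0 -> (forall z : K, ~ absim pi (z * z)) ->
  r != 0 -> exists2 q, abslt q r & power_class j q /\ ~ power_class j.+1 q.
Proof.
move=> pi0 npi; elim: j r => [|j IH] r r0.
  have [s s0 sP] := abslt_min3 r0 (oner_neq0 K) (invr_neq0 pi0).
  have [z z0 /sP[zr z1 zpi]] := ex_abslt s0.
  exists (z * (z * pi)).
    rewrite -[r]mulr1; apply: absltM zr _ (oner_neq0 _).
    by rewrite -(mulVf pi0); apply: absleM (absle_refl _); exact: abslt_absle.
  split; first by rewrite /= !mulf_neq0.
  move=> [w [w0 [H1 H2]]]; apply: (npi (w / z)).
  have E : w / z * (w / z) = w * w / (z * z) by rewrite mulrACA -invfM.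
  have zz0 : z * z != 0 by rewrite mulf_neq0.
  have E' : z * (z * pi) = pi * (z * z) by rewrite mulrA mulrC.
  by rewrite E; split; apply/(absle_mul2r _ _ zz0); rewrite divfK// -E'.
have [s s0 sP] := abslt_min r0 (oner_neq0 K).
have [q /sP[qr q1] [qj nqj]] := IH s s0; exists (q * q).
  by rewrite -[r]mulr1; exact: absltM qr (abslt_absle q1) (oner_neq0 _).
split; first by exists q; split=> //; exact: absim_refl.
move=> [z [zj /absim_sqr qz]]; apply: nqj.
exact: (@power_class_sim j.+1 _ _ (absim_sym qz) zj).
Qed.

End PowerClasses.

Section UltrametricClusters.
Variables (K : ovField) (L : language) (S : structure L K) (m : nat).
Variables (X : defset (expansion S) m) (x0 : dset X).
Local Notation KK := (expansion S).
Local Notation R := (cdfun X).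
Implicit Types (c f g h p t u e : R) (x y z : dset X) (a b r s : K).

Hypothesis ultra : forall a b : K, abslt (b - a) a -> absim a b.

Lemma envdef_power_class j T : envfun KK T ->
  envdef KK (fun v : nat -> K => power_class j (T v)).
Proof.
elim: j T => [|j IH] T dT; first exact: kdef_neq0.
apply: (envdef_ex (Q := fun (z : K) (v : nat -> K) => power_class j z /\ absim (T v) (z * z))).
apply: envdef_and; first exact/IH/envfun_var.
have dz : envfun KK (fun v => v 0%N * v 0%N) by apply: kfun_mul; exact: envfun_var.
by apply: envdef_and; apply: kdef_absle => //; exact: envfun_shift.
Qed.

(** Induction on [s]: the value [b] is used where |u| is not a 2^(j+1)-th power, and the function
    for the other values, built with j + 1, where it is. Power classes are locally constant where
    [u] is non-zero, and both functions vanish with [u], so the gluing is continuous. *)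
Lemma cd_glue (pi : K) u (s : seq K) j : pi != 0 -> (forall z : K, ~ absim pi (z * z)) ->
  s != [::] -> exists g, (forall y, exists2 b, b \in s & g y = b * u y) /\
    forall b, b \in s -> forall r, r != 0 -> exists q,
      [/\ abslt q r, power_class j q & forall y, u y = q -> g y = b * q].
Proof.
move=> pi0 npi; elim: s j => [//|b s IH] j _.
have [c cE] := cd_cst x0 b.
have [->|s0] := eqVneq s [::].
  exists (c * u); split=> [y|d].
    by exists b; [exact: mem_head|rewrite cdME cE].
  rewrite inE => /eqP -> r r0; have [q qr [qj _]] := ex_power_class j pi0 npi r0.
  by exists q; split=> // y uq; rewrite cdME cE uq.
have [g' [g's g'P]] := IH j.+1 s0.
have dP : envdef KK (fun v : nat -> K => power_class j.+1 (u (totpt x0 (\row_(i < m) v i)))).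
  by apply: envdef_power_class; exact/kfun_cd/envpt_var.
have [x|g gE] := cd_if (P := fun y => power_class j.+1 (u y))
    (f := g') (g := c * u) dP.
  have [ux|ux] := eqVneq (u x) 0.
    by left; have [d _ ->] := g's x; rewrite cdME ux !mulr0.
  have [r r0 rP] := @cd_near _ _ _ _ _ u x _ ux; right; exists r => // y /rP/ultra yx.
  by split; apply: power_class_sim => //; exact: absim_sym.
exists g; split=> [y|d].
  have [g1 g2] := gE y; have [/g1 ->|/g2 ->] := pselect (power_class j.+1 (u y)).
    by have [d ds ->] := g's y; exists d; rewrite // inE ds orbT.
  by exists b; [exact: mem_head|rewrite cdME cE].
rewrite inE => /orP[/eqP ->|ds] r r0.
  have [q qr [qj nqj]] := ex_power_class j pi0 npi r0.
  by exists q; split=> // y uq; rewrite (gE y).2 ?uq// cdME cE uq.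
have [q [qr qj qP]] := g'P d ds r r0.
exists q; split=> //; first exact: power_classS.
by move=> y uq; rewrite (gE y).1 ?uq//; exact: qP.
Qed.

Lemma ultrametric_has_cluster_sets (pi : K) z r (I : {set 'I_m}) :
  pi != 0 -> (forall w : K, ~ absim pi (w * w)) -> box z r I -> (0 < #|I|)%N ->
  has_cluster_sets z.
Proof.
move=> pi0 npi [r0 bx] /card_gt0P[i iI] s s0.
have [u uE] : exists u : R, forall y, u y = val y 0 i - val z 0 i.
  have [v vE] := cd_coord x0 i; have [c cE] := cd_cst x0 (val z 0 i).
  by exists (v - c) => y; rewrite cdBE vE cE.
have [g [gs gP]] := cd_glue u 0 pi0 npi s0.
(* With [h] the zero function, no condition restricts the points y. *)
exists g, 0, u => a; split=> [Va|as_ q q0].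
  have [q q0 qP] := finite_gap s a.
  have [y [_ [_ [uy]]]] := Va q q0; have [b bs ->] := gs y.
  by move=> /(abslt_quotient _ _ _ uy); rewrite mulfK// => /(qP b bs) <-.
have [d d0 dP] := bx z (oball_center _ r0) q q0.
have [k [kd /= k0 kP]] := gP a as_ d d0.
have [l|y [_ zy yE]] := dP (fun l => if l == i then k else 0).
  by case: eqP => // _; exact: abslt0.
have uy : u y = k by rewrite uE yE// eqxx addrAC subrr add0r.
exists y; split=> //; split; first by [].
rewrite uy (kP y uy) subrr; split=> //; apply: abslt0; exact: mulf_neq0.
Qed.

End UltrametricClusters.

(** The integer 1 is not of the form h + h. That such an element exists is a first-order sentence,
    so it holds in the value group, and any [pi] with that value works. *)
Lemma condZ_nonsquare (K : ovField) (L : language) (S : structure L K) : condZ S ->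
  (forall a b : K, abslt (b - a) a -> absim a b) /\
  exists2 pi : K, pi != 0 & forall z : K, ~ absim pi (z * z).
Proof.
case: K S => [F|F v] S //= [eqv _]; split; first exact: valued_ultrametric.
(* Under both quantifiers, index 1 is the element g and index 0 its would-be half h. *)
pose phi : formula Logroup 0 := FEx (FNot (FEx (FEq (TVar Logroup (1 : 'I_2))
  (TApp (f := tt : Defs.fsym Logroup) (fun=> TVar Logroup (0 : 'I_2)))))).
have phiE (G : porderZmodType) (d : 'rV[G]_0) :
    holds (ogroup G) phi d <-> exists g : G, forall h, g <> h + h.
  have E (g h : G) (M := row_mx (const_mx h : 'rV_1) (row_mx (const_mx g : 'rV_1) d)) :
      M 0 (0 : 'I_2) = h /\ M 0 (1 : 'I_2) = g.
    have -> : (0 : 'I_2) = lshift _ 0 :> 'I_(1 + (1 + 0)) by exact: val_inj.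
    have -> : (1 : 'I_2) = rshift 1 (lshift 0 0) :> 'I_(1 + (1 + 0)) by exact: val_inj.
    by rewrite /M row_mxEl row_mxEr row_mxEl !mxE.
  rewrite /=; split=> -[g H]; exists g.
    by move=> h gE; apply: H; exists h; have := E g h; rewrite /= !mxE => -[-> ->].
  by move=> [h]; have := E g h; rewrite /= !mxE => -[-> ->]; exact: H.
have [g gP] : exists g : vgroup v, forall h, g <> h + h.
  apply/(phiE _ 0)/(eqv phi 0 0)/phiE; exists 1 => h.
  by move=> /(congr1 (fun z : int => odd `|z|%N)); rewrite -mulr2n -mulr_natr abszM oddM andbF.
have [pi pi0 vpi] := vval_surj g; exists pi => // z.
move=> [H1 H2]; have zz0 : z * z != 0 := absle_neq0 H1 pi0.
have z0 : z != 0 by move: zz0; rewrite mulf_eq0 orbb.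
apply: (gP (vval v z)); rewrite -vpi -(@vvalM F v)//.
move/(@absle_valuedE F v _ _ zz0): H1 => [/eqP|H1]; first by rewrite (negPf pi0).
move/(@absle_valuedE F v _ _ pi0): H2 => [/eqP|H2]; first by rewrite (negPf zz0).
by apply/le_anti; rewrite H1 H2.
Qed.

(** * Definability in the ring (C(X), B) *)

Section RingDefinable.
Variables (K : ovField) (L : language) (S : structure L K) (m : nat).
Variables (X : defset (expansion S) m) (x0 : dset X).
Local Notation R := (cdfun X).
Local Notation RR := (cdring X).
Implicit Types (T U V : (nat -> R) -> R).

Lemma rfun_add T U : envfun RR T -> envfun RR U -> envfun RR (fun v => T v + U v).
Proof. exact/envfun_op2/ringpred_addP. Qed.

Lemma rfun_sub T U : envfun RR T -> envfun RR U -> envfun RR (fun v => T v - U v).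
Proof. exact/(envfun_op2 (op := fun f g => f - g))/ringpred_subP. Qed.

Lemma rfun_mul T U : envfun RR T -> envfun RR U -> envfun RR (fun v => T v * U v).
Proof. exact/envfun_op2/ringpred_mulP. Qed.

Lemma rdef_disj T U : envfun RR T -> envfun RR U -> envdef RR (fun v => disj (T v) (U v)).
Proof.
apply: envdef_rel2.
apply: (envdef_ex (Q := fun a v => exists b, a * v 0%N + b * v 1%N = 1)).
apply: (envdef_ex (Q := fun b v => v 0%N * v 1%N + b * v 2%N = 1)).
apply: envdef_eq; last exact: envfun_cst.
by apply: rfun_add; apply: rfun_mul; exact: envfun_var.
Qed.

Lemma rdef_zsub T U : envfun RR T -> envfun RR U -> envdef RR (fun v => zsub (T v) (U v)).
Proof.
apply: envdef_rel2.
apply: (envdef_all (Q := fun g v => disj g (v 1%N) -> disj g (v 0%N))).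
by apply: envdef_imp; apply: rdef_disj; exact: envfun_var.
Qed.

Lemma rdef_ispt T : envfun RR T -> envdef RR (fun v => ispt (T v)).
Proof.
apply: envdef_rel1; apply: envdef_and.
  by apply/envdef_not/rdef_disj; exact: envfun_var.
apply: (envdef_all (Q := fun g v => zsub g (v 0%N) -> ~ disj g g -> zsub (v 0%N) g)).
apply: envdef_imp; first by apply: rdef_zsub; exact: envfun_var.
apply: envdef_imp; last by apply: rdef_zsub; exact: envfun_var.
by apply/envdef_not/rdef_disj; exact: envfun_var.
Qed.

(* The point of [X] coded by [p], with the junk value [x0] if [p] is not a code. *)
Definition point_of_code (p : R) : dset X :=
  if pselect (ispt p) then xget x0 [set x | p x = 0] else x0.

Lemma point_of_codeK p x : iscode p x -> point_of_code p = x.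
Proof.
move=> px; rewrite /point_of_code; case: pselect => [pt|npt]; last by case: npt; apply/(isptP x0); exists x.
by apply/px; apply: (@xgetPex _ x0 [set x | p x = 0]); exists x; exact/px.
Qed.

Lemma point_of_code_out p : ~ ispt p -> point_of_code p = x0.
Proof. by rewrite /point_of_code; case: pselect. Qed.

(** At a coded point, vanishing is an inclusion of zero sets. When the variable is not a code, the
    point meant is [x0], and the fixed code [q] of [x0] serves as a parameter. *)
Lemma rdef_eq0 T k : envfun RR T -> envdef RR (fun v => T v (point_of_code (v k)) = 0).
Proof.
move=> dT; have [q qx] := ex_iscode x0 x0.
have zE (f p : R) x : iscode p x -> zsub p f <-> f x = 0.
  move=> px; split=> [/zsubP-/(_ x0) H|fx]; first exact/H/px.
  by apply/(zsubP x0) => y /px ->.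
apply: (envdef_iff (P := fun v => (ispt (v k) /\ zsub (v k) (T v)) \/
   (~ ispt (v k) /\ zsub q (T v)))) => [v|].
  have [pt|npt] := pselect (ispt (v k)).
    have [x px] := (isptP x0 _).1 pt; rewrite (point_of_codeK px) (zE _ _ _ px).
    by split=> [[[]|[]]|]; auto.
  rewrite point_of_code_out// (zE _ _ _ qx).
  by split=> [[[]|[]]|]; auto.
have dk : envdef RR (fun v => ispt (v k)) by apply: rdef_ispt; exact: envfun_var.
apply: envdef_or; apply: envdef_and => //; try exact: envdef_not.
  by apply: rdef_zsub => //; exact: envfun_var.
by apply: rdef_zsub => //; exact: envfun_cst.
Qed.

Lemma rdef_eq T U k : envfun RR T -> envfun RR U ->
  envdef RR (fun v => T v (point_of_code (v k)) = U v (point_of_code (v k))).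
Proof.
move=> dT dU; apply: envdef_iff (rdef_eq0 k (rfun_sub dT dU)) => v.
by rewrite cdBE; split=> [/eqP|->]; rewrite ?subrr// subr_eq0 => /eqP.
Qed.

Lemma rdef_neq0 T k : envfun RR T ->
  envdef RR (fun v => is_true (T v (point_of_code (v k)) != 0)).
Proof.
move=> dT; apply: envdef_iff (envdef_not (rdef_eq0 k dT)) => v.
by split=> /eqP.
Qed.

(** The predicate B enters here: |T(x)| <= |U(x)| iff T(x) = U(x) b(x) for some [b] in B, and a
    constant [b] suffices. *)
Lemma rdef_absle T U k : envfun RR T -> envfun RR U ->
  envdef RR (fun v => absle (T v (point_of_code (v k))) (U v (point_of_code (v k)))).
Proof.
move=> dT dU; apply: (envdef_iff (P := fun v => exists b, cdbounded b /\
    T v (point_of_code (v k)) = (U v * b) (point_of_code (v k)))) => [v|].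
  split=> [[b [bB E]]|[a aO E]]; first by exists (b (point_of_code (v k))).
  by have [b bE] := cd_cst x0 a; exists b; split=> [y|]; rewrite ?cdME bE.
apply: (envdef_ex (Q := fun b v => cdbounded b /\
    T v (point_of_code (v k)) = (U v * b) (point_of_code (v k)))).
apply: envdef_and; first exact: ringpred_predP.
apply: (rdef_eq k.+1 (envfun_shift dT)); apply: rfun_mul; first exact: envfun_shift.
exact: envfun_var.
Qed.

Lemma rdef_abslt T U k : envfun RR T -> envfun RR U ->
  envdef RR (fun v => abslt (T v (point_of_code (v k))) (U v (point_of_code (v k)))).
Proof.
move=> dT dU; apply: envdef_iff (envdef_not (rdef_absle k dU dT)) => v.
exact: iff_sym (absltNge _ _).
Qed.

Lemma rdef_ex (Q : dset X -> (nat -> R) -> Prop) :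
  envdef RR (fun v => Q (point_of_code (v 0%N)) (fun k => v k.+1)) ->
  envdef RR (fun v => exists x, Q x v).
Proof.
move=> dQ; apply: (envdef_iff (P := fun v => exists p, Q (point_of_code p) v)) => [v|].
  split=> [[p Qp]|[x Qx]]; first by exists (point_of_code p).
  by have [p px] := ex_iscode x0 x; exists p; rewrite (point_of_codeK px).
exact: (envdef_ex (Q := fun p v => Q (point_of_code p) v)).
Qed.

Lemma rdef_all (Q : dset X -> (nat -> R) -> Prop) :
  envdef RR (fun v => Q (point_of_code (v 0%N)) (fun k => v k.+1)) ->
  envdef RR (fun v => forall x, Q x v).
Proof.
move=> dQ; apply: (envdef_iff (P := fun v => ~ exists x, ~ Q x v)) => [v|].
  by split=> [H x|H [x]]; [apply: contrapT => nQ; apply: H; exists x|apply].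
apply: envdef_not; apply: (rdef_ex (Q := fun x v => ~ Q x v)).
exact: envdef_not.
Qed.

End RingDefinable.

Ltac rdef := cbv beta; lazymatch goal with
| |- envdef _ (fun v => @?P v /\ @?Q v) => apply: envdef_and; rdef
| |- envdef _ (fun v => @?P v \/ @?Q v) => apply: envdef_or; rdef
| |- envdef _ (fun v => ~ @?P v) => apply: envdef_not; rdef
| |- envdef _ (fun v => @?P v -> @?Q v) => apply: envdef_imp; rdef
| |- envdef _ (fun v => is_true (@?T v != 0)) => apply: rdef_neq0; rdef
| |- envdef _ (fun v => @?T v = 0) => apply: rdef_eq0; rdef
| |- envdef _ (fun v => @?T v = @?U v) => apply: rdef_eq; rdef
| |- envdef _ (fun v => absle (@?T v) (@?U v)) => apply: rdef_absle; rdef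
| |- envdef _ (fun v => abslt (@?T v) (@?U v)) => apply: rdef_abslt; rdef
| |- envdef _ (fun v => exists f : cdfun _, @?P v f) => apply: envdef_ex; rdef
| |- envdef _ (fun v => forall f : cdfun _, @?P v f) => apply: envdef_all; rdef
| x0 : set_type _ |- envdef _ (fun v => exists x : set_type _, @?P v x) =>
    apply: (rdef_ex (x0 := x0)); rdef
| x0 : set_type _ |- envdef _ (fun v => forall x : set_type _, @?P v x) =>
    apply: (rdef_all (x0 := x0)); rdef
| |- envfun _ (fun v => @?T v - @?U v) => apply: rfun_sub; rdef
| |- envfun _ (fun v => @?T v + @?U v) => apply: rfun_add; rdef
| |- envfun _ (fun v => @?T v * @?U v) => apply: rfun_mul; rdef
| |- envfun _ (fun v => v _) => exact: envfun_var
| |- envfun _ (fun=> ?c) => exact: envfun_cst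
| |- _ => idtac
end.

(** * Definability of local dimension and of the orbit formula *)

Section FormulasDefinable.
Variables (K : ovField) (L : language) (S : structure L K) (m : nat).
Variables (X : defset (expansion S) m) (x0 : dset X).
Local Notation R := (cdfun X).
Local Notation RR := (cdring X).

Lemma rdef_chain j : envdef RR (fun v => chain j (v 0%N) (v 1%N) (v 2%N)).
Proof.
elim: j => [|j IH]; first by rewrite /chain /nbd /=; rdef.
(* The recursive clause of [chain], with conjunctions nested as [rdef] expects. *)
pose Q (h' : R) (v : nat -> R) :=
  (forall y, abslt (v 1%N y) (v 2%N y) -> h' y = 0 -> v 0%N y = 0) /\
  ((forall y, abslt (v 1%N y) (v 2%N y) -> h' y = 0 ->
      forall p' e' : R, p' y = 0 -> e' y != 0 -> exists z : dset X,
        abslt (v 1%N z) (v 2%N z) /\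
        (abslt (p' z) (e' z) /\ (v 0%N z = 0 /\ h' z != 0))) /\
   chain j h' (v 1%N) (v 2%N)).
apply: (envdef_iff (P := fun v => exists h', Q h' v)) => [v|].
  split=> [[h' [H1 [H2 H3]]]|[h' [H1 H2 H3]]]; exists h'.
    split=> // y py hy p' e' p'y e'y.
    by have [z [? [? []]]] := H2 y py hy p' e' p'y e'y; exists z.
  split=> //; split=> // y py hy p' e' p'y e'y.
  by have [z []] := H2 y py hy p' e' p'y e'y; exists z.
apply: envdef_ex; rewrite /Q; rdef.
by apply: (envdef_rel3 IH); exact: envfun_var.
Qed.

Lemma rdef_locdim j k : envdef RR (fun v => locdim_formula j (point_of_code x0 (v k))).
Proof.
rewrite /locdim_formula /nbd /=; rdef.
by apply: (envdef_rel3 (rdef_chain j)); rdef.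
Qed.

Lemma rdef_orbit (al be b : R) k l :
  envdef RR (fun v => orbit_formula al be b (point_of_code x0 (v k)) (v l)).
Proof. by rewrite /orbit_formula /cluster_value; rdef. Qed.

End FormulasDefinable.

(** * Continuous functions with values in a union of two orbits *)

Section OrbitValued.
Variables (K : ovField) (L : language) (S : structure L K) (m : nat).
Variables (X : defset (expansion S) m) (x0 : dset X).
Local Notation KK := (expansion S).
Local Notation R := (cdfun X).
Local Notation RR := (cdring X).

Hypothesis cD : condDim KK.
Hypothesis fin : forall A : set K, definable1 KK A ->
  closed A -> ovbounded A -> A `<=` isolated A -> finite_set A.

Definition adherent (Y : set K) (a : K) : Prop :=
  forall r : K, r != 0 -> exists2 y, Y y & abslt (y - a) r.

(** In the applications [T] and [T'] are inverse to each other and [b] is 1 or 0, so that [Y] is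
    tau^Z or tau Z. The proviso in [Ycl] is there because 0 may adhere to tau^Z without lying in
    it. *)
Variables (Y : set K) (al be al' be' b : K).
Let T a := al * a + be.
Let T' a := al' * a + be'.
Hypothesis Tinj : injective (fun n => iter n T b).
Hypothesis T'inj : injective (fun n => iter n T' b).
Hypothesis YE : forall a, Y a <->
  (exists n, a = iter n T b) \/ (exists n, a = iter n T' b).
Hypothesis Ycl : forall a, Y 0 \/ a != 0 -> adherent Y a -> Y a.

(** The orbit formula is asked at points z arbitrarily close to x rather than at x, since all
    cluster sets are only known to exist at such z. By continuity f(x) then adheres to [Y], and
    [Ycl] puts it in [Y]. *)
Lemma Cvalued_definable (D : set 'rV[K]_m) :
  (forall k, envdef RR (fun v => D (val (point_of_code x0 (v k))))) ->
  (forall (x : dset X) (p e : R), D (val x) -> p x = 0 -> e x != 0 ->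
     exists z, [/\ nbd p e z, D (val z) & has_cluster_sets z]) ->
  definable1 RR (@Cvalued K L S m X D Y).
Proof.
move=> dD good.
have [A AE] := cd_cst x0 al; have [B BE] := cd_cst x0 be.
have [A' A'E] := cd_cst x0 al'; have [B' B'E] := cd_cst x0 be'.
have [C CE] := cd_cst x0 b.
have sound (f : R) z : orbit_formula A B C z f \/ orbit_formula A' B' C z f -> Y (f z).
  move=> H; apply/YE; case: H => H; [left|right].
    have := orbit_formula_sound x0 fin _ H; rewrite AE BE CE; exact.
  have := orbit_formula_sound x0 fin _ H; rewrite A'E B'E CE; exact.
have complete (f : R) z : has_cluster_sets z -> Y (f z) ->
    orbit_formula A B C z f \/ orbit_formula A' B' C z f.
  move=> hz /YE[[n fz]|[n fz]]; [left|right].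
    by apply: (orbit_formula_complete x0 (n := n)) => //; rewrite AE BE CE.
  by apply: (orbit_formula_complete x0 (n := n)) => //; rewrite A'E B'E CE.
apply: (envdef_definable1 0).
apply: (envdef_iff (P := fun (v : nat -> R) => forall x : dset X,
   (D (val x) -> (Y 0 \/ v 0%N x != 0) /\
      forall p e : R, p x = 0 -> e x != 0 -> exists z, abslt (p z) (e z) /\
        (orbit_formula A B C z (v 0%N) \/ orbit_formula A' B' C z (v 0%N))) /\
   (~ D (val x) -> v 0%N x = 0))) => [v|]; last first.
  rdef; try exact: dD; try exact: envdef_prop; exact: rdef_orbit.
have vc x r : r != 0 -> exists2 s, s != 0 & forall y : dset X,
  oball (val x) s (val y) -> abslt (v 0%N y - v 0%N x) r by exact: cd_near.
split=> [H x|H x]; have [Dx nDx] := H x; split=> // xD.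
  have [Y0 Hx] := Dx xD; apply: Ycl => // r r0.
  have [s s0 sP] := vc x r r0.
  have [p [e [px _ ex pe]]] := ex_nbd x0 x s0.
  have [z [pz /sound Yz]] := Hx p e px ex.
  by exists (v 0%N z) => //; exact/sP/pe.
split=> [|p e px ex].
  by have [v0|] := eqVneq (v 0%N x) 0; [left; rewrite -v0; exact: Dx|right].
have [z [pz Dz hz]] := good x p e xD px ex.
by exists z; split=> //; apply: complete => //; have [+ _] := H z; exact.
Qed.

Variable k0 : nat.
Hypothesis hk : forall (z : dset X) r (I : {set 'I_m}),
  box z r I -> (k0 <= #|I|)%N -> has_cluster_sets z.

(** [z] is the centre of a box inside a small ball at [x]. The last clause transfers upper bounds on
    dimension from [x] to [z]. *)
Lemma locdim_ge_good k (x : dset X) r (p e : R) : (k0 <= k)%N ->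
  r != 0 -> locdim_ge (dset X) k (val x) -> p x = 0 -> e x != 0 ->
  exists z, [/\ nbd p e z, has_cluster_sets z, locdim_ge (dset X) k (val z) &
    exists2 s, s != 0 & oball (val z) s `&` dset X `<=` oball (val x) r `&` dset X].
Proof.
move=> k0k r0 xk px ex; have [s s0 sP] := nbd_center px ex.
have [t t0 tP] := oball_min m r0 s0.
have [z [u [I [xz bx kI ut]]]] := ex_box x0 cD t0 (xk t t0).
exists z; split; first by apply: sP; have [] := tP _ _ xz.
- by apply: hk bx _; exact: leq_trans kI.
- exact: (box_locdim_ge x0 cD bx kI).
- exists u; first exact: bx.1.
  move=> y [zy Xy]; split=> //; rewrite -(totpt_in x0 Xy).
  by have [] := tP _ _ (ut (totpt x0 y) _); rewrite ?totpt_in.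
Qed.

Lemma Ceq_definable k : (k0 <= k)%N -> definable1 RR (Ceq X k Y).
Proof.
move=> k0k; have DP (x : dset X) : Delta k (dset X) (val x) <->
    locdim_formula k x /\ ~ locdim_formula k.+1 x.
  by rewrite !(locdim_formulaP x0)//; exact/DeltaP/set_valP.
apply: Cvalued_definable => [i|x p e].
  apply: (envdef_iff (P := fun v => locdim_formula k (point_of_code x0 (v i)) /\
     ~ locdim_formula k.+1 (point_of_code x0 (v i)))) => [v|].
    exact: iff_sym (DP _).
  by apply: envdef_and; [|apply: envdef_not]; exact: rdef_locdim.
move=> /(DeltaP _ (set_valP x))[xk nxk] px ex.
(* A ball at [x] whose trace has dimension at most [k] bounds the local dimension at every [z] with
   a ball inside it. *)
have [r r0 rP] : exists2 r, r != 0 & ~ (natdim k.+1 <= tdim (oball (val x) r `&` dset X))%E.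
  apply: contrapT => H; apply: nxk => r r0; apply: contrapT => H'.
  by apply: H; exists r.
have [z [pz hz zk [s s0 sr]]] := locdim_ge_good k0k r0 xk px ex.
exists z; split=> //; apply/(DeltaP _ (set_valP z)); split=> // zk1; apply: rP.
exact: le_trans (zk1 s s0) (tdim_sub sr).
Qed.

Lemma Cge_definable k : (k0 <= k)%N -> definable1 RR (Cge X k Y).
Proof.
move=> k0k; have DP (x : dset X) :
    (\bigcup_(l in [set l | (k <= l)%N]) Delta l (dset X)) (val x) <-> locdim_formula k x.
  by rewrite (locdim_formulaP x0)//; exact/bigcup_DeltaP/set_valP.
apply: Cvalued_definable => [i|x p e].
  apply: envdef_iff (rdef_locdim x0 k i) => v; exact: iff_sym (DP _).
move=> /(bigcup_DeltaP _ (set_valP x)) xk px ex.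
have [z [pz hz zk _]] := locdim_ge_good k0k (oner_neq0 _) xk px ex.
by exists z; split=> //; apply/(bigcup_DeltaP _ (set_valP z)).
Qed.

End OrbitValued.

(** * The powers of an element are closed away from 0, its multiples everywhere *)

Section Adherence.
Variable K : ovField.
Implicit Types (a b r s : K) (Y : set K).

(** An element y of [Y] within [r] of [a] must be [a]: otherwise [Y] would have an element closer to
    [a] than y, hence a second one within [r]. *)
Lemma adherent_gap Y a : (exists2 r, r != 0 & forall y z, Y y -> Y z ->
    abslt (y - a) r -> abslt (z - a) r -> y = z) ->
  adherent Y a -> Y a.
Proof.
move=> [r r0 rP] ad; have [y Yy ya] := ad r r0.
have [<- //|na] := eqVneq y a; rewrite -subr_eq0 in na.
have [s s0 sP] := abslt_min r0 na; have [z Yz /sP[zr zy]] := ad s s0.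
by move: zy; rewrite (rP y z)// => /abslt_irr.
Qed.

Variable t : K.

Section Powers.
Hypothesis t1 : abslt t 1.
Hypothesis t0 : t != 0.

Lemma expr_absle n : absle (t ^+ n.+1) t.
Proof.
elim: n => [|n IH]; first by rewrite expr1; exact: absle_refl.
by rewrite exprS -[X in absle _ X]mulr1; apply: absleM (absle_refl _)
  (absle_trans IH (abslt_absle t1)).
Qed.

(** All t^(n+1) have absolute value at most |t| < 1, so uniform openness gives one [s] for all [n]:
    if 1 - t^(n+1) were smaller than [s], adding t^(n+1) would give |1| < |1|. *)
Lemma expr_gap : exists2 s, s != 0 & forall n, absle s (1 - t ^+ n.+1).
Proof.
have [s s0 sP] := abslt_open_unif t1; exists s => // n; apply/absleNgt => H.
by have := sP _ _ (expr_absle n) H; rewrite subrKC => /abslt_irr.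
Qed.

Lemma expr_neq1 n : t ^+ n.+1 != 1.
Proof.
have [s s0 sP] := expr_gap; apply/eqP => H.
by have := sP n; rewrite H subrr => /absler0/eqP; rewrite (negPf s0).
Qed.

Lemma expr_inj : injective (fun n => t ^+ n).
Proof.
suff H i j : (i < j)%N -> t ^+ i <> t ^+ j.
  move=> i j ij; have [/H //|/H H'|//] := ltngtP i j.
  by case: H'.
move=> ij /eqP; rewrite -(subnKC ij) addSnnS exprD -{1}[t ^+ i]mulr1.
by rewrite (inj_eq (mulfI (expf_neq0 _ t0))) eq_sym (negPf (expr_neq1 _)).
Qed.

Lemma adherent_intpowers a : a != 0 -> adherent (intpowers t) a -> intpowers t a.
Proof.
move=> a0; apply: adherent_gap; have [s s0 sP] := expr_gap.
have [d d0 dP] := absle_near a0.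
have [u u0 uP] := abslt_split (mulf_neq0 d0 s0).
have [r r0 rP] := abslt_min d0 u0; exists r => // _ _ [i _ <-] [j _ <-].
suff H (k l : int) : k < l -> abslt (t ^ k - a) r -> abslt (t ^ l - a) r -> False.
  move=> yi yj; have [ij|ji|->//] := ltgtP i j; first by case: (H _ _ ij).
  by case: (H _ _ ji).
move=> kl /rP[/dP dk ku] /rP[_ lu].
have [n nE] : exists n : nat, l = k + n.+1%:Z.
  have : 0 < l - k by rewrite subr_gt0.
  case E : (l - k) => [[|n]|n] // _; exists n.
  by rewrite -E addrC subrK.
have := uP _ _ ku (absltN u0 lu); rewrite opprB subrKA => /absltNge; apply.
(* Near [a], |t^k| >= |d|, and |1 - t^(n+1)| >= |s|, so two distinct powers differ there by at least
   |d s|. *)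
have -> : t ^ k - t ^ l = t ^ k * (1 - t ^+ n.+1) by rewrite nE expfzDr// mulrBr mulr1.
exact: absleM.
Qed.

End Powers.

Lemma intpowersV : t != 0 -> intpowers t^-1 = intpowers t.
Proof.
by move=> t0; apply/seteqP; split=> _ [k _ <-]; exists (- k); rewrite ?exprz_inv ?opprK.
Qed.

Lemma intpowersP a : intpowers t a <->
  (exists n, a = t ^+ n) \/ (exists n, a = t^-1 ^+ n).
Proof.
split=> [[[n|n] _ <-]|[[n ->]|[n ->]]].
- by left; exists n.
- by right; exists n.+1; rewrite exprVn.
- by exists n.
- by exists (- n%:Z) => //; rewrite -exprz_inv.
Qed.

Lemma intmultiplesP a : intmultiples t a <->
  (exists n, a = t *+ n) \/ (exists n, a = (- t) *+ n).
Proof.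
split=> [[[n|n] _ <-]|[[n ->]|[n ->]]].
- by left; exists n.
- by right; exists n.+1; rewrite mulNrn.
- by exists n.
- by exists (- n%:Z) => //; rewrite mulrNz mulNrn.
Qed.

Lemma iter_mul n : iter n (fun a => t * a + 0) 1 = t ^+ n.
Proof. by elim: n => [|n IH] //; rewrite iterS IH addr0 -exprS. Qed.

Lemma iter_add n : iter n (fun a => 1 * a + t) 0 = t *+ n.
Proof. by elim: n => [|n IH] //; rewrite iterS IH mul1r mulrS addrC. Qed.

Section Multiples.
Variable s : K.
Hypothesis s0 : s != 0.
Hypothesis gap : forall n, ~ abslt (t *+ n.+1) s.

Lemma mulrn_inj : injective (fun n => t *+ n).
Proof.
suff H i j : (i < j)%N -> t *+ i <> t *+ j.
  move=> i j ij; have [/H //|/H H'|//] := ltngtP i j.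
  by case: H'.
move=> ij /eqP; rewrite -(subnKC ij) addSnnS mulrnDr -{1}[t *+ i]addr0.
rewrite (inj_eq (addrI _)) => /eqP H; apply: (gap (n := (j - i.+1)%N)).
by rewrite -H; exact: abslt0.
Qed.

(** Distinct multiples differ by at least |s|, so a small enough ball contains at most one. *)
Lemma adherent_intmultiples a : adherent (intmultiples t) a -> intmultiples t a.
Proof.
apply: adherent_gap; have [u u0 uP] := abslt_split s0.
exists u => // _ _ [i _ <-] [j _ <-].
suff H (k l : int) : k < l -> abslt (t *~ k - a) u -> abslt (t *~ l - a) u -> False.
  move=> yi yj; have [ij|ji|->//] := ltgtP i j; first by case: (H _ _ ij).
  by case: (H _ _ ji).
move=> kl ku lu.
have [n nE] : exists n : nat, l = k + n.+1%:Z.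
  have : 0 < l - k by rewrite subr_gt0.
  case E : (l - k) => [[|n]|n] // _; exists n.
  by rewrite -E addrC subrK.
have := uP _ _ lu (absltN u0 ku); rewrite opprB subrKA nE mulrzDr addrAC subrr add0r.
exact: gap.
Qed.

End Multiples.
End Adherence.

(** * Orders compatible with addition *)

Section OrderGap.
Variables (K : ovField) (L : language) (S : structure L K).
Local Notation KK := (expansion S).
Implicit Types (a b r s : K).

(** The only projection of K^1 onto a positive power of K is the identity, so positive dimension
    would give a ball inside [P]. *)
Lemma tdim1_interior (P : set K) :
  (forall a, P a -> forall r, r != 0 -> exists2 b, abslt (b - a) r & ~ P b) ->
  (tdim [set x : 'rV[K]_1 | P (x 0%R 0%R)] <= natdim 0)%E.
Proof.
move=> noint; rewrite /tdim; case: ifPn => [_|_]; first exact: leNye.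
rewrite natdim_le; apply/bigmax_leqP => I /asboolP[u].
rewrite leqn0; apply: contraPT; rewrite -lt0n => /card_gt0P[i iI].
rewrite /interior => /nbhs_oballE[r r0 rP].
have [x Px xu] := rP u (oball_center u r0).
have [b bx nPb] := noint _ Px r r0; apply: nPb.
have [y Py yb] : (coord_proj I @` [set x : 'rV[K]_1 | P (x 0 0)])
    (coord_proj I (const_mx b)).
  by apply: rP => j; rewrite -xu !mxE [enum_val j]ord1.
have := congr1 (fun M : 'rV[K]_#|I| => M 0 (enum_rank_in iI i)) yb.
by rewrite !mxE enum_rankK_in// (ord1 i) => <-.
Qed.

(** Without interior, [P] has dimension at most 0. But 0 is in its frontier, as s or -s lies in [P]
    for each small s, and a non-empty frontier has dimension at least 0, against (Dim2). *)
Lemma positive_cone_interior (P : set K) : condDim KK -> definable1 KK P ->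
  ~ P 0 -> (forall a, a != 0 -> P a \/ P (- a)) ->
  exists a r, [/\ P a, r != 0 & forall b, abslt (b - a) r -> P b].
Proof.
move=> cD dP nP0 PN; apply: contrapT => noint.
have d0 := @tdim1_interior P; set A := [set x : 'rV[K]_1 | P (x 0 0)] in d0.
have {}d0 : (tdim A <= natdim 0)%E.
  apply: d0 => a Pa r r0; apply: contrapT => H; apply: noint; exists a, r.
  by split=> // b ba; apply: contrapT => nPb; apply: H; exists b.
have A0 : A !=set0.
  have [P1|P1] := PN 1 (oner_neq0 _); first by exists (const_mx 1); rewrite /A /= mxE.
  by exists (const_mx (- 1)); rewrite /A /= mxE.
have [_ [_ /(_ A0) lt] _] := cD _ A dP.
have : frontier A !=set0.
  exists 0; split; last by rewrite /A /= mxE.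
  move=> B /nbhs_oballE[r r0 rB]; have [s s0 sr] := ex_abslt r0.
  have [Ps|Ps] := PN s s0.
    exists (const_mx s); split; first by rewrite /A /= mxE.
    by apply: rB => i; rewrite !mxE subr0.
  exists (const_mx (- s)); split; first by rewrite /A /= mxE.
  by apply: rB => i; rewrite !mxE subr0; exact: absltN.
move=> /tdim_nat[d dE]; have := lt_le_trans lt d0.
by rewrite dE natdim_lt.
Qed.

(* If [n x] were small for a point [x] in the interior of the positive cone, then
   [x - n x] and [(n - 1) x] would both be non-negative. *)
Lemma additive_order_gap (le : rel K) (t : K) : condDim KK -> additive_order le ->
  definable (ringpred (OO K)) [set x : 'rV[K]_2 | le (x 0 0) (x 0 1)] -> t != 0 ->
  exists2 s, s != 0 & forall n, ~ abslt (t *+ n.+1) s.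
Proof.
move=> cD [[lexx_ lea let_ letot] leD] dle t0.
pose P : set K := [set a | le 0 a /\ a != 0].
have dP : definable1 KK P.
  apply: (envdef_definable1 0); apply: envdef_and; last exact/kdef_neq0/envfun_var.
  have := definable_envdef dle => /(envdef_inl S).
  move=> /(envdef_subst (fun k => if k is 0 then inr 0 else inl 0%N)).
  by apply: envdef_iff => e; rewrite /= !mxE.
have PD a b : P a -> P b -> P (a + b).
  move=> [a0 na] [b0 nb]; have ab : le a (a + b).
    by have := leD _ _ a b0; rewrite add0r addrC.
  split; first exact: let_ ab.
  apply: contra_neq na => ab0; apply: lea; rewrite a0 andbT.
  by rewrite ab0 in ab.
have nP0 : ~ P 0 by move=> [_]; rewrite eqxx.
have PN a : a != 0 -> P a \/ P (- a).
  move=> na; have /orP[a0|a0] := letot 0 a; first by left.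
  right; split; last by rewrite oppr_eq0.
  by have := leD _ _ (- a) a0; rewrite subrr add0r.
have [x [r [Px r0 xr]]] := positive_cone_interior cD dP nP0 PN.
have x0 : x != 0 := Px.2.
(* Division by t/x turns multiples of [t] into multiples of [x], and this bound into [r]. *)
exists (r * (t / x)); first by rewrite !mulf_neq0 ?invr_eq0.
move=> n ns; have nx : abslt (x *+ n.+1) r.
  have tx0 : t / x != 0 by rewrite mulf_neq0 ?invr_eq0.
  apply/(abslt_mul2r _ _ tx0); rewrite mulrnAl [x * _]mulrC divfK//.
have P1 : P (x - x *+ n.+1).
  by apply: xr; rewrite addrAC subrr add0r; exact: absltN.
case: n nx P1 ns => [|n] _; first by rewrite subrr.
move=> P1 _; apply: nP0.
have Pn : P (x *+ n.+1).
  by elim: n {P1} => [|n IH] //; rewrite mulrSr; exact: PD.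
by have := PD _ _ P1 Pn; rewrite mulrS opprD addrA subrr add0r addNr.
Qed.

End OrderGap.

(** * Application to powers and multiples, and conclusion *)

Lemma abslt_or_inv (K : ovField) (t : K) : t != 0 -> ~ abseq t 1 ->
  abslt t 1 \/ abslt t^-1 1.
Proof.
move=> t0 nt; have [t1|[a aO t1]] := absle_total t 1; first by left.
right; apply/absltNge => [[c cO tc]]; apply: nt.
have aE : t^-1 = a by apply: (mulfI t0); rewrite mulfV.
have cE : t = c by apply: (mulfI (invr_neq0 t0)); rewrite mulVf.
by exists t; rewrite ?mul1r//; split=> //; [rewrite cE|rewrite aE].
Qed.

Section Conclusion.
Variables (K : ovField) (L : language) (S : structure L K) (m : nat).
Variables (X : defset (expansion S) m) (x0 : dset X) (t : K).
Local Notation KK := (expansion S).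
Local Notation RR := (cdring X).

Hypothesis cD : condDim KK.
Hypothesis fin : forall A : set K, definable1 KK A ->
  closed A -> ovbounded A -> A `<=` isolated A -> finite_set A.
Hypothesis t0 : t != 0.
Variable k0 : nat.
Hypothesis hk : forall (z : dset X) r (I : {set 'I_m}),
  box z r I -> (k0 <= #|I|)%N -> has_cluster_sets z.

(** The maps are multiplication by [t] and by its inverse, starting from 1. If |t| > 1, the
    estimates on powers are applied to the inverse, which generates the same set. *)
Lemma intpowers_definable : ~ abseq t 1 ->
  (forall k, (k0 <= k)%N -> definable1 RR (Ceq X k (intpowers t))) /\
  definable1 RR (Cge X k0 (intpowers t)).
Proof.
move=> nt1; have V0 : t^-1 != 0 by rewrite invr_eq0.
have injV (u : K) : u != 0 -> injective (fun n => u ^+ n) -> injective (fun n => u^-1 ^+ n).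
  by move=> u0 iu i j; rewrite !exprVn => /invr_inj; exact: iu.
have [it itV] : injective (fun n => t ^+ n) /\ injective (fun n => t^-1 ^+ n).
  have [lt1|lt1] := abslt_or_inv t0 nt1.
    by have it := expr_inj lt1 t0; split=> //; exact: injV.
  have it := expr_inj lt1 V0; split=> //.
  by have := injV _ V0 it; rewrite invrK.
have iT : injective (fun n => iter n (fun a => t * a + 0) 1).
  by move=> i j; rewrite !iter_mul; exact: it.
have iT' : injective (fun n => iter n (fun a => t^-1 * a + 0) 1).
  by move=> i j; rewrite !iter_mul; exact: itV.
have YE a : intpowers t a <-> (exists n, a = iter n (fun a => t * a + 0) 1) \/
    (exists n, a = iter n (fun a => t^-1 * a + 0) 1).
  rewrite intpowersP; split=> -[[n ->]|[n ->]]; [left|right|left|right];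
    by exists n; rewrite iter_mul.
have Ycl a : intpowers t 0 \/ a != 0 -> adherent (intpowers t) a -> intpowers t a.
  move=> [[k _ /eqP]|a0]; first by rewrite expfz_eq0 (negPf t0) andbF.
  have [lt1|lt1] := abslt_or_inv t0 nt1; first exact: adherent_intpowers.
  by rewrite -(intpowersV t0); exact: adherent_intpowers.
split=> [k|]; first exact: (Ceq_definable x0 cD fin iT iT' YE Ycl hk).
exact: (Cge_definable x0 cD fin iT iT' YE Ycl hk).
Qed.

(** The maps are translation by [t] and by -t, starting from 0; [gap] makes the orbits injective and
    the set of multiples closed. *)
Lemma intmultiples_definable (s : K) :
  s != 0 -> (forall n, ~ abslt (t *+ n.+1) s) ->
  (forall k, (k0 <= k)%N -> definable1 RR (Ceq X k (intmultiples t))) /\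
  definable1 RR (Cge X k0 (intmultiples t)).
Proof.
move=> s0 gap.
have iT : injective (fun n => iter n (fun a => 1 * a + t) 0).
  by move=> i j; rewrite !iter_add; exact: (mulrn_inj s0 gap).
have iT' : injective (fun n => iter n (fun a => 1 * a + (- t)) 0).
  by move=> i j; rewrite !iter_add !mulNrn => /oppr_inj; exact: (mulrn_inj s0 gap).
have YE a : intmultiples t a <-> (exists n, a = iter n (fun a => 1 * a + t) 0) \/
    (exists n, a = iter n (fun a => 1 * a + (- t)) 0).
  rewrite intmultiplesP; split=> -[[n ->]|[n ->]]; [left|right|left|right];
    by exists n; rewrite iter_add.
have Ycl a : intmultiples t 0 \/ a != 0 ->
    adherent (intmultiples t) a -> intmultiples t a.
  by move=> _; exact: (adherent_intmultiples s0 gap).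
split=> [k|]; first exact: (Ceq_definable x0 cD fin iT iT' YE Ycl hk).
exact: (Cge_definable x0 cD fin iT iT' YE Ycl hk).
Qed.

End Conclusion.

(** C(X) is then the one-element ring, and membership in [A] is a fixed proposition. The case is
    separate because coding of points relies on a default point [x0]. *)
Lemma definable1_empty (K : ovField) (L : language) (S : structure L K) m
    (X : defset (expansion S) m) (A : set (cdfun X)) :
  (dset X -> False) -> definable1 (cdring X) A.
Proof.
move=> X0; apply: (envdef_definable1 0).
apply: envdef_iff (envdef_prop _ (A 0)) => v.
suff -> : v 0%N = 0 by [].
by apply: cdfun_ext => x; case: (X0 x).
Qed.

Theorem theorem6p7 (K : ovField) (L : language) (S : structure L K)
    (m : nat) (X : defset (expansion S) m) (tau : K) :
  condDim (expansion S) ->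
  (forall A : set K, definable1 (expansion S) A ->
     closed A -> ovbounded A -> A `<=` isolated A -> finite_set A) ->
  tau != 0 ->
  (~ abseq tau 1 ->
     ((forall k : nat, (2 <= k)%N ->
         definable1 (cdring X) (Ceq X k (intpowers tau))) /\
      definable1 (cdring X) (Cge X 2 (intpowers tau))) /\
     (condZ (expansion S) ->
        (forall k : nat, (1 <= k)%N ->
           definable1 (cdring X) (Ceq X k (intpowers tau))) /\
        definable1 (cdring X) (Cge X 1 (intpowers tau)))) /\
  ((exists le : rel K, additive_order le /\
      definable (ringpred (OO K)) [set x : 'rV[K]_2 | le (x 0 0) (x 0 1)]) ->
     (forall k : nat, (2 <= k)%N ->
        definable1 (cdring X) (Ceq X k (intmultiples tau))) /\
     definable1 (cdring X) (Cge X 2 (intmultiples tau))).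
Proof.
move=> cD fin tau0.
have [[x0]|X0] := pselect (inhabited (dset X)); last first.
  have all_def A : definable1 (cdring X) A.
    by apply: definable1_empty => x; apply: X0; constructor.
  by do !split.
have box2 (z : dset X) r (I : {set 'I_m}) : box z r I -> (2 <= #|I|)%N -> has_cluster_sets z.
  exact: box_has_cluster_sets.
split=> [nt|[le [leO dle]]].
  split; first exact: (intpowers_definable x0 cD fin tau0 box2).
  (* Under (Z) one free coordinate yields all cluster sets, which lowers the bound on [k] to 1. *)
  move=> /condZ_nonsquare[ultra [pi pi0 npi]].
  apply: (intpowers_definable x0 cD fin tau0) nt => z r I.
  exact: (ultrametric_has_cluster_sets x0 ultra pi0 npi).
have [s s0 gap] := additive_order_gap cD leO dle tau0.
exact: (intmultiples_definable x0 cD fin box2 s0 gap).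
Qed.
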